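(* The process $(\theta_t)_{t\ge 0}$ is a Feller process on $(\mathcal M_2,d_2)$, in the following sense: for every $t\ge 0$ and every bounded continuous function $F:\mathcal M_2\to\mathbb R$, the function $\mathcal P_tF:\mathcal M_2\to\mathbb R$, $\mathcal P_tF(\eta)=\mathbb E\big(F(\theta_t)\,\big|\,\theta_0=\eta\big)$, is bounded and continuous.
   Context: Branching Brownian motion (BBM) started from $0$: a single particle starts at $0$ at time $0$, moves as a standard Brownian motion on $\mathbb R$ and splits at rate one into two particles, which then evolve independently by the same rules. The number of particles at time $t$ is $n(t)$, with positions $\chi_1(t),\dots,\chi_{n(t)}(t)$. $\mathcal M$ is the space of integer-valued locally finite measures on $\mathbb R$. Write $\langle h,\eta\rangle=\int h\,d\eta$. Let $C_0^+(\mathbb R)$ be the set of compactly supported non-negative continuous functions. Vague convergence $\eta_n\to\eta$ means $\langle h,\eta_n\rangle\to\langle h,\eta\rangle$ for all $h\in C_0^+(\mathbb R)$. There is a countable sequence $(h_k)_{k\ge1}\subset C_0^+(\mathbb R)$ such that it suffices to test on $(h_k)$, and $d(\eta_1,\eta_2)=\sum_{k\ge1}2^{-k}(|\langle h_k,\eta_1\rangle-\langle h_k,\eta_2\rangle|\wedge1)$ metrizes vague convergence. $\mathcal M_2$ is the set of $\eta\in\mathcal M$ with $\eta\neq0$, $\eta([0,\infty))<\infty$ and $\lim_{m\to\infty}\frac1{m^2}\log(\eta([-m,-m+1])\vee1)=0$. For $\eta=\sum_{i\in I}\delta_{x_i}\ne0$, $\max\eta=\sup_i x_i$. For $k\ge1$,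 $\alpha_k(x)=e^{-x^2/k}$ if $x\le-1$, $\alpha_k(x)=-e^{-1/k}x$ if $-1<x<0$, $\alpha_k(x)=0$ if $x\ge0$. The metric on $\mathcal M_2$ is $d_2(\eta_1,\eta_2)=d(\eta_1,\eta_2)+|\max\eta_1-\max\eta_2|+\sum_{k\ge1}2^{-k}(|\langle\alpha_k,\eta_1\rangle-\langle\alpha_k,\eta_2\rangle|\wedge1)$. The process (BBM with critical drift): given $\theta_0=\sum_{i\in I}\delta_{x_i}\in\mathcal M_2$ ($I$ finite or countable), set $\theta_t=\sum_{i\in I}\sum_{k=1}^{n^i(t)}\delta_{x_i+\chi^i_k(t)-\sqrt2t}$, where $\{\chi^i\}_{i\in I}$ are i.i.d. BBMs started from $0$, independent of $\theta_0$. Almost surely $\theta_t\in\mathcal M_2$, so $\mathcal P_tF$ is well defined. *)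

(* Defs.v *)
From HB Require Import structures.
From mathcomp Require Import all_boot all_order all_algebra.
From mathcomp Require Import all_classical all_reals all_analysis.

Set Implicit Arguments.
Unset Strict Implicit.
Unset Printing Implicit Defensive.

Import Order.TTheory GRing.Theory Num.Theory.
Import numFieldNormedType.Exports.

Local Open Scope classical_set_scope.
Local Open Scope ring_scope.

Notation measure_on_line R := {measure set (measurableTypeR R) -> \bar R}.

Section point_measures.
Context {R : realType}.
Implicit Types eta : measure_on_line R.

Definition locally_finite eta : Prop :=
  forall K : set R, compact K -> (eta K < +oo)%E.

Definition integer_valued eta : Prop :=
  forall A : set (measurableTypeR R), measurable A ->
    eta A = +oo%E \/ exists n : nat, eta A = n%:R%:E.

Definition inM eta : Prop := integer_valued eta /\ locally_finite eta.

Definition pairing (h : R -> R) eta : R := Rintegral eta setT h.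

Definition C0plus (h : R -> R) : Prop :=
  [/\ continuous h, forall x, 0 <= h x & compact (closure [set x | h x != 0])].

Definition vague_cvg (eta_ : nat -> measure_on_line R) eta : Prop :=
  forall h, C0plus h -> (fun n => pairing h (eta_ n)) @ \oo --> pairing h eta.

(* [h k] is the test function of index k + 1, here and in [vague_dist]. *)
Definition vague_test_sequence (h : nat -> R -> R) : Prop :=
  (forall k, C0plus (h k)) /\
  forall (eta_ : nat -> measure_on_line R) eta,
    (forall n, inM (eta_ n)) -> inM eta ->
    (forall k, (fun n => pairing (h k) (eta_ n)) @ \oo --> pairing (h k) eta) ->
    vague_cvg eta_ eta.

Definition inM2 eta : Prop :=
  [/\ inM eta,
      (eta [set: R] != 0)%E,
      (eta `[0%R, +oo[%classic < +oo)%E &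
      (fun m : nat =>
         ln (Num.max (fine (eta `[- m%:R, - m%:R + 1]%classic)) 1) / m%:R ^+ 2 : R)
        @ \oo --> (0 : R)].

Definition max_atom eta : R := sup [set x : R | (0 < eta [set x])%E].

Definition alpha (k : nat) (x : R) : R :=
  if x <= -1 then expR (- (x ^+ 2 / k%:R))
  else if x < 0 then - expR (- k%:R^-1) * x else 0.

(* \sum_(k >= 1) 2 ^ (- k) * (`|< f_k, eta1 > - < f_k, eta2 >| /\ 1), where
   [f k] is the function of index k + 1. *)
Definition test_dist (f : nat -> R -> R) eta1 eta2 : R :=
  limn (series (fun k : nat => 2 ^- k.+1 *
    Num.min `|pairing (f k) eta1 - pairing (f k) eta2| 1)).

Definition vague_dist (h : nat -> R -> R) eta1 eta2 : R :=
  test_dist h eta1 eta2.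

Definition dist2 (h : nat -> R -> R) eta1 eta2 : R :=
  vague_dist h eta1 eta2 + `|max_atom eta1 - max_atom eta2|
  + test_dist (fun k => alpha k.+1) eta1 eta2.

Lemma cvg_test_dist f eta1 eta2 : cvgn (series (fun k : nat => 2 ^- k.+1 *
    Num.min `|pairing (f k) eta1 - pairing (f k) eta2| 1 : R)).
Proof.
apply: (@series_le_cvg _ _ (geometric 1 (2^-1 : R))).
- by move=> n; rewrite mulr_ge0 ?invr_ge0 ?exprn_ge0// le_min normr_ge0 ler01.
- by move=> n; rewrite /geometric/= mul1r exprn_ge0// invr_ge0.
- move=> n; rewrite /geometric/= mul1r.
  rewrite (@le_trans _ _ (2 ^- n.+1))//.
    by rewrite ler_piMr ?invr_ge0 ?exprn_ge0// ge_min lexx orbT.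
  rewrite -exprVn exprS ler_piMl ?exprn_ge0 ?invr_ge0//.
  by rewrite invf_le1// ler1n.
- apply: is_cvg_geometric_series.
  by rewrite ger0_norm ?invr_ge0// invf_lt1// ltr1n.
Qed.

Lemma test_distxx f eta : test_dist f eta eta = 0.
Proof.
rewrite /test_dist; apply: cvg_lim => //.
rewrite (_ : series _ = fun=> 0); first exact: cvg_cst.
apply/funext => n; rewrite /series/= big1// => k _.
by rewrite subrr normr0 min_l ?mulr0.
Qed.

Lemma test_distC f eta1 eta2 : test_dist f eta1 eta2 = test_dist f eta2 eta1.
Proof.
rewrite /test_dist; congr (limn (series _)); apply/funext => k.
by rewrite distrC.
Qed.

Lemma test_distD f eta1 eta2 eta3 :
  test_dist f eta1 eta3 <= test_dist f eta1 eta2 + test_dist f eta2 eta3.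
Proof.
rewrite /test_dist -limD; [|exact: cvg_test_dist..].
apply: ler_lim; [exact: cvg_test_dist|by apply: is_cvgD; exact: cvg_test_dist|].
apply: nearW => n; rewrite fctE /series/= -big_split/= ler_sum// => k _.
rewrite -mulrDr ler_wpM2l ?invr_ge0 ?exprn_ge0//.
set a := pairing _ eta1; set b := pairing _ eta2; set c := pairing _ eta3.
have abc := ler_distD b a c.
have [|] := leP `|a - b| 1; have [|] := leP `|b - c| 1 => h1 h2.
- by rewrite (le_trans _ abc)// ge_min lexx.
- by rewrite ge_min lerDr normr_ge0 orbT.
- by rewrite ge_min lerDl normr_ge0 orbT.
- by rewrite ge_min lerDl ler01 orbT.
Qed.

Lemma dist2xx h eta : dist2 h eta eta = 0.
Proof. by rewrite /dist2 /vague_dist !test_distxx subrr normr0 !addr0. Qed.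

Lemma dist2C h eta1 eta2 : dist2 h eta1 eta2 = dist2 h eta2 eta1.
Proof. by rewrite /dist2 /vague_dist !(test_distC _ eta1) distrC. Qed.

Lemma dist2D h eta1 eta2 eta3 :
  dist2 h eta1 eta3 <= dist2 h eta1 eta2 + dist2 h eta2 eta3.
Proof.
rewrite /dist2 addrACA (addrACA (vague_dist _ _ _)).
by rewrite !lerD ?test_distD// ler_distD.
Qed.

End point_measures.

(* [M2 h] carries the topology of [dist2 h], which is only a pseudometric here
   because [measure_on_line R] distinguishes measures that differ only on
   non-measurable sets. *)

Record M2 (R : realType) (h : nat -> R -> R) := mkM2 {
  M2_measure :> measure_on_line R ;
  M2P : inM2 M2_measure }.

HB.instance Definition _ (R : realType) (h : nat -> R -> R) :=
  gen_eqMixin (M2 h).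
HB.instance Definition _ (R : realType) (h : nat -> R -> R) :=
  gen_choiceMixin (M2 h).

Section M2_topology.
Context {R : realType} (h : nat -> R -> R).

Definition M2_ball (eta : M2 h) (e : R) : set (M2 h) :=
  [set eta' | dist2 h eta eta' < e].

Let ent := entourage_ M2_ball.

HB.instance Definition _ := hasNbhs.Build (M2 h) (nbhs_ ent).

Let M2_ball_center eta e : 0 < e -> M2_ball eta e eta.
Proof. by rewrite /M2_ball/= dist2xx. Qed.

Let M2_ball_sym eta eta' e : M2_ball eta e eta' -> M2_ball eta' e eta.
Proof. by rewrite /M2_ball/= dist2C. Qed.

Let M2_ball_triangle eta1 eta2 eta3 e1 e2 :
  M2_ball eta1 e1 eta2 -> M2_ball eta2 e2 eta3 -> M2_ball eta1 (e1 + e2) eta3.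
Proof.
rewrite /M2_ball/= => h1 h2.
by rewrite (le_lt_trans (dist2D h eta1 eta2 eta3))// ltrD.
Qed.

HB.instance Definition _ := @Nbhs_isPseudoMetric.Build R (M2 h)
  ent erefl M2_ball M2_ball_center M2_ball_sym M2_ball_triangle erefl.

End M2_topology.

Section dirac_sum.
Context {R : realType} {J : choiceType}.
Variables (D : set J) (y : J -> R).

Definition dirac_sum (A : set (measurableTypeR R)) : \bar R :=
  (\esum_(j in D) \d_(y j : measurableTypeR R) A)%E.

Let dirac_sum0 : dirac_sum set0 = 0%E.
Proof. by rewrite /dirac_sum esum1// => j _; rewrite measure0. Qed.

Let dirac_sum_ge0 A : (0 <= dirac_sum A)%E.
Proof. exact: esum_ge0. Qed.

Let dirac_sum_sigma_additive : semi_sigma_additive dirac_sum.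
Proof.
move=> F mF tF mUF.
suff -> : dirac_sum (\bigcup_n F n) = (\sum_(0 <= n <oo) dirac_sum (F n))%E.
  by apply: is_cvg_nneseries => n _ _; exact: dirac_sum_ge0.
rewrite nneseries_esumT; last by move=> n; exact: dirac_sum_ge0.
rewrite /dirac_sum esum_esum//.
rewrite (reindex_esum (D `*`` fun=> [set: nat]) _ (fun p => (p.2, p.1)))/=.
  rewrite -(@esum_esum _ _ _ D (fun=> setT)
    (fun j n => \d_(y j : measurableTypeR R) (F n)))//.
  by apply: eq_esum => j _; rewrite -nneseries_esumT// measure_semi_bigcup.
split => [[j n] []//|[j n] [j' n'] _ _ /= [-> ->]//|[n j] [_ Dj]].
by exists (j, n).
Qed.

HB.instance Definition _ := isMeasure.Build _ _ _ dirac_sum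
  dirac_sum0 dirac_sum_ge0 dirac_sum_sigma_additive.

End dirac_sum.

Definition sums_diracs {R : realType} (I : set nat) (x : nat -> R)
    (eta : measure_on_line R) : Prop :=
  forall A : set (measurableTypeR R), measurable A -> eta A = dirac_sum I x A.

Section branching_Brownian_motion.
Context {R : realType} {d : measure_display} {Omega : measurableType d}.
Variable P : probability Omega R.

Definition mutually_independent {I : choiceType} (G : I -> set_system Omega)
    : Prop :=
  forall (s : seq I) (A : I -> set Omega), uniq s ->
    (forall i, i \in s -> G i (A i)) ->
    P (\bigcap_(i in [set` s]) A i) = (\prod_(i <- s) P (A i))%E.

Definition sigma_of (X : Omega -> R) : set_system Omega :=
  preimage_set_system setT (X : Omega -> measurableTypeR R) measurable.

Definition sigma_of_process (X : R -> Omega -> R) : set_system Omega :=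
  <<s \bigcup_(t in [set t : R | 0 <= t]) sigma_of (X t) >>.

Definition has_law (X : Omega -> R)
    (Q : set (measurableTypeR R) -> \bar R) : Prop :=
  forall A : set (measurableTypeR R), measurable A -> P (X @^-1` A) = Q A.

(* Processes are indexed by R; only the times t >= 0 are meaningful. *)
Record standard_Brownian_motion (X : R -> Omega -> R) : Prop := {
  BM_measurable : forall t, 0 <= t ->
    measurable_fun setT (X t : Omega -> measurableTypeR R) ;
  BM_start : forall w, X 0 w = 0 ;
  BM_continuous : forall w,
    {within [set t : R | 0 <= t], continuous (fun t => X t w)} ;
  BM_gaussian : forall s t, 0 <= s -> s < t ->
    has_law (fun w => X t w - X s w) (normal_prob 0 (Num.sqrt (t - s))) ;
  BM_independent_increments : forall (n : nat) (t : nat -> R),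
    0 <= t 0%N -> {homo t : i j / (i <= j)%N >-> i <= j} ->
    mutually_independent
      (fun i : 'I_n => sigma_of (fun w => X (t i.+1) w - X (t i) w)) }.

(* Particles are labelled by [seq bool]: the root is [::] and the two children
   of u are [rcons u false] and [rcons u true], so that the strict ancestors of
   u are [take j u], j < size u.  The particle u lives for a time [tau u],
   moves during its life along [X u] from the place where its parent died, and
   is replaced at its death by its two children. *)

Record is_BBM (tau : seq bool -> Omega -> R) (X : seq bool -> R -> Omega -> R)
    : Prop := {
  BBM_lifetime_measurable : forall u,
    measurable_fun setT (tau u : Omega -> measurableTypeR R) ;
  BBM_lifetime_gt0 : forall u w, 0 < tau u w ;
  BBM_lifetime_law : forall u, has_law (tau u) (exponential_prob 1) ;
  BBM_motion : forall u, standard_Brownian_motion (X u) ;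
  BBM_independent : mutually_independent
    (fun l : seq bool + seq bool => match l with
     | inl u => sigma_of (tau u)
     | inr u => sigma_of_process (X u)
     end) }.

Definition birth (tau : seq bool -> Omega -> R) (u : seq bool) (w : Omega) : R :=
  \sum_(j < size u) tau (take j u) w.

Definition alive (tau : seq bool -> Omega -> R) (t : R) (w : Omega)
    (u : seq bool) : Prop :=
  birth tau u w <= t < birth tau u w + tau u w.

Definition position (tau : seq bool -> Omega -> R)
    (X : seq bool -> R -> Omega -> R) (t : R) (w : Omega) (u : seq bool) : R :=
  \sum_(j < size u) X (take j u) (tau (take j u) w) w
  + X u (t - birth tau u w) w.

Definition sigma_of_BBM (tau : seq bool -> Omega -> R)
    (X : seq bool -> R -> Omega -> R) : set_system Omega :=
  <<s (\bigcup_u sigma_of (tau u)) `|` (\bigcup_u sigma_of_process (X u)) >>.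

(* All the BBMs have the same law, since the properties in [is_BBM] determine
   the law of the pair (tau, X). *)
Definition iid_BBMs (tau : nat -> seq bool -> Omega -> R)
    (X : nat -> seq bool -> R -> Omega -> R) : Prop :=
  (forall i, is_BBM (tau i) (X i)) /\
  mutually_independent (fun i => sigma_of_BBM (tau i) (X i)).

(* The BBM with critical drift at time t, started from the sum of the Dirac
   masses at the points x i, i in I. *)
Definition theta (tau : nat -> seq bool -> Omega -> R)
    (X : nat -> seq bool -> R -> Omega -> R) (I : set nat) (x : nat -> R)
    (t : R) (w : Omega) : measure_on_line R :=
  dirac_sum [set p : nat * seq bool | I p.1 /\ alive (tau p.1) t w p.2]
    (fun p => x p.1 + position (tau p.1) (X p.1) t w p.2 - Num.sqrt 2 * t).

(* F is extended by 0 outside M_2, which theta_t avoids almost surely. *)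
Definition extend_M2 (h : nat -> R -> R) (F : M2 h -> R)
    (eta : measure_on_line R) : R :=
  if pselect (inM2 eta) is left eta2 then F (mkM2 h eta2) else 0.

(* [I eta] and [x eta] enumerate the atoms of the initial condition eta. *)
Definition semigroup (tau : nat -> seq bool -> Omega -> R)
    (X : nat -> seq bool -> R -> Omega -> R) (h : nat -> R -> R)
    (I : M2 h -> set nat) (x : M2 h -> nat -> R) (t : R) (F : M2 h -> R)
    (eta : M2 h) : R :=
  fine 'E_P[fun w => extend_M2 F (theta tau X (I eta) (x eta) t w)].

End branching_Brownian_motion.

(* Main.v *)
(* Let f_k(x) = exp (- (x /\ 0)^2 / k).  A nonzero integer-valued measure lies in
   M_2 as soon as all the f_k are integrable, and d_2-convergence of eta_n to eta
   gives <f_k, eta_n> -> <f_k, eta> as well as the convergence of the j-th largest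
   atom for every j; by Scheffe's lemma, sum_j |f_k(y^n_j) - f_k(y_j)| -> 0, where
   y^n and y enumerate the atoms in decreasing order.
   The law of theta_t does not depend on the enumeration of the atoms, so all the
   initial conditions can be coupled by letting the j-th largest atom carry the
   j-th BBM.  A particle u alive at time t with Brownian displacement z
   contributes at most const * f_2k(y_j) exp (2 z^2 / k), and, for k large,
   E [1_{u alive} exp (z^2 / (4 (t + 1)))] <= C 4^-|u|, which is summable over the
   2^n labels of each length n.  Along a subsequence with summable
   l^1 distances, the weighted sums converge almost surely, and dominated
   convergence with moving majorants shows d_2(theta^n_t, theta_t) -> 0, hence
   E F(theta^n_t) -> E F(theta_t). *)
Require Import Defs.
From HB Require Import structures.
From mathcomp Require Import all_boot all_order all_algebra.
From mathcomp Require Import all_classical all_reals all_analysis.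
From mathcomp Require Import finmap measurable_realfun ring lra.

Set Implicit Arguments.
Unset Strict Implicit.
Unset Printing Implicit Defensive.

Import Order.TTheory GRing.Theory Num.Theory.
Import numFieldNormedType.Exports.

Local Open Scope classical_set_scope.
Local Open Scope ring_scope.

(** * Independence and equality in law *)

(** One obstacle is equality in law: the hypotheses describe the joint law of lifetimes and Brownian
    motions, while [theta] evaluates the motions at random times. Lifetimes and increments over a
    mesh of step 1/(m+1) form a family of independent variables with known marginals, and by path
    continuity the state at time t is a pointwise limit of functions of them. The same rounding
    yields the moments: once the rounded ages along the line of u are fixed, the displacement is a
    sum of independent Gaussians whose variances add up to at most t. The base 4 is E exp(-3 T) =
    1/4 for an exponential lifetime T; it has to exceed 2, the number of children. Almost sure
    convergence is available only along subsequences, so continuity is proved by contradiction, from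
    a sequence along which the values stay away from the expected limit. Measurability of F(theta_t)
    needs an argument as well: at every precision, M_2 is covered by countably many small sets
    described by rational approximations of finitely many coordinates. *)

Section transfer.
Context {R : realType} {d : measure_display} {Omega : measurableType d}.

Lemma measurable_indic_comp (Y : Omega -> R) (A : set R) :
  measurable_fun setT Y -> measurable A ->
  measurable_fun setT (fun w => \1_A (Y w) : R).
Proof.
move=> mY mA; apply: (@measurableT_comp _ _ _ _ _ _ (\1_A : R -> R)) => //.
Qed.

End transfer.

Section integral_transfer.
Context {R : realType} {d d' : measure_display} {Omega : measurableType d}
  {Omega' : measurableType d'}.
Variables (P : {measure set Omega -> \bar R}) (P' : {measure set Omega' -> \bar R}).

Import HBNNSimple.

(* The two sides agree on indicators [f = \1_A], hence on all [f >= 0]. *)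
Lemma ge0_integral_transfer (Z Y : Omega -> R) (Y' : Omega' -> R) (c : R) :
  measurable_fun setT Z -> (forall w, 0 <= Z w) ->
  measurable_fun setT Y -> measurable_fun setT Y' -> 0 <= c ->
  (forall A : set (R), measurable A ->
    (\int[P]_w (Z w * \1_A (Y w))%:E = c%:E * P' (Y' @^-1` A))%E) ->
  forall f : R -> R, measurable_fun setT f ->
    (forall x, 0 <= f x) ->
    (\int[P]_w (Z w * f (Y w))%:E = c%:E * \int[P']_w (f (Y' w))%:E)%E.
Proof.
move=> mZ Z0 mY mY' c0 H f mf f0.
have mf' : measurable_fun setT (fun x => (f x)%:E) by exact/measurable_EFinP.
pose f_ := nnsfun_approx measurableT mf'.
have f_cvg x : EFin \o f_ ^~ x @ \oo --> (f x)%:E.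
  by apply: cvg_nnsfun_approx => //= y _; rewrite lee_fin.
have mfY n : measurable_fun setT (fun w => (f_ n (Y w))%:E).
  by apply/measurable_EFinP; apply: measurableT_comp.
have mfY' n : measurable_fun setT (fun w => (f_ n (Y' w))%:E).
  by apply/measurable_EFinP; apply: measurableT_comp.
have mZ' : measurable_fun setT (fun w => (Z w)%:E) by exact/measurable_EFinP.
have simple n : (\int[P]_w (Z w * f_ n (Y w))%:E
    = c%:E * \int[P']_w (f_ n (Y' w))%:E)%E.
  have fE y : (f_ n y)%:E =
      (\sum_(r \in range (f_ n)) (r * \1_(f_ n @^-1` [set r]) y)%:E)%E.
    by rewrite fimfunE -fsumEFin.
  have mA r : measurable (f_ n @^-1` [set r]) by exact: measurable_funPTI.
  have m1 r : measurable_fun setT (fun w => (\1_(f_ n @^-1` [set r]) (Y w))%:E : \bar R).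
    apply/measurable_EFinP.
    by apply: measurable_indic_comp.
  have m1' r : measurable_fun setT (fun w => (\1_(f_ n @^-1` [set r]) (Y' w))%:E : \bar R).
    apply/measurable_EFinP.
    by apply: measurable_indic_comp.
  have m2' r : measurable_fun setT (fun w => (r * \1_(f_ n @^-1` [set r]) (Y' w))%:E : \bar R).
    by under eq_fun do rewrite EFinM; apply: emeasurable_funM.
  have m2 r : measurable_fun setT (fun w => (r * \1_(f_ n @^-1` [set r]) (Y w))%:E : \bar R).
    by under eq_fun do rewrite EFinM; apply: emeasurable_funM.
  have r0 r y : (0 <= (r * \1_(f_ n @^-1` [set r]) y)%:E)%E.
    exact: nnfun_muleindic_ge0.
  under eq_integral do rewrite EFinM fE ge0_mule_fsumr//.
  rewrite ge0_integral_fsum//; last 2 first.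
  - by move=> r; apply: emeasurable_funM.
  - by move=> r w _; rewrite mule_ge0// lee_fin.
  under [in RHS]eq_integral do rewrite fE.
  rewrite ge0_integral_fsum//.
  rewrite ge0_mule_fsumr//; last by move=> r; exact: integral_ge0.
  apply: eq_fsbigr => r _.
  have [r_ge0|r_lt0] := leP 0 r; last first.
    rewrite preimage_nnfun0//= !integral0_eq ?mule0// => w _;
      by rewrite indic0 mulr0 ?mule0.
  under eq_integral do rewrite -EFinM mulrCA EFinM.
  under [in RHS]eq_integral do rewrite EFinM.
  rewrite !ge0_integralZl//; last 2 first.
  - by under eq_fun do rewrite EFinM; apply: emeasurable_funM.
  - by move=> w _; rewrite lee_fin mulr_ge0.
  rewrite H// muleCA; congr (_ * (_ * _))%E.
  have -> : (\int[P']_x (\1_(f_ n @^-1` [set r]) (Y' x))%:E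
      = \int[P']_x (\1_(Y' @^-1` (f_ n @^-1` [set r])) x)%:E)%E by [].
  rewrite integral_indic// ?setIT//.
  by rewrite -[X in measurable X]setTI; apply: mY'.
transitivity (limn (fun n => \int[P]_w (Z w * f_ n (Y w))%:E))%E.
  rewrite -monotone_convergence//.
  - apply: eq_integral => w _; apply/esym/cvg_lim => //.
    under eq_fun do rewrite EFinM.
    by rewrite EFinM; apply: cvgeZl => //; exact: f_cvg.
  - by move=> n; under eq_fun do rewrite EFinM; apply: emeasurable_funM.
  - by move=> n w _; rewrite lee_fin mulr_ge0.
  - move=> w _ m n mn; rewrite lee_fin ler_wpM2l//.
    exact/lefP/nd_nnsfun_approx.
under eq_fun do rewrite simple.
apply/cvg_lim => //; apply: cvgeZl => //.
have -> : (\int[P']_w (f (Y' w))%:E)%E = limn (fun n => \int[P']_w (f_ n (Y' w))%:E)%E.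
  rewrite -monotone_convergence//.
  - by apply: eq_integral => w _; apply/esym/cvg_lim => //; exact: f_cvg.
  - by move=> n w _; rewrite lee_fin.
  - by move=> w _ m n mn; rewrite lee_fin; exact/lefP/nd_nnsfun_approx.
apply: ereal_nondecreasing_is_cvgn => m n mn; apply: ge0_le_integral => //.
- by move=> w _; rewrite lee_fin.
- by move=> w _; rewrite lee_fin; exact/lefP/nd_nnsfun_approx.
Qed.

End integral_transfer.

Section independence.
Context {R : realType} {d : measure_display} {Omega : measurableType d}.
Variable P : probability Omega R.

(** Induction on [s]: [ge0_integral_transfer] upgrades the indicator of the head to [f i], after
    which [f i (Y i w)] is absorbed into [Z] and [e i] into [c]. This is why the statement carries
    an arbitrary weight [Z]. *)
Lemma ge0_expectation_prod {I : eqType} (Z : Omega -> R) (Y : I -> Omega -> R)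
    (f : I -> R -> R) (s : seq I) (c : R) (e : I -> R) :
  measurable_fun setT Z -> (forall w, 0 <= Z w) -> 0 <= c ->
  (forall i, measurable_fun setT (Y i)) ->
  (forall i, measurable_fun setT (f i)) -> (forall i x, 0 <= f i x) ->
  (forall i, i \in s -> (\int[P]_w (f i (Y i w))%:E)%E = (e i)%:E) ->
  uniq s ->
  (forall A : I -> set (R), (forall i, measurable (A i)) ->
    (\int[P]_w (Z w * \prod_(i <- s) \1_(A i) (Y i w))%:E =
     c%:E * \prod_(i <- s) P (Y i @^-1` A i))%E) ->
  (\int[P]_w (Z w * \prod_(i <- s) f i (Y i w))%:E = (c * \prod_(i <- s) e i)%:E)%E.
Proof.
move=> mZ Z0 c0 mY mf f0 fe.
elim: s Z c fe mZ Z0 c0 => [|i s ih] Z c fe mZ Z0 c0 us H.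
  have := H (fun=> setT) (fun=> measurableT).
  under eq_integral do rewrite big_nil.
  under [X in _ -> X = _]eq_integral do rewrite big_nil.
  by rewrite !big_nil mule1 mulr1.
move: us => /= /andP[ins us].
have m1 (A : set (R)) j : measurable A -> measurable_fun setT (fun w => \1_A (Y j w) : R).
  by move=> mA; apply: measurable_indic_comp.
have PE (A : I -> set (R)) : (forall i, measurable (A i)) ->
    forall l, (\prod_(j <- l) P (Y j @^-1` A j))%E = (\prod_(j <- l) fine (P (Y j @^-1` A j)))%:E.
  move=> mA; elim=> [|j l IH]; first by rewrite !big_nil.
  rewrite !big_cons IH EFinM fineK// fin_num_measure//.
  by rewrite -[X in measurable X]setTI; apply: mY.
have e0 j : j \in i :: s -> 0 <= e j.
  by move=> js; rewrite -lee_fin -fe//; apply: integral_ge0 => w _; rewrite lee_fin.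
have step (A : I -> set (R)) : (forall i, measurable (A i)) ->
    (\int[P]_w (Z w * f i (Y i w) * \prod_(j <- s) \1_(A j) (Y j w))%:E =
     (c * e i)%:E * \prod_(j <- s) P (Y j @^-1` A j))%E.
  move=> mA.
  have := @ge0_integral_transfer _ _ _ _ _ P P (fun w => Z w * \prod_(j <- s) \1_(A j) (Y j w)) (Y i) (Y i)
    (c * \prod_(j <- s) fine (P (Y j @^-1` A j))).
  move=> /(_ _ _ (mY i) (mY i) _ _ (f i) (mf i) (f0 i)) step; rewrite PE// -EFinM mulrAC EFinM.
  rewrite -(fe i) ?mem_head// -step.
  - by apply: eq_integral => w _; rewrite mulrAC.
  - by apply: measurable_funM => //; apply: measurable_prod => j _; exact: m1.
  - by move=> w; rewrite mulr_ge0//; apply: prodr_ge0.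
  - by rewrite mulr_ge0//; apply: prodr_ge0 => j _; rewrite fine_ge0.
  (* As [i] does not occur in [s], changing the family at [i] affects the head only. *)
  move=> B mB; have := H (fun j => if j == i then B else A j).
  have notin : forall j, j \in s -> (j == i) = false.
    by move=> j js; apply/negbTE; apply: contraNneq ins => <-.
  rewrite big_cons eqxx (eq_big_seq (fun j => P (Y j @^-1` A j))); last first.
    by move=> j js; rewrite notin.
  rewrite PE// muleCA -EFinM muleC => <-; last by move=> j; case: ifP.
  apply: eq_integral => w _; rewrite big_cons eqxx mulrCA (mulrC _ (\1_B _)).
  by congr (_ * (_ * _))%:E; apply: eq_big_seq => j js; rewrite notin.
under eq_integral do rewrite big_cons mulrA.
rewrite big_cons mulrA; apply: ih => //.
- by move=> j js; apply: fe; rewrite inE js orbT.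
- by apply: measurable_funM => //; exact: (measurableT_comp (mf i) (mY i)).
- by move=> w; rewrite mulr_ge0.
- by rewrite mulr_ge0// e0// mem_head.
Qed.

(** Dynkin's lemma: the events independent of [B] form a Dynkin system. *)
Lemma indep_sigma_algebra (G : set_system Omega) (B : set Omega) :
  setI_closed G -> G `<=` measurable -> measurable B ->
  (forall A, G A -> P (A `&` B) = P A * P B)%E ->
  forall A, <<s G >> A -> P (A `&` B) = (P A * P B)%E.
Proof.
move=> GI mG mB GB A; rewrite -setI_closed_g_dynkin_g_sigma_algebra// => GA.
suff : <<d G >> `<=` [set A | measurable A /\ P (A `&` B) = (P A * P B)%E].
  by move=> /(_ _ GA) [].
apply: smallest_sub => [|C GC]; last by split; [exact: mG|exact: GB].
split => /=.
- by rewrite setTI probability_setT mul1e.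
- move=> C [mC CB]; split; first exact: measurableC.
  rewrite setIC -setDE measureD//; last by rewrite ltey_eq fin_num_measure.
  transitivity (P B - P C * P B)%E; first by congr (_ - _)%E; rewrite -CB setIC.
  rewrite probability_setC// muleBl ?mul1e//.
  by rewrite fin_num_measure.
- move=> F tF FB; split; first by apply: bigcup_measurable => k _; case: (FB k).
  have mF k : measurable (F k) by case: (FB k).
  rewrite setI_bigcupl !measure_bigcup//; last 2 first.
  + by move=> k _; exact: measurableI.
  + by apply: trivIset_setIr.
  have PB : P B = (fine (P B))%:E by rewrite fineK// fin_num_measure.
  rewrite muleC PB -nneseriesZl; last by move=> k _; exact: measure_ge0.
  by apply: eq_eseriesr => k _; rewrite muleC -PB; case: (FB k).
Qed.
(** Dynkin's lemma for two maps: the sets whose preimages are measurable and equally likely form a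
    Dynkin system. *)
Lemma eq_preimage_sigma_algebra {U : Type} (G : set_system U) (f g : Omega -> U) :
  setI_closed G -> (forall A, G A -> measurable (f @^-1` A)) ->
  (forall A, G A -> measurable (g @^-1` A)) ->
  (forall A, G A -> P (f @^-1` A) = P (g @^-1` A)) ->
  forall A, <<s G >> A -> P (f @^-1` A) = P (g @^-1` A).
Proof.
move=> GI mf mg fg A; rewrite -setI_closed_g_dynkin_g_sigma_algebra// => GA.
suff : <<d G >> `<=` [set A | [/\ measurable (f @^-1` A), measurable (g @^-1` A) &
    P (f @^-1` A) = P (g @^-1` A)]] by move=> /(_ _ GA) [].
apply: smallest_sub => [|C GC]; last by split; [exact: mf|exact: mg|exact: fg].
split => /=.
- by split; rewrite ?preimage_setT.
- move=> C [mfC mgC fgC]; split.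
  + exact: (measurableC mfC).
  + exact: (measurableC mgC).
  + transitivity (1 - P (f @^-1` C))%E; first exact: (probability_setC P mfC).
    by rewrite fgC; apply/esym; exact: (probability_setC P mgC).
- move=> F tF FG.
  have mfF k : measurable (f @^-1` F k) by case: (FG k).
  have mgF k : measurable (g @^-1` F k) by case: (FG k).
  split.
  + rewrite preimage_bigcup; exact: bigcupT_measurable.
  + rewrite preimage_bigcup; exact: bigcupT_measurable.
  + rewrite !preimage_bigcup !measure_bigcup//; last 2 first.
    * by move=> i j _ _ [w [Fi Fj]]; apply: tF => //; exists (g w).
    * by move=> i j _ _ [w [Fi Fj]]; apply: tF => //; exists (f w).
    by apply: eq_eseriesr => k _; case: (FG k).
Qed.

(** Independence by blocks, the blocks being the fibres of [pi]: a finite intersection over [K] is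
    regrouped by fibre, [G] makes the fibres independent of each other, and the last hypothesis
    factorises each of them. *)
Lemma mutually_independent_nested {I K : choiceType} (pi : K -> I)
    (G : I -> set_system Omega) (H : K -> set_system Omega) :
  mutually_independent P G ->
  (forall i (s : seq K) A, (forall k, k \in s -> pi k = i /\ H k (A k)) ->
    G i (\bigcap_(k in [set` s]) A k)) ->
  (forall i (s : seq K) A, uniq s -> (forall k, k \in s -> pi k = i /\ H k (A k)) ->
    P (\bigcap_(k in [set` s]) A k) = \prod_(k <- s) P (A k))%E ->
  mutually_independent P H.
Proof.
move=> indG GH indH s A us sA.
pose t := undup (map pi s).
pose B i := \bigcap_(k in [set` [seq k <- s | pi k == i]]) A k.
have -> : \bigcap_(k in [set` s]) A k = \bigcap_(i in [set` t]) B i.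
  apply/seteqP; split => [w sw i /= it k /=|w tw k /= ks].
    by rewrite mem_filter => /andP[_ ks]; exact: sw.
  apply: (tw (pi k)); rewrite /= ?mem_filter ?eqxx// mem_undup.
  by apply/mapP; exists k.
have BA i k : k \in [seq k <- s | pi k == i] -> pi k = i /\ H k (A k).
  by rewrite mem_filter => /andP[/eqP -> ks]; split => //; exact: sA.
rewrite indG ?undup_uniq//; last by move=> i _; apply: GH => k; exact: BA.
have PB i : P (B i) = (\prod_(k <- s) (if pi k == i then P (A k) else 1))%E.
  by rewrite /B (indH i _ _ (filter_uniq _ us) (BA i)) big_filter big_mkcond.
under eq_bigr do rewrite PB.
(* After the exchange each [k] meets exactly one index [i], namely [pi k]. *)
rewrite exchange_big/=; apply: eq_big_seq => k ks.
rewrite (bigD1_seq (pi k)) ?undup_uniq//= ?eqxx; last first.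
  by rewrite mem_undup; apply/mapP; exists k.
by rewrite big1 ?mule1// => i /negbTE; rewrite eq_sym => ->.
Qed.

End independence.

(** * Laws of families of real random variables *)

Section cylinders.
Context {R : realType} {T : choiceType}.

Definition cylinder {U : Type} (f : T -> U -> R) (s : seq T) (A : T -> set R)
    : set U :=
  [set w | forall k, k \in s -> A k (f k w)].

(** [G] is a parameter because the same sigma-algebra is generated in two ways: by all measurable
    sets, and by half-lines when a law has to be identified. *)
Definition cylinder_system {U : Type} (f : T -> U -> R) (G : set_system R)
    : set_system U :=
  [set C | exists s A, (forall k, G (A k)) /\ C = cylinder f s A].

Lemma cylinder_cons {U : Type} (f : T -> U -> R) k s A :
  cylinder f (k :: s) A = (f k @^-1` A k) `&` cylinder f s A.
Proof.
apply/seteqP; split => [w kw|w [kw sw] j].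
  by split=> [|j js]; apply: kw; rewrite inE ?eqxx ?js ?orbT.
by rewrite inE => /orP[/eqP ->|js] //; exact: sw.
Qed.

Lemma cylinder_systemI {U : Type} (f : T -> U -> R) (G : set_system R) :
  G setT -> setI_closed G -> setI_closed (cylinder_system f G).
Proof.
move=> GT GI _ _ [s [A [GA ->]]] [t [B [GB ->]]].
exists (s ++ t), (fun k => (if k \in s then A k else setT) `&`
  (if k \in t then B k else setT)); split.
  by move=> k; apply: GI; case: ifP.
apply/seteqP; split => [w [sw tw] k _|w stw].
  by split; case: ifP => // ?; [exact: sw|exact: tw].
by split => k kst; have := stw k; rewrite mem_cat kst ?orbT => /(_ isT) [].
Qed.

Lemma measurable_cylinder {d} {U : measurableType d} (f : T -> U -> R) s A :
  (forall k, measurable_fun setT (f k)) -> (forall k, measurable (A k)) ->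
  measurable (cylinder f s A).
Proof.
move=> mf mA; elim: s => [|k s ih].
  by rewrite (_ : cylinder f [::] A = setT)//; apply/seteqP; split.
rewrite cylinder_cons; apply: measurableI => //.
by rewrite -[X in measurable X]setTI; exact: mf.
Qed.

(** The product sigma-algebra on [T -> R]. *)
Definition pathspace := g_sigma_algebraType
  (cylinder_system (fun k (f : T -> R) => f k) (@measurable _ R)).

Lemma measurable_coordinate k :
  measurable_fun setT ((fun f => f k) : pathspace -> R).
Proof.
move=> _ A mA; rewrite setTI; apply: sub_sigma_algebra.
exists [:: k], (fun=> A); split => //.
apply/seteqP; split => [f /= kf j|f fk]; first by rewrite inE => /eqP ->.
by apply: fk; rewrite mem_head.
Qed.

Lemma measurable_fun_pathspace {d} {U : measurableType d} (V : T -> U -> R) :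
  (forall k, measurable_fun setT (V k)) ->
  measurable_fun setT ((fun w k => V k w) : U -> pathspace).
Proof.
move=> mV; apply: (@measurability _ _ _ pathspace setT _
  (cylinder_system (fun k (f : T -> R) => f k) measurable)) =>// _ [_ [s [A [mA ->]]] <-].
by rewrite setTI; exact: (measurable_cylinder s mV mA).
Qed.

End cylinders.

Lemma continuous_minr {R : realType} (f g : R -> R) :
  continuous f -> continuous g -> continuous (fun x => Num.min (f x) (g x)).
Proof. by move=> cf cg x; exact: (@continuous_min R R f g x (cf x) (cg x)). Qed.

Lemma continuous_maxr {R : realType} (f g : R -> R) :
  continuous f -> continuous g -> continuous (fun x => Num.max (f x) (g x)).
Proof. by move=> cf cg x; exact: (@continuous_max R R f g x (cf x) (cg x)). Qed.

Section equality_in_law.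
Context {R : realType} {d : measure_display} {Omega : measurableType d}.
Variable P : probability Omega R.

(** Equality of finite-dimensional distributions; [eqlaw_preimage] turns it into equality of the
    laws on [pathspace]. *)
Definition eqlaw {T : choiceType} (V V' : T -> Omega -> R) : Prop :=
  forall (s : seq T) (A : T -> set R), (forall k, measurable (A k)) ->
    P (cylinder V s A) = P (cylinder V' s A).

Lemma eqlaw_preimage {T : choiceType} (V V' : T -> Omega -> R) :
  (forall k, measurable_fun setT (V k)) ->
  (forall k, measurable_fun setT (V' k)) -> eqlaw V V' ->
  forall A : set (@pathspace R T), measurable A ->
    P ((fun w k => V k w) @^-1` A) = P ((fun w k => V' k w) @^-1` A).
Proof.
move=> mV mV' VV' A mA.
apply: (@eq_preimage_sigma_algebra _ _ _ P _
  (cylinder_system (fun k (f : T -> R) => f k) measurable)) => //.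
- by apply: cylinder_systemI => //; exact: measurableI.
- by move=> _ [s [B [mB ->]]]; exact: (measurable_cylinder s mV mB).
- by move=> _ [s [B [mB ->]]]; exact: (measurable_cylinder s mV' mB).
- by move=> _ [s [B [mB ->]]]; exact: VV'.
Qed.

Lemma eqlaw_comp {T T' : choiceType} (V V' : T -> Omega -> R)
    (g : T' -> @pathspace R T -> R) :
  (forall k, measurable_fun setT (V k)) ->
  (forall k, measurable_fun setT (V' k)) ->
  (forall k, measurable_fun setT (g k)) -> eqlaw V V' ->
  eqlaw (fun k w => g k (fun j => V j w)) (fun k w => g k (fun j => V' j w)).
Proof.
move=> mV mV' mg VV' s A mA.
exact: (eqlaw_preimage mV mV' VV' (measurable_cylinder s mg mA)).
Qed.

Lemma eqlaw_ge0_integral {T : choiceType} (V V' : T -> Omega -> R)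
    (g : @pathspace R T -> \bar R) :
  (forall k, measurable_fun setT (V k)) ->
  (forall k, measurable_fun setT (V' k)) -> eqlaw V V' ->
  measurable_fun setT g -> (forall f, 0 <= g f)%E ->
  (\int[P]_w g (fun k => V k w) = \int[P]_w g (fun k => V' k w))%E.
Proof.
move=> mV mV' VV' mg g0.
have mVp := measurable_fun_pathspace mV.
have mVp' := measurable_fun_pathspace mV'.
transitivity (\int[pushforward P ((fun w k => V k w) : Omega -> pathspace)]_f g f)%E.
  by rewrite ge0_integral_pushforward.
rewrite [RHS](_ : _ = \int[pushforward P ((fun w k => V' k w) : Omega -> pathspace)]_f g f)%E.
  by apply: eq_measure_integral => A mA _; exact: eqlaw_preimage.
by rewrite ge0_integral_pushforward.
Qed.

(** Adding the constant [C] makes the integrand non-negative; under a probability the integral of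
    [C] is finite and can be subtracted again. *)
Lemma eqlaw_bounded_integral {T : choiceType} (V V' : T -> Omega -> R)
    (g : @pathspace R T -> R) (C : R) :
  (forall k, measurable_fun setT (V k)) ->
  (forall k, measurable_fun setT (V' k)) -> eqlaw V V' ->
  measurable_fun setT g -> (forall f, `|g f| <= C) ->
  (\int[P]_w (g (fun k => V k w))%:E = \int[P]_w (g (fun k => V' k w))%:E)%E.
Proof.
move=> mV mV' VV' mg gC.
have shift (W : T -> Omega -> R) : (forall k, measurable_fun setT (W k)) ->
    (\int[P]_w (g (fun k => W k w) + C)%:E =
     \int[P]_w (g (fun k => W k w))%:E + C%:E)%E.
  move=> mW; under eq_integral do rewrite EFinD.
  have mgW : measurable_fun setT (fun w => g (fun k => W k w)).
    exact: (measurableT_comp mg (measurable_fun_pathspace mW)).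
  rewrite integralD//=.
  - by rewrite integral_cst//= probability_setT mule1.
  - apply: (@le_integrable _ _ _ P setT _ _ (fun=> C%:E)) => //.
    + exact/measurable_EFinP.
    + by move=> w _; rewrite lee_fin (le_trans (gC _))// ler_norm.
    + exact: finite_measure_integrable_cst.
  - exact: finite_measure_integrable_cst.
have : (\int[P]_w (g (fun k => V k w) + C)%:E =
        \int[P]_w (g (fun k => V' k w) + C)%:E)%E.
  apply: (@eqlaw_ge0_integral T V V' (fun f => (g f + C)%:E)) => //.
  - by apply/measurable_EFinP; apply: measurable_funD.
  - move=> f; rewrite lee_fin -lerBlDr sub0r.
    by have := gC f; rewrite ler_norml => /andP[].
by rewrite !shift// => /(congr1 (fun z => z - C%:E)%E); rewrite !addeK.
Qed.

(** [setT] is included as a filler: the intersection of two cylinders over different index lists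
    leaves some coordinates unconstrained on one side. *)
Definition rays : set_system R := [set A | A = setT \/ exists a, A = `]a, +oo[%classic].

Lemma measurable_coordinate_rays {T : choiceType} (k : T) :
  measurable_fun setT ((fun f => f k) :
    g_sigma_algebraType (cylinder_system (fun k (f : T -> R) => f k) rays) -> R).
Proof.
apply: (measurability _ (RGenOInfty.measurableE R)) => _ [_ [a ->] <-].
rewrite setTI; apply: sub_sigma_algebra.
exists [:: k], (fun=> `]a, +oo[%classic); split; first by move=> _; right; exists a.
by rewrite cylinder_cons; apply/seteqP; split => [f /= fk|f []].
Qed.

(** Rays generate the Borel sets and are stable under intersection, so Dynkin's lemma applies.
    Coordinates whose constraint is [setT] are dropped from the index list, which leaves proper
    half-lines only. *)
Lemma eqlaw_rays {T : choiceType} (V V' : T -> Omega -> R) :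
  (forall k, measurable_fun setT (V k)) ->
  (forall k, measurable_fun setT (V' k)) ->
  (forall s (a : T -> R), P (cylinder V s (fun k => `]a k, +oo[%classic)) =
    P (cylinder V' s (fun k => `]a k, +oo[%classic))) ->
  eqlaw V V'.
Proof.
move=> mV mV' VV' s A mA.
pose G := cylinder_system (fun k (f : T -> R) => f k) rays.
have mR B : rays B -> measurable B.
  by move=> [->//|[a ->]]; exact: measurable_itv.
have GI : setI_closed rays.
  move=> B C [->|[b ->]] [->|[c ->]]; rewrite ?setTI ?setIT; [by left| | |].
  - by right; exists c.
  - by right; exists b.
  - right; exists (Num.max b c); apply/seteqP; split => x /=;
      by rewrite !in_itv/= !andbT gt_max => /andP.
have sGA : <<s G >> (cylinder (fun k (f : T -> R) => f k) s A).
  exact: (@measurable_cylinder _ _ _ (g_sigma_algebraType G) _ _ _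
    (fun k => measurable_coordinate_rays k) mA).
suff eqG : forall B, <<s G >> B ->
  P ((fun w k => V k w) @^-1` B) = P ((fun w k => V' k w) @^-1` B) by exact: eqG sGA.
apply: eq_preimage_sigma_algebra.
- by apply: cylinder_systemI => //; left.
- move=> _ [t [B [rB ->]]].
  by apply: (measurable_cylinder t mV (A := B)) => k; exact: mR.
- move=> _ [t [B [rB ->]]].
  by apply: (measurable_cylinder t mV' (A := B)) => k; exact: mR.
move=> _ [t [B [rB ->]]].
have /choice[a aB] k : exists a, B k <> setT -> B k = `]a, +oo[%classic.
  by case: (rB k) => [->|[a ->]]; [exists 0|exists a].
have cylE (W : T -> Omega -> R) : cylinder W t B =
    cylinder W [seq k <- t | `[< B k <> setT >]] (fun k => `]a k, +oo[%classic).
  apply/seteqP; split => w tw k.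
    by rewrite mem_filter => /andP[/asboolP Bk kt]; rewrite -aB//; exact: tw.
  move=> kt; have [->//|Bk] := pselect (B k = setT).
  by rewrite aB//; apply: tw; rewrite mem_filter kt andbT; apply/asboolP.
have := VV' [seq k <- t | `[< B k <> setT >]] a.
by rewrite -!cylE.
Qed.

(** Under independence the probability of a cylinder is the product of its marginals; repetitions in
    the index list are removed beforehand. *)
Lemma eqlaw_independent {T : choiceType} (V V' : T -> Omega -> R) :
  mutually_independent P (fun k => sigma_of (V k)) ->
  mutually_independent P (fun k => sigma_of (V' k)) ->
  (forall k A, measurable A -> P (V k @^-1` A) = P (V' k @^-1` A)) ->
  eqlaw V V'.
Proof.
move=> iV iV' VV' s A mA.
have E (W : T -> Omega -> R) : mutually_independent P (fun k => sigma_of (W k)) ->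
    P (cylinder W s A) = (\prod_(k <- undup s) P (W k @^-1` A k))%E.
  move=> iW; rewrite (_ : cylinder W s A = \bigcap_(k in [set` undup s]) (W k @^-1` A k)).
    apply: iW; first exact: undup_uniq.
    by move=> k _; exists (A k); [exact: mA|rewrite setTI].
  by apply/seteqP; split => w sw k; have := sw k; rewrite /= mem_undup.
by rewrite !E//; apply: eq_bigr => k _; exact: VV'.
Qed.

Lemma cvg_bounded_integral (f_ : nat -> Omega -> R) (f : Omega -> R) (C : R) :
  (forall n, measurable_fun setT (f_ n)) -> measurable_fun setT f ->
  (forall n w, `|f_ n w| <= C) ->
  {ae P, forall w, f_ ^~ w @ \oo --> f w} ->
  (fun n => \int[P]_w (f_ n w)%:E)%E @ \oo --> (\int[P]_w (f w)%:E)%E.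
Proof.
move=> mf_ mf f_C f_f.
have [] := @dominated_convergence _ _ _ P setT measurableT
  (fun n w => (f_ n w)%:E) (fun w => (f w)%:E) (fun=> C%:E) => //.
- by move=> n; exact/measurable_EFinP.
- exact/measurable_EFinP.
- by apply: filterS f_f => w fw _; apply/cvg_EFin; [exact: nearW|exact: fw].
- exact: finite_measure_integrable_cst.
- by apply: aeW => w n _; rewrite lee_fin.
Qed.

(** Indicators of half-lines are discontinuous, so two limits are taken: in [m] for a product of
    continuous approximations [phi l], then in [l] to recover the half-lines. *)
Lemma eqlaw_cvg {T : choiceType} (V_ V'_ : nat -> T -> Omega -> R)
    (V V' : T -> Omega -> R) :
  (forall m k, measurable_fun setT (V_ m k)) ->
  (forall m k, measurable_fun setT (V'_ m k)) ->
  (forall k w, V_ ^~ k ^~ w @ \oo --> V k w) ->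
  (forall k w, V'_ ^~ k ^~ w @ \oo --> V' k w) ->
  (forall m, eqlaw (V_ m) (V'_ m)) -> eqlaw V V'.
Proof.
move=> mV_ mV'_ V_V V'_V' VV'.
have mV k : measurable_fun setT (V k).
  by apply: (measurable_fun_cvg (fun m => mV_ m k)) => w _; exact: V_V.
have mV' k : measurable_fun setT (V' k).
  by apply: (measurable_fun_cvg (fun m => mV'_ m k)) => w _; exact: V'_V'.
apply: eqlaw_rays => // s a.
(* [phi l] increases to the indicator of ]0, +oo[ as l grows. *)
pose phi (l : nat) (x : R) := Num.min 1 (Num.max 0 (l%:R * x)).
pose psi l (f : T -> R) := \prod_(k <- s) phi l (f k - a k).
have phi01 l x : 0 <= phi l x <= 1.
  by rewrite /phi le_min ler01 le_max lexx ge_min lexx.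
have psi1 l f : `|psi l f| <= 1.
  rewrite /psi ger0_norm; last by apply: prodr_ge0 => k _; case/andP: (phi01 l (f k - a k)).
  by apply: prodr_ile1 => k _; exact: phi01.
have cphi l : continuous (phi l).
  apply: continuous_minr; first by move=> x; exact: cvg_cst.
  apply: continuous_maxr; first by move=> x; exact: cvg_cst.
  by move=> x; apply: cvgMl_tmp; exact: cvg_id.
have mphi l : measurable_fun setT (phi l) by exact: continuous_measurable_fun.
have mpsi l (W : T -> Omega -> R) : (forall k, measurable_fun setT (W k)) ->
    measurable_fun setT (fun w => psi l (fun k => W k w)).
  move=> mW; apply: measurable_prod => k _.
  by apply: (measurableT_comp (mphi l)); apply: measurable_funB.
have cvg_prod (F : nat -> T -> R) (G : T -> R) : (forall k, F ^~ k @ \oo --> G k) ->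
    (fun n => \prod_(k <- s) F n k) @ \oo --> \prod_(k <- s) G k.
  move=> FG; elim: (s) => [|k t ih].
    under eq_fun do rewrite big_nil.
    by rewrite big_nil; exact: cvg_cst.
  under eq_fun do rewrite big_cons.
  by rewrite big_cons; apply: cvgM.
have psiP (W : T -> Omega -> R) : (forall k, measurable_fun setT (W k)) ->
    (fun l => \int[P]_w (psi l (fun k => W k w))%:E)%E @ \oo -->
    P (cylinder W s (fun k => `]a k, +oo[%classic)).
  move=> mW.
  have mC : measurable (cylinder W s (fun k => `]a k, +oo[%classic)).
    by apply: measurable_cylinder => // k; exact: measurable_itv.
  have <- : (\int[P]_w (\1_(cylinder W s (fun k => `]a k, +oo[%classic)) w)%:E)%E =
      P (cylinder W s (fun k => `]a k, +oo[%classic)).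
    by rewrite integral_indic// setIT.
  apply: (cvg_bounded_integral (C := 1)) => //.
  - by move=> l; exact: mpsi.
  - apply: aeW => w.
    have -> : \1_(cylinder W s (fun k => `]a k, +oo[%classic)) w =
        \prod_(k <- s) (a k < W k w)%R%:R :> R.
      rewrite indicE; have [|] := boolP (w \in _).
        move=> /set_mem sw; rewrite big_seq big1// => k ks.
        by have := sw k ks; rewrite /= in_itv/= andbT => ->.
      rewrite notin_setE /cylinder/= => /existsNP[k /not_implyP[ks]].
      rewrite in_itv/= andbT => /negP Wk; apply/esym/eqP.
      by rewrite prodf_seq_eq0; apply/hasP; exists k => //=; rewrite (negbTE Wk).
    apply: cvg_prod => k; have [aW|Wa] := ltP.
      apply: cvg_near_cst; near=> l.
      rewrite /phi max_r; last by rewrite mulr_ge0// subr_ge0 ltW.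
      rewrite min_l// -ler_pdivrMr ?subr_gt0// div1r.
      by near: l; exact: nbhs_infty_ger.
    rewrite (_ : (fun n => _) = fun=> 0); first exact: cvg_cst.
    apply/funext => l; rewrite /phi max_l ?min_r//.
    by rewrite mulr_ge0_le0// subr_le0.
have cvgm l (W_ : nat -> T -> Omega -> R) (W : T -> Omega -> R) :
    (forall m k, measurable_fun setT (W_ m k)) -> (forall k, measurable_fun setT (W k)) ->
    (forall k w, W_ ^~ k ^~ w @ \oo --> W k w) ->
    (fun m => \int[P]_w (psi l (fun k => W_ m k w))%:E)%E @ \oo -->
    (\int[P]_w (psi l (fun k => W k w))%:E)%E.
  move=> mW_ mW W_W; apply: (cvg_bounded_integral (C := 1)) => //.
  - by move=> m; exact: mpsi.
  - exact: mpsi.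
  - apply: aeW => w; apply: cvg_prod => k.
    apply: (@cvg_comp _ _ _ (fun m => W_ m k w - a k) (phi l)); last exact: cphi.
    by apply: cvgB; [exact: W_W|exact: cvg_cst].
have eqpsi l : (\int[P]_w (psi l (fun k => V k w))%:E =
    \int[P]_w (psi l (fun k => V' k w))%:E)%E.
  have := cvgm l _ _ mV_ mV V_V; have := cvgm l _ _ mV'_ mV' V'_V'.
  have -> : (fun m => \int[P]_w (psi l (fun k => V'_ m k w))%:E)%E =
            (fun m => \int[P]_w (psi l (fun k => V_ m k w))%:E)%E.
    apply/funext => m; apply/esym.
    apply: (eqlaw_bounded_integral (mV_ m) (mV'_ m) (VV' m) (g := psi l)) => //.
    apply: measurable_prod => k _; apply: (measurableT_comp (mphi l)).
    by apply: measurable_funB => //; exact: measurable_coordinate.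
  by move=> /cvg_lim + /cvg_lim => <-// <-.
have := psiP _ mV; under eq_fun do rewrite eqpsi.
by move=> /cvg_lim <-//; apply/cvg_lim => //; exact: psiP.
Unshelve. all: by end_near. Qed.

End equality_in_law.

(** * The law of a family of branching Brownian motions *)

Section sigma_algebras_of_BBM.
Context {R : realType} {d : measure_display} {Omega : measurableType d}.
Variable P : probability Omega R.

Lemma sigma_algebra_sigma_of (Y : Omega -> R) : sigma_algebra setT (sigma_of Y).
Proof. by apply: sigma_algebra_preimage; exact: smallest_sigma_algebra. Qed.

(** When the [G i] are sigma-algebras, finite intersections of events of a block stay in its
    sigma-algebra, which is the closure property asked by [mutually_independent_nested]. *)
Lemma mutually_independent_refine {I K : choiceType} (pi : K -> I)
    (G : I -> set_system Omega) (H : K -> set_system Omega) :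
  mutually_independent P G -> (forall i, sigma_algebra setT (G i)) ->
  (forall k, H k `<=` G (pi k)) ->
  (forall i (s : seq K) A, uniq s -> (forall k, k \in s -> pi k = i /\ H k (A k)) ->
    P (\bigcap_(k in [set` s]) A k) = \prod_(k <- s) P (A k))%E ->
  mutually_independent P H.
Proof.
move=> iG sG HG; apply: mutually_independent_nested iG _ => i s A sA.
pose T : measurableType _ := g_sigma_algebraType (G i).
have Gi B : G i B <-> @measurable _ T B.
  by rewrite (_ : @measurable _ T = G i)//; apply: sigma_algebra_id; exact: sG.
suff : @measurable _ T (\bigcap_(k in [set` s]) A k) by move/Gi.
rewrite bigcap_seq big_seq; apply: big_ind => //; first exact: (@measurableI _ T).
by move=> k /sA[pik HA]; apply/Gi; rewrite -pik; exact: HG.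
Qed.

Definition increment (X : R -> Omega -> R) (m j : nat) (w : Omega) : R :=
  X (j.+1%:R / m.+1%:R) w - X (j%:R / m.+1%:R) w.

Lemma sigma_of_process_increment (X : R -> Omega -> R) m j :
  sigma_of (increment X m j) `<=` sigma_of_process X.
Proof.
pose T : measurableType _ :=
  g_sigma_algebraType (\bigcup_(t in [set t : R | 0 <= t]) sigma_of (X t)).
have mX t : 0 <= t -> measurable_fun setT (X t : T -> R).
  move=> t0 _ A mA; rewrite setTI; apply: sub_sigma_algebra.
  by exists t => //; exists A => //; rewrite setTI.
have mI : measurable_fun setT (increment X m j : T -> R).
  by apply: measurable_funB; apply: mX; rewrite divr_ge0.
by move=> _ [A mA <-]; exact: mI.
Qed.

(** Brownian independence is stated for [n] consecutive intervals indexed by ['I_n]; [n] is taken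
    beyond every index of [s], and [s] is pulled back to ordinals. *)
Lemma increment_independent (X : R -> Omega -> R) m :
  standard_Brownian_motion P X ->
  mutually_independent P (fun j : nat => sigma_of (increment X m j)).
Proof.
move=> BM s A us sA.
pose n := (\max_(j <- s) j).+1.
have sn j : j \in s -> (j < n)%N by move=> js; rewrite ltnS; exact: leq_bigmax_seq.
pose s' : seq 'I_n := pmap insub s.
have s'E : map val s' = s.
  rewrite /s' pmap_filter; last by move=> j; exact: insubK.
  by apply/all_filterP/allP => j /sn jn; rewrite insubT.
have -> : \bigcap_(j in [set` s]) A j = \bigcap_(i in [set` s']) A (val i).
  rewrite -{1}s'E; apply/seteqP; split => w sw j /= js.
    by apply: sw; rewrite /= map_f.
  by case/mapP: js => i is' ->; exact: sw.
rewrite -[in RHS]s'E big_map.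
apply: (BM_independent_increments BM (t := fun j => j%:R / m.+1%:R)).
- by rewrite mul0r.
- by move=> i j ij; rewrite ler_pM2r ?invr_gt0// ler_nat.
- by rewrite -(map_inj_uniq val_inj) s'E.
- by move=> i is'; apply: sA; rewrite -s'E map_f.
Qed.

(** A discretised BBM is a countable family of real variables: [inl u] stands for the lifetime of
    [u], [inr (u, j)] for the increment of its motion over the mesh interval of index [j]. *)
Definition mesh_index := (seq bool + seq bool * nat)%type.

Definition mesh (tau : seq bool -> Omega -> R) (X : seq bool -> R -> Omega -> R)
    (m : nat) (k : mesh_index) : Omega -> R :=
  match k with inl u => tau u | inr (u, j) => increment (X u) m j end.

Lemma mesh_independent tau X m : is_BBM P tau X ->
  mutually_independent P (fun k => sigma_of (mesh tau X m k)).
Proof.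
move=> bbm.
pose pi (k : mesh_index) : seq bool + seq bool :=
  match k with inl u => inl u | inr (u, _) => inr u end.
apply: (mutually_independent_refine (pi := pi) (BBM_independent bbm)).
- case=> u; first exact: sigma_algebra_sigma_of.
  exact: smallest_sigma_algebra.
- by case=> [u //|[u j]]; exact: sigma_of_process_increment.
move=> [u|u] s A us sA.
  (* A lifetime block contains a single index, so a duplicate-free list in it has length at most
     1. *)
  have : all (pred1 (inl u : mesh_index)) s.
    by apply/allP => -[v|[v j]] /sA[]//= [->].
  move=> /all_pred1P; move: us; case: (size s) => [|[|n]] + sE; rewrite sE//=.
  - have -> : \bigcap_(k in [set` [::]]) A k = setT by apply/seteqP; split.
    by rewrite big_nil probability_setT.
  - have -> : \bigcap_(k in [set` [:: inl u]]) A k = A (inl u).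
      apply/seteqP; split=> [w|w Aw k]; first by apply; exact: mem_head.
      by rewrite /= inE => /eqP ->.
    by rewrite big_seq1.
  - by rewrite mem_head.
pose t : seq nat := pmap (fun k : mesh_index => if k is inr (_, j) then Some j else None) s.
have sE : s = map (fun j => inr (u, j)) t.
  rewrite {}/t; elim: s us sA => [//|k s ih] /= /andP[ks us] sA.
  have /sA[] : k \in k :: s by rewrite mem_head.
  case: k ks sA => [//|[v j]] /= ks sA [->] _ /=; congr cons.
  by apply: ih => // k' k's; apply: sA; rewrite inE k's orbT.
have ut : uniq t by move: us; rewrite sE map_inj_uniq// => j j' [].
have -> : \bigcap_(k in [set` s]) A k = \bigcap_(j in [set` t]) A (inr (u, j)).
  rewrite {1}sE; apply/seteqP; split => w sw k /= ks.
    by apply: sw; apply/mapP; exists k.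
  by case/mapP: ks => j jt ->; exact: sw.
rewrite sE big_map.
have := increment_independent (m := m) (BBM_motion bbm u) (s := t) (A := fun j => A (inr (u, j))) ut.
apply.
move=> j jt; suff /sA[] : (inr (u, j) : mesh_index) \in s by [].
by rewrite sE; apply/mapP; exists j.
Qed.

Definition iid_mesh (tau : nat -> seq bool -> Omega -> R)
    (X : nat -> seq bool -> R -> Omega -> R) (m : nat)
    (k : nat * mesh_index) : Omega -> R :=
  mesh (tau k.1) (X k.1) m k.2.

Lemma iid_mesh_independent tau X m : iid_BBMs P tau X ->
  mutually_independent P (fun k => sigma_of (iid_mesh tau X m k)).
Proof.
move=> [bbm ind].
apply: (mutually_independent_refine (pi := fst) ind).
- by move=> i; exact: smallest_sigma_algebra.
- move=> [i [u|[u j]]] /= B sB; apply: sub_sigma_algebra; [left|right]; exists u => //.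
  exact: sigma_of_process_increment sB.
move=> i s A us sA.
have sE : s = map (fun k => (i, k)) (map snd s).
  rewrite -map_comp -[LHS]map_id; apply/eq_in_map => -[i' k] /= /sA[/= -> _] //.
have us2 : uniq (map snd s) by move: us; rewrite {1}sE map_inj_uniq// => k k' [].
have -> : \bigcap_(k in [set` s]) A k = \bigcap_(k in [set` map snd s]) A (i, k).
  rewrite {1}sE; apply/seteqP; split => w sw k /= ks.
    by apply: sw; apply/mapP; exists k.
  by case/mapP: ks => j jt ->; exact: sw.
rewrite [in RHS]sE big_map.
have := mesh_independent (m := m) (bbm i) (s := map snd s) (A := fun k => A (i, k)) us2.
apply => k ks.
by apply: (sA (i, k) _).2; rewrite sE; apply/mapP; exists k.
Qed.

Lemma measurable_increment (X : R -> Omega -> R) m j :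
  standard_Brownian_motion P X -> measurable_fun setT (increment X m j).
Proof.
by move=> BM; apply: measurable_funB; apply: (BM_measurable BM); rewrite divr_ge0.
Qed.

Lemma measurable_iid_mesh tau X m k : iid_BBMs P tau X ->
  measurable_fun setT (iid_mesh tau X m k).
Proof.
move: k => [i [u|[u j]]] [bbm _]; first exact: (BBM_lifetime_measurable (bbm i) u).
exact: (measurable_increment m j (BBM_motion (bbm i) u)).
Qed.

(** Both families are independent with the same marginals, exponential for lifetimes and Gaussian
    for increments. *)
Lemma iid_mesh_eqlaw tau X tau' X' m : iid_BBMs P tau X -> iid_BBMs P tau' X' ->
  eqlaw P (iid_mesh tau X m) (iid_mesh tau' X' m).
Proof.
move=> bbm bbm'; apply: eqlaw_independent; [exact: iid_mesh_independent|exact: iid_mesh_independent|].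
have [{}bbm _] := bbm; have [{}bbm' _] := bbm'.
move=> [i [u|[u j]]] A mA.
  by rewrite /iid_mesh/= (BBM_lifetime_law (bbm i) u mA) (BBM_lifetime_law (bbm' i) u mA).
rewrite /iid_mesh/=.
have st : (j%:R / m.+1%:R : R) < j.+1%:R / m.+1%:R.
  by rewrite ltr_pM2r ?invr_gt0// ltr_nat.
have s0 : (0 : R) <= j%:R / m.+1%:R by rewrite divr_ge0.
by rewrite (BM_gaussian (BBM_motion (bbm i) u) s0 st mA)
  (BM_gaussian (BBM_motion (bbm' i) u) s0 st mA).
Qed.

End sigma_algebras_of_BBM.

Section discretisation.
Context {R : realType} {d : measure_display} {Omega : measurableType d}.

(** Evaluation of a process at a random time is measurable once the time takes countably many
    values; this is what rounding to the mesh provides. *)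
Lemma measurable_nat_index (S : nat -> Omega -> R) (N : Omega -> nat) :
  (forall l, measurable_fun setT (S l)) ->
  (forall l, measurable [set w | N w = l]) ->
  measurable_fun setT (fun w => S (N w) w).
Proof.
move=> mS mN _ A mA; rewrite setTI.
have -> : (fun w => S (N w) w) @^-1` A =
    \bigcup_l ([set w | N w = l] `&` S l @^-1` A).
  by apply/seteqP; split => [w Aw|w [l _ [/= <-]]]; [exists (N w)|].
apply: bigcupT_measurable => l; apply: measurableI => //.
by rewrite -[X in measurable X]setTI; exact: mS.
Qed.

Lemma measurable_truncn_eq (g : Omega -> R) l :
  measurable_fun setT g -> measurable [set w | Num.truncn (g w) = l].
Proof.
move=> mg.
have mle k : measurable [set w | (Num.truncn (g w) <= k)%N].
  rewrite (_ : [set _ | _] = g @^-1` `]-oo, k.+1%:R[%classic).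
    by rewrite -[X in measurable X]setTI; apply: mg => //; exact: measurable_itv.
  by apply/seteqP; split => w /=; rewrite truncn_le_nat in_itv.
case: l => [|l].
  rewrite (_ : [set _ | _] = [set w | (Num.truncn (g w) <= 0)%N])//.
  by apply/seteqP; split => w /=; [move=> ->|rewrite leqn0 => /eqP].
rewrite (_ : [set _ | _] = [set w | (Num.truncn (g w) <= l.+1)%N] `\`
  [set w | (Num.truncn (g w) <= l)%N]); first exact: measurableD.
apply/seteqP; split => w /=; first by move=> ->; rewrite ltnn leqnn.
by move=> [+ /negP]; rewrite -ltnNge => h1 h2; apply/eqP; rewrite eqn_leq h1.
Qed.

(** Rounding goes down, so that rounded ages add up to at most the true total, and the result is
    never negative, so that it is a meaningful time for a process. *)
Definition grid (m : nat) (s : R) : R := (Num.truncn (m.+1%:R * s))%:R / m.+1%:R.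

Lemma grid_ge0 m s : 0 <= grid m s.
Proof. by rewrite divr_ge0. Qed.

Lemma grid_le m s : 0 <= s -> grid m s <= s.
Proof.
move=> s0; rewrite ler_pdivrMr// mulrC truncn_le.
by rewrite mulr_ge0.
Qed.

Lemma grid_cvg s : 0 <= s -> grid ^~ s @ \oo --> s.
Proof.
move=> s0; apply/cvgrPdist_le => e e0; near=> m.
rewrite ger0_norm ?subr_ge0 ?grid_le// lerBlDr.
have : m.+1%:R * s < (Num.truncn (m.+1%:R * s)).+1%:R := truncnS_gt _.
rewrite -ltr_pdivlMl// => /ltW /le_trans; apply.
rewrite mulrC -natr1 mulrDl addrC lerD2r div1r.
near: m.
by apply: filterS (near_infty_natSinv_lt (PosNum e0)) => k /ltW.
Unshelve. all: by end_near. Qed.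

End discretisation.

Section lifetimes.
Context {R : realType} {d : measure_display} {Omega : measurableType d}.
Variable tau : seq bool -> Omega -> R.
Hypothesis mtau : forall u, measurable_fun setT (tau u).

Lemma measurable_birth u : measurable_fun setT (birth tau u).
Proof.
by apply: measurable_sum => j; exact: mtau.
Qed.

Lemma measurable_birth_le t u : measurable [set w | birth tau u w <= t].
Proof.
rewrite (_ : [set w | _] = birth tau u @^-1` `]-oo, t]); last first.
  by apply/seteqP; split => w /=; rewrite in_itv.
rewrite -[X in measurable X]setTI; exact: measurable_birth.
Qed.

Lemma measurable_clipped_age t u :
  measurable_fun setT (fun w => Num.max 0 (t - birth tau u w)).
Proof.
apply: measurable_maxr => //; apply: measurable_funB => //.
exact: measurable_birth.
Qed.

(** Applied over [Omega] and also over the sigma-algebra generated by the lifetimes alone, where it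
    shows that survival is an event of that sigma-algebra. *)
Lemma measurable_alive t u : measurable [set w | alive tau t w u].
Proof.
rewrite (_ : [set w | _] = (birth tau u @^-1` `]-oo, t]) `&`
  ((fun w => birth tau u w + tau u w) @^-1` `]t, +oo[)); last first.
  by apply/seteqP; split => w /=; rewrite /alive !in_itv/= andbT => /andP.
have mb := measurable_birth u.
apply: measurableI; rewrite -[X in measurable X]setTI.
  by apply: mb => //; exact: measurable_itv.
by apply: measurable_funD => //; exact: mtau.
Qed.

End lifetimes.

Section positions.
Context {R : realType} {d : measure_display} {Omega : measurableType d}.
Variable P : probability Omega R.

Section one_BBM.
Variables (tau : seq bool -> Omega -> R) (X : seq bool -> R -> Omega -> R).

(* Agrees with [position] once u is born; before that, the value of X at the
   negative time t - birth would be junk. *)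
Definition clipped_position (t : R) (u : seq bool) (w : Omega) : R :=
  \sum_(j < size u) X (take j u) (tau (take j u) w) w
  + X u (Num.max 0 (t - birth tau u w)) w.

(** Every stretch of path along the ancestral line is cut at a mesh time, so the result depends on
    lifetimes and mesh increments only. *)
Definition grid_position (m : nat) (t : R) (u : seq bool) (w : Omega) : R :=
  \sum_(j < size u) X (take j u) (grid m (tau (take j u) w)) w
  + X u (grid m (Num.max 0 (t - birth tau u w))) w.

Lemma position_clipped t u w :
  birth tau u w <= t -> position tau X t w u = clipped_position t u w.
Proof. by move=> bt; rewrite /clipped_position max_r// subr_ge0. Qed.

Hypothesis bbm : is_BBM P tau X.

Lemma BM_grid_cvg u s w : 0 <= s ->
  (fun m => X u (grid m s) w) @ \oo --> X u s w.
Proof.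
move=> s0.
have /subspace_continuousP c :
    {within [set t : R | 0 <= t], continuous (fun t => X u t w)}.
  exact: (BM_continuous (BBM_motion bbm u)).
apply: (cvg_comp (fun m => grid m s) (fun t => X u t w) _ (c s s0)).
move=> B sB.
have : \forall m \near \oo, 0 <= grid m s -> B (grid m s) := grid_cvg s0 sB.
apply: filterS => m; apply.
exact: grid_ge0.
Qed.

Lemma grid_position_cvg t u w :
  (fun m => grid_position m t u w) @ \oo --> clipped_position t u w.
Proof.
apply: cvgD.
  apply: cvg_big => [|j _]; first exact: (@add_continuous R).
  apply: BM_grid_cvg.
  exact/ltW/(BBM_lifetime_gt0 bbm).
by apply: BM_grid_cvg; rewrite le_max lexx.
Qed.

Lemma measurable_X_grid m u (g : Omega -> R) : measurable_fun setT g ->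
  measurable_fun setT (fun w => X u (grid m (g w)) w).
Proof.
move=> mg.
apply: (measurable_nat_index (S := fun l => X u (l%:R / m.+1%:R))
  (N := fun w => Num.truncn (m.+1%:R * g w))) => l.
  by apply: (BM_measurable (BBM_motion bbm u)); rewrite divr_ge0.
by apply: measurable_truncn_eq; apply: measurable_funM.
Qed.

Lemma measurable_grid_position m t u : measurable_fun setT (grid_position m t u).
Proof.
apply: measurable_funD; last first.
  by apply: measurable_X_grid; apply: measurable_clipped_age; exact: (BBM_lifetime_measurable bbm).
apply: measurable_sum => j; apply: measurable_X_grid.
exact: (BBM_lifetime_measurable bbm).
Qed.

Lemma measurable_clipped_position t u : measurable_fun setT (clipped_position t u).
Proof.
apply: (measurable_fun_cvg (fun m => measurable_grid_position m t u)) => w _.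
exact: grid_position_cvg.
Qed.

End one_BBM.

Definition state_index := (nat * seq bool * bool)%type.

(** All that [theta] at time [t] needs from the BBMs, as one countable family of real variables: a
    0/1 survival flag and a position for each label. *)
Definition state (tau : nat -> seq bool -> Omega -> R)
    (X : nat -> seq bool -> R -> Omega -> R) (t : R) (k : state_index)
    (w : Omega) : R :=
  let: (i, u, b) := k in
  if b then (birth (tau i) u w <= t < birth (tau i) u w + tau i u w)%R%:R
  else clipped_position (tau i) (X i) t u w.

Lemma measurable_state tau X t k : iid_BBMs P tau X ->
  measurable_fun setT (state tau X t k).
Proof.
move: k => [[i u] [|]] [bbm _]; last exact: (measurable_clipped_position (bbm i)).
rewrite (_ : state _ _ _ _ = \1_[set w | alive (tau i) t w u]).
  by apply: measurable_indic; apply: measurable_alive; exact: (BBM_lifetime_measurable (bbm i)).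
by apply/funext => w; rewrite indicE /= mem_setE.
Qed.

Definition mesh_walk (f : nat * mesh_index -> R) (i : nat) (u : seq bool) (l : nat) : R :=
  \sum_(j < l) f (i, inr (u, val j)).

Definition mesh_birth (f : nat * mesh_index -> R) (i : nat) (u : seq bool) : R :=
  \sum_(j < size u) f (i, inl (take j u)).

(** The survival flag and [grid_position] as deterministic functions of the mesh data, so that
    [eqlaw_comp] carries equality in law over. The flag involves no rounding. *)
Definition mesh_state (m : nat) (t : R) (k : state_index) (f : nat * mesh_index -> R) : R :=
  let: (i, u, b) := k in
  if b then (mesh_birth f i u <= t < mesh_birth f i u + f (i, inl u))%R%:R
  else \sum_(j < size u)
      mesh_walk f i (take j u) (Num.truncn (m.+1%:R * f (i, inl (take j u))))
    + mesh_walk f i u (Num.truncn (m.+1%:R * Num.max 0 (t - mesh_birth f i u))).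

Lemma measurable_mesh_state m t k :
  measurable_fun setT (mesh_state m t k : @pathspace R _ -> R).
Proof.
have mc j : measurable_fun setT ((fun f => f j) : @pathspace R (nat * mesh_index)%type -> R).
  exact: measurable_coordinate.
have mb i u : measurable_fun setT
    ((fun f => mesh_birth f i u) : @pathspace R (nat * mesh_index)%type -> R).
  by apply: measurable_sum.
have mw i u (g : @pathspace R (nat * mesh_index)%type -> R) : measurable_fun setT g ->
    measurable_fun setT ((fun f => mesh_walk f i u (Num.truncn (m.+1%:R * g f)))
      : @pathspace R (nat * mesh_index)%type -> R).
  move=> mg.
  apply: (@measurable_nat_index _ _ (@pathspace R _) (fun l f => mesh_walk f i u l)
    (fun f => Num.truncn (m.+1%:R * g f))) => l.
    by apply: measurable_sum.
  by apply: measurable_truncn_eq; apply: measurable_funM.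
move: k => [[i u] [|]] /=; last first.
  apply: measurable_funD; first by apply: measurable_sum => j; exact: mw.
  by apply: mw; apply: measurable_maxr => //; apply: measurable_funB.
rewrite (_ : mesh_state m t (i, u, true) = \1_((fun f => mesh_birth f i u) @^-1` `]-oo, t]%classic `&`
    (fun f => mesh_birth f i u + f (i, inl u)) @^-1` `]t, +oo[%classic)).
  apply: measurable_indic; apply: measurableI; rewrite -[X in measurable X]setTI.
    by apply: mb => //; exact: measurable_itv.
  by apply: measurable_funD => //; exact: measurable_itv.
apply/funext => f; rewrite indicE; congr (_%:R); apply: congr1.
by apply/idP/idP; rewrite in_setE /= !in_itv/= andbT => /andP.
Qed.

(** The increments telescope and the motion starts at 0. *)
Lemma mesh_walkE tau X m i u l w : iid_BBMs P tau X ->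
  mesh_walk (fun k => iid_mesh tau X m k w) i u l = X i u (l%:R / m.+1%:R) w.
Proof.
move=> [bbm _]; rewrite /mesh_walk.
have -> : \sum_(j < l) iid_mesh tau X m (i, inr (u, val j)) w =
    \sum_(0 <= j < l) (X i u (j.+1%:R / m.+1%:R) w - X i u (j%:R / m.+1%:R) w).
  by rewrite big_mkord.
by rewrite telescope_sumr// mul0r (BM_start (BBM_motion (bbm i) u)) subr0.
Qed.

Lemma mesh_state_cvg tau X t k w : iid_BBMs P tau X ->
  (fun m => mesh_state m t k (fun j => iid_mesh tau X m j w)) @ \oo -->
  state tau X t k w.
Proof.
move=> iid; move: k => [[i u] [|]].
  rewrite (_ : (fun m => _) = fun=> state tau X t (i, u, true) w)//.
  exact: cvg_cst.
rewrite (_ : (fun m => _) = fun m => grid_position (tau i) (X i) m t u w).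
  by apply: grid_position_cvg; case: iid.
apply/funext => m; rewrite /mesh_state; congr (_ + _); last by rewrite (mesh_walkE _ _ _ _ _ iid).
by apply: eq_bigr => j _; rewrite (mesh_walkE _ _ _ _ _ iid).
Qed.

(** For fixed [m] the same function [mesh_state] is applied to mesh data of equal law; path
    continuity gives the pointwise limit in [m]. *)
Theorem state_eqlaw tau X tau' X' t : iid_BBMs P tau X -> iid_BBMs P tau' X' ->
  eqlaw P (state tau X t) (state tau' X' t).
Proof.
move=> iid iid'.
pose V m tau X (k : state_index) (w : Omega) :=
  mesh_state m t k (fun j => iid_mesh tau X m j w).
have mV m k tau0 X0 : iid_BBMs P tau0 X0 -> measurable_fun setT (V m tau0 X0 k).
  move=> iid0; apply: (measurableT_comp (measurable_mesh_state m t k)).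
  apply: (measurable_fun_pathspace (V := iid_mesh tau0 X0 m)) => j.
  exact: (measurable_iid_mesh m j iid0).
apply: (eqlaw_cvg (V_ := fun m => V m tau X) (V'_ := fun m => V m tau' X')).
- by move=> m k; exact: mV.
- by move=> m k; exact: mV.
- by move=> k w; exact: mesh_state_cvg.
- by move=> k w; exact: mesh_state_cvg.
move=> m; apply: eqlaw_comp.
- by move=> k; exact: (measurable_iid_mesh m k iid).
- by move=> k; exact: (measurable_iid_mesh m k iid').
- by move=> k; exact: measurable_mesh_state.
- exact: iid_mesh_eqlaw.
Qed.

End positions.

(** * Gaussian moments of the displacements *)

Section gaussian_integrals.
Context {R : realType}.
Notation mu := (@lebesgue_measure R).

(** Completing the square in the exponent. *)
Lemma normal_pdf_tilt (s l x : R) : s != 0 ->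
  normal_pdf 0 s x * expR (l * x) =
  expR (l ^+ 2 * s ^+ 2 / 2) * normal_pdf (l * s ^+ 2) s x.
Proof.
move=> s0; rewrite !normal_pdfE//= /normal_fun mulrCA -!mulrA -!expRD.
congr (_ * expR _); rewrite subr0.
by field.
Qed.

(** The hypothesis says that -x^2/(2 s^2) + c x^2 = -x^2/(2 s'^2); the quotient of the peaks
    restores the normalisation. *)
Lemma normal_pdf_widen (s s' c x : R) : s != 0 -> s' != 0 ->
  s ^- 2 = s' ^- 2 + c *+ 2 ->
  normal_pdf 0 s x * expR (c * x ^+ 2) =
  normal_peak s / normal_peak s' * normal_pdf 0 s' x.
Proof.
move=> s0 s'0 ss'; rewrite !normal_pdfE//= /normal_fun !subr0.
have p0 : normal_peak s' != 0 by rewrite gt_eqF// normal_peak_gt0.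
rewrite [in RHS]mulrA divfK// -mulrA -expRD; congr (_ * expR _).
have -> : c = (s ^- 2 - s' ^- 2) / 2 by rewrite ss'; field.
by field; rewrite s0 s'0.
Qed.

Lemma integral_normal_expR (s l : R) : s != 0 ->
  (\int[mu]_x (normal_pdf 0 s x * expR (l * x))%:E =
   (expR (l ^+ 2 * s ^+ 2 / 2))%:E)%E.
Proof.
move=> s0; under eq_integral do rewrite normal_pdf_tilt// EFinM.
rewrite ge0_integralZl//=.
- by rewrite integral_normal_pdf mule1.
- by apply/measurable_EFinP; exact: measurable_normal_pdf.
- by move=> x _; rewrite lee_fin normal_pdf_ge0.
Qed.

Lemma integral_normal_expR_sqr (s s' c : R) : s != 0 -> s' != 0 ->
  s ^- 2 = s' ^- 2 + c *+ 2 ->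
  (\int[mu]_x (normal_pdf 0 s x * expR (c * x ^+ 2))%:E =
   (normal_peak s / normal_peak s')%:E)%E.
Proof.
move=> s0 s'0 ss'; under eq_integral do rewrite (normal_pdf_widen _ s0 s'0 ss') EFinM.
rewrite ge0_integralZl//=.
- by rewrite integral_normal_pdf mule1.
- by apply/measurable_EFinP; exact: measurable_normal_pdf.
- by move=> x _; rewrite lee_fin normal_pdf_ge0.
- by rewrite lee_fin divr_ge0// normal_peak_ge0.
Qed.

Lemma integral_exponential_expR (c : R) : 0 <= c ->
  (\int[mu]_x (exponential_pdf 1 x * expR (- c * x))%:E = (1 / (1 + c))%:E)%E.
Proof.
move=> c0; have c1 : 0 < 1 + c by rewrite ltr_pwDl.
have E x : exponential_pdf 1 x * expR (- c * x) = (1 / (1 + c)) * exponential_pdf (1 + c) x.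
  have [x0|x0] := ltP x 0; first by rewrite !lt0_exponential_pdf// mul0r mulr0.
  rewrite !exponential_pdfE// !mul1r mulrA mulVf ?gt_eqF// mul1r -expRD.
  by congr expR; ring.
under eq_integral do rewrite E EFinM.
rewrite ge0_integralZl//=.
- by rewrite integral_exponential_pdf// mule1.
- by apply/measurable_EFinP; exact: measurable_exponential_pdf.
- by move=> x _; rewrite lee_fin exponential_pdf_ge0// ltW.
- by rewrite lee_fin divr_ge0// ltW.
Qed.

End gaussian_integrals.

Section laws.
Context {R : realType} {d : measure_display} {Omega : measurableType d}.
Variable P : probability Omega R.

(** [ge0_integral_transfer] with Lebesgue measure and the weight [pdf] on the left, and the constant
    1. *)
Lemma has_law_pdf_integral (Y : Omega -> R) (pdf f : R -> R) :
  measurable_fun setT Y -> measurable_fun setT pdf -> (forall x, 0 <= pdf x) ->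
  has_law P Y (fun A => \int[lebesgue_measure]_(x in A) (pdf x)%:E)%E ->
  measurable_fun setT f -> (forall x, 0 <= f x) ->
  (\int[P]_w (f (Y w))%:E = \int[lebesgue_measure]_x (pdf x * f x)%:E)%E.
Proof.
move=> mY mpdf pdf0 lawY mf f0.
have := @ge0_integral_transfer R _ _ (measurableTypeR R) Omega lebesgue_measure P pdf idfun Y 1
  mpdf pdf0 (@measurable_id _ _ _) mY ler01.
move=> /(_ _ f mf f0) -> /=; first by rewrite mul1e.
move=> A mA; rewrite mul1e (lawY _ mA) [RHS]integral_mkcond.
apply: eq_integral => x _; rewrite /patch indicE.
by case: ifP => _; rewrite ?mulr1 ?mulr0.
Qed.

Lemma BM_expectation_expR (X : R -> Omega -> R) (l s : R) :
  standard_Brownian_motion P X -> 0 <= s ->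
  (\int[P]_w (expR (l * X s w))%:E = (expR (l ^+ 2 * s / 2))%:E)%E.
Proof.
move=> BM; rewrite le_eqVlt => /predU1P[<-|s0].
  (* Time 0 is treated apart, since the Gaussian law is given for increments between distinct
     times. *)
  under eq_integral do rewrite (BM_start BM) mulr0 expR0.
  by rewrite integral_cst//= probability_setT mule1 mulr0 mul0r expR0.
have sn0 : Num.sqrt s != 0 by rewrite gt_eqF// sqrtr_gt0.
have E w : X s w = X s w - X 0 w by rewrite (BM_start BM) subr0.
have law : has_law P (X s) (normal_prob 0 (Num.sqrt s)).
  have := BM_gaussian BM (lexx 0) s0; rewrite subr0 => H A mA.
  by rewrite -(H A mA); congr (P _); apply/seteqP; split => w /=; rewrite -E.
rewrite (has_law_pdf_integral (pdf := normal_pdf 0 (Num.sqrt s))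
  (f := fun x => expR (l * x)) _ _ _ law).
- by rewrite integral_normal_expR// sqr_sqrtr// ltW.
- by apply: (BM_measurable BM); exact: ltW.
- exact: measurable_normal_pdf.
- by move=> x; exact: normal_pdf_ge0.
- by apply: measurableT_comp => //; apply: measurable_funM.
- by move=> x; exact: expR_ge0.
Qed.

Lemma exponential_expectation_expR (T : Omega -> R) (c : R) : 0 <= c ->
  measurable_fun setT T -> has_law P T (exponential_prob 1) ->
  (\int[P]_w (expR (- c * T w))%:E = (1 / (1 + c))%:E)%E.
Proof.
move=> c0 mT law.
rewrite (has_law_pdf_integral (pdf := exponential_pdf 1)
  (f := fun x => expR (- c * x)) _ _ _ law).
- exact: integral_exponential_expR.
- by [].
- exact: measurable_exponential_pdf.
- by move=> x; exact: exponential_pdf_ge0.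
- by apply: measurableT_comp => //; apply: measurable_funM.
- by move=> x; exact: expR_ge0.
Qed.

End laws.

Section independent_events.
Context {R : realType} {d : measure_display} {Omega : measurableType d}.
Variable P : probability Omega R.

Lemma mutually_independent_inj {I K : choiceType} (f : K -> I)
    (G : I -> set_system Omega) : injective f -> mutually_independent P G ->
  mutually_independent P (fun k => G (f k)).
Proof.
move=> f_inj indG s A us sA.
(* [B] transports [A] to the range of [f] and imposes nothing elsewhere. *)
pose B i := if pselect (exists k, f k = i) is left e then A (projT1 (cid e)) else setT.
have BE k : B (f k) = A k.
  rewrite /B; case: pselect => [e|[]]; last by exists k.
  by case: cid => /= k' /f_inj ->.
have -> : \bigcap_(k in [set` s]) A k = \bigcap_(i in [set` map f s]) B i.
  apply/seteqP; split => w sw i /= => [/mapP[k ks ->]|is_].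
    by rewrite BE; exact: sw.
  by rewrite -BE; apply: sw; exact: map_f.
rewrite indG ?map_inj_uniq//; last by move=> _ /mapP[k ks ->]; rewrite BE; exact: sA.
by rewrite big_map; apply: eq_bigr => k _; rewrite BE.
Qed.

Lemma prod_indic {I : eqType} (Y : I -> Omega -> R) (A : I -> set R) (s : seq I) w :
  \prod_(i <- s) \1_(A i) (Y i w) = \1_(\bigcap_(i in [set` s]) (Y i @^-1` A i)) w :> R.
Proof.
rewrite indicE; have [|] := boolP (w \in _).
  move=> /set_mem sw; rewrite big_seq big1// => i is_.
  by rewrite indicE mem_set//; exact: sw.
rewrite notin_setE => /existsNP[i /not_implyP[is_ Yi]].
apply/eqP; rewrite prodf_seq_eq0; apply/hasP; exists i => //=.
by rewrite indicE memNset.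
Qed.

Lemma expectation_prod_event {I : choiceType} (G : set Omega) (Y : I -> Omega -> R)
    (f : I -> R -> R) (s : seq I) (e : I -> R) :
  measurable G -> (forall i, measurable_fun setT (Y i)) ->
  (forall i, measurable_fun setT (f i)) -> (forall i x, 0 <= f i x) ->
  (forall i, i \in s -> (\int[P]_w (f i (Y i w))%:E)%E = (e i)%:E) ->
  uniq s ->
  (forall A : I -> set R, (forall i, measurable (A i)) ->
    P (G `&` \bigcap_(i in [set` s]) (Y i @^-1` A i)) =
    (P G * \prod_(i <- s) P (Y i @^-1` A i))%E) ->
  (\int[P]_w (\1_G w * \prod_(i <- s) f i (Y i w))%:E =
   (fine (P G) * \prod_(i <- s) e i)%:E)%E.
Proof.
move=> mG mY mf f0 fe us indG; apply: ge0_expectation_prod => //.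
  by rewrite fine_ge0.
move=> A mA.
rewrite fineK ?fin_num_measure// -indG//.
have mB : measurable (\bigcap_(i in [set` s]) (Y i @^-1` A i)).
  exact: (measurable_cylinder s mY mA).
transitivity (\int[P]_w (\1_(G `&` \bigcap_(i in [set` s]) (Y i @^-1` A i)) w)%:E)%E.
  by apply: eq_integral => w _; rewrite prod_indic indicI.
by rewrite integral_indic ?setIT//; exact: measurableI.
Qed.

End independent_events.

Section moments.
Context {R : realType} {d : measure_display} {Omega : measurableType d}.
Variable P : probability Omega R.
Variables (tau : seq bool -> Omega -> R) (X : seq bool -> R -> Omega -> R).
Hypothesis bbm : is_BBM P tau X.

Let mtau := BBM_lifetime_measurable bbm.

Lemma take_inj_size (u : seq bool) (i j : nat) :
  (i <= size u)%N -> (j <= size u)%N -> take i u = take j u -> i = j.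
Proof. by move=> iu ju /(congr1 size); rewrite !size_takel. Qed.

(** Chernoff bound: the indicator of {birth <= t} is at most exp(3t) exp(-3 birth), and E exp(-3
    tau) = 1/4 for each of the |u| independent lifetimes. With the rate 3, the bound 4^-n outweighs
    the 2^n labels of length n. *)
Lemma birth_probability_le t u :
  (P [set w | birth tau u w <= t]%R <= (expR (3 * t) * 4 ^- size u)%:E)%E.
Proof.
have mb := measurable_birth mtau u.
have mB := measurable_birth_le mtau t u.
(* The strict ancestors have distinct lengths, hence form the duplicate-free list that independence
   requires. *)
pose s := [seq take j u | j <- iota 0 (size u)].
have birthE w : birth tau u w = \sum_(v <- s) tau v w.
  rewrite /s big_map.
  have -> : iota 0 (size u) = index_iota 0 (size u) by rewrite /index_iota subn0.
  by rewrite big_mkord.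
have us : uniq s.
  rewrite map_inj_in_uniq ?iota_uniq// => i j.
  rewrite !mem_iota !add0n /= => iu ju; apply: take_inj_size; exact: ltnW.
have indtau := mutually_independent_inj (f := inl) (fun _ _ => @inl_inj _ _ _ _) (BBM_independent bbm).
have := @expectation_prod_event _ _ _ P _ setT tau (fun _ x => expR (- 3 * x)) s
  (fun=> 4^-1) measurableT mtau.
move=> /(_ _ _ _ us) H.
have {H} : (\int[P]_w (expR (- 3 * birth tau u w))%:E = (4 ^- size u)%:E)%E.
  transitivity (\int[P]_w (\1_[set: Omega] w * \prod_(v <- s) expR (- 3 * tau v w))%:E)%E.
    by apply: eq_integral => w _; rewrite birthE mulr_sumr expR_sum indicT mul1r.
  rewrite H.
  - rewrite probability_setT mul1r big_const_seq count_predT /s size_map size_iota.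
    by rewrite iter_mulr_1 exprVn.
  - by move=> _; apply: measurableT_comp => //; apply: measurable_funM.
  - by move=> _ x; exact: expR_ge0.
  - move=> v _; rewrite exponential_expectation_expR//.
    + by congr (_%:E); field.
    + exact: mtau.
    + exact: (BBM_lifetime_law bbm).
  move=> A mA; rewrite setTI probability_setT mul1e.
  by apply: indtau => // v _; exists (A v); [exact: mA|rewrite setTI].
move=> E.
rewrite EFinM -E -ge0_integralZl//=; last first.
  by apply/measurable_EFinP; apply: measurableT_comp => //; apply: measurable_funM.
rewrite -[X in P X]setIT -integral_indic//.
apply: ge0_le_integral => //.
- exact/measurable_EFinP/measurable_indic.
- under eq_fun do rewrite -EFinM; apply/measurable_EFinP; apply: measurable_funM => //.
  by apply: measurableT_comp => //; apply: measurable_funM.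
- move=> w _; rewrite -EFinM lee_fin -expRD indicE.
  have [|] := boolP (_ \in _); last by rewrite expR_ge0.
  move=> /set_mem /= bt; rewrite -expR0 ler_expR mulNr subr_ge0.
  by rewrite ler_pM2l.
Qed.

(** Dynkin's lemma in [G], starting from cylinders of lifetimes, where the claim is the joint
    independence of lifetimes and motions. Injectivity of [v] ensures that the motions belong to
    distinct particles. *)
Lemma sigma_tau_BM_independent (G : set Omega) n (v : 'I_n -> seq bool)
    (s : 'I_n -> R) (A : 'I_n -> set R) :
  injective v -> (forall j, 0 <= s j) -> (forall j, measurable (A j)) ->
  <<s cylinder_system tau measurable >> G ->
  P (G `&` \bigcap_(j in [set` index_enum 'I_n]) (X (v j) (s j) @^-1` A j)) =
  (P G * \prod_j P (X (v j) (s j) @^-1` A j))%E.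
Proof.
move=> v_inj s0 mA sG.
set B := \bigcap_(j in _) _.
have mX j : measurable_fun setT (X (v j) (s j)).
  exact: (BM_measurable (BBM_motion bbm (v j))).
have mB : measurable B by exact: (measurable_cylinder (index_enum 'I_n) mX mA).
(* [D] merges lifetimes and motions into one family of events; a motion outside the range of [v] is
   left unconstrained. *)
pose D (A0 : seq bool -> set R) (l : seq bool + seq bool) : set Omega :=
  match l with
  | inl u => tau u @^-1` A0 u
  | inr u => if [pick j | v j == u] is Some j then X u (s j) @^-1` A j else setT
  end.
have DE A0 j : D A0 (inr (v j)) = X (v j) (s j) @^-1` A j.
  rewrite /D; case: pickP => [j' /eqP/v_inj ->//|/(_ j)]; by rewrite eqxx.
have DP A0 (r : seq (seq bool)) (q : seq 'I_n) : (forall u, measurable (A0 u)) ->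
    uniq r -> uniq q ->
    P (cylinder tau r A0 `&` \bigcap_(j in [set` q]) (X (v j) (s j) @^-1` A j)) =
    (\prod_(u <- r) P (tau u @^-1` A0 u) * \prod_(j <- q) P (X (v j) (s j) @^-1` A j))%E.
  move=> mA0 ur uq.
  pose L := map inl r ++ map (fun j => inr (v j)) q : seq (seq bool + seq bool).
  have -> : cylinder tau r A0 `&` \bigcap_(j in [set` q]) (X (v j) (s j) @^-1` A j) =
      \bigcap_(l in [set` L]) D A0 l.
    apply/seteqP; split => [w [wr wq] l /=|w wL].
      rewrite mem_cat => /orP[] /mapP[k kr ->]; first exact: wr.
      by rewrite DE; exact: wq.
    split => k kr.
      by apply: (wL (inl k)); rewrite /= mem_cat map_f.
    rewrite -(DE A0); apply: (wL (inr (v k))).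
    by rewrite /= mem_cat; apply/orP; right; apply/mapP; exists k.
  rewrite (BBM_independent bbm); first last.
  - move=> l; rewrite mem_cat => /orP[] /mapP[k kr ->] /=.
      by exists (A0 k); [exact: mA0|rewrite setTI].
    apply: sub_sigma_algebra; exists (s k); first exact: s0.
    by exists (A k); [exact: mA|rewrite setTI -(DE A0)].
  - rewrite cat_uniq !map_inj_uniq ?ur ?uq//=; last 2 first.
    + by move=> j j' [/v_inj].
    + by move=> u u' [].
    by rewrite andbT; apply/hasPn => _ /mapP[j _ ->]; apply/negP => /mapP[].
  rewrite big_cat !big_map; congr (_ * _)%E.
  by apply: eq_bigr => j _; rewrite DE.
have PB : P B = (\prod_j P (X (v j) (s j) @^-1` A j))%E.
  have := DP (fun=> setT) [::] (index_enum 'I_n) (fun=> measurableT) isT (index_enum_uniq _).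
  rewrite big_nil mul1e => <-; congr (P _).
  by rewrite (_ : cylinder _ _ _ = setT) ?setTI//; apply/seteqP; split.
rewrite -PB; apply: (indep_sigma_algebra _ _ mB _ sG).
- by apply: cylinder_systemI => //; exact: measurableI.
- by move=> _ [r [A0 [mA0 ->]]]; exact: measurable_cylinder.
move=> _ [r [A0 [mA0 ->]]].
have undupE : cylinder tau r A0 = cylinder tau (undup r) A0.
  by apply/seteqP; split => w wr k; have := wr k; rewrite mem_undup.
rewrite undupE DP ?undup_uniq ?index_enum_uniq// -PB; congr (_ * _)%E.
have := DP A0 (undup r) [::] mA0 (undup_uniq _) isT.
rewrite big_nil mule1 => <-; congr (P _).
by rewrite (_ : \bigcap_(j in _) _ = setT) ?setIT//; apply/seteqP; split.
Qed.

(** The survival event is cut according to the rounded ages. On a piece [G k] the displacement is a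
    sum of motions of distinct particles at fixed times, independent of [G k], which involves
    lifetimes only. Ages sum to [t] and rounding goes down, so the total variance is at most [t]. *)
Lemma grid_position_exp_moment m (l t : R) u :
  (\int[P]_w (\1_[set w | alive tau t w u] w *
     expR (l * grid_position tau X m t u w))%:E <=
   (expR (l ^+ 2 * t / 2))%:E * P [set w | alive tau t w u])%E.
Proof.
pose n := size u.
pose v (j : 'I_n.+1) := take j u.
have v_inj : injective v.
  by move=> i j /take_inj_size ij; apply/val_inj/ij; rewrite -ltnS.
(* Coordinates [j < n] are the lifetimes of the strict ancestors, coordinate [n] is the age of [u]
   itself. *)
pose age (j : 'I_n.+1) w :=
  if (j < n)%N then tau (take j u) w else Num.max 0 (t - birth tau u w).
have age_ge0 j w : 0 <= age j w.
  by rewrite /age; case: ifP => _; [exact/ltW/(BBM_lifetime_gt0 bbm)|rewrite le_max lexx].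
have sum_age w : alive tau t w u -> \sum_j age j w = t.
  move=> /andP[bt _]; rewrite big_ord_recr /= {2}/age ltnn max_r ?subr_ge0//.
  rewrite (eq_bigr (fun j : 'I_n => tau (take j u) w)); first by rewrite addrC subrK.
  by move=> j _; rewrite /age /= ltn_ord.
pose N j w := Num.truncn (m.+1%:R * age j w).
pose L := Num.truncn (m.+1%:R * t).
(* The bound [L] makes the set of patterns finite; [inord] loses nothing when [u] is alive, since
   every age is then at most [t]. *)
pose Nh w : {ffun 'I_n.+1 -> 'I_L.+1} := [ffun j => inord (N j w)].
have NhE w j : alive tau t w u -> Nh w j = N j w :> nat.
  move=> aw; rewrite ffunE inordK// ltnS /N /L le_truncn// ler_pM2l//.
  rewrite -(sum_age w aw) (bigD1 j)//= lerDl; exact: sumr_ge0.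
have gpE w : grid_position tau X m t u w =
    \sum_j X (v j) ((N j w)%:R / m.+1%:R) w.
  rewrite big_ord_recr /= /v /= take_size /N /age ltnn; congr (_ + _).
  by apply: eq_bigr => j _ /=; rewrite ltn_ord.
pose Z (k : {ffun 'I_n.+1 -> 'I_L.+1}) w :=
  \prod_j expR (l * X (v j) ((k j)%:R / m.+1%:R) w).
pose G (k : {ffun 'I_n.+1 -> 'I_L.+1}) := [set w | alive tau t w u] `&` [set w | Nh w = k].
have sumG (a : {ffun 'I_n.+1 -> 'I_L.+1} -> R) w :
    \sum_k \1_(G k) w * a k = \1_[set w | alive tau t w u] w * a (Nh w).
  have GE k : \1_(G k) w = \1_[set w | alive tau t w u] w * (Nh w == k)%:R :> R.
    have <- : (w \in [set w | Nh w = k]) = (Nh w == k).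
      by apply/idP/eqP => [/set_mem|/mem_set].
    by rewrite indicI /= !indicE.
  rewrite (bigD1 (Nh w))//= big1 ?addr0; first by rewrite GE eqxx mulr1.
  by move=> k /negbTE kN; rewrite GE eq_sym kN mulr0 mul0r.
pose T' : measurableType _ := g_sigma_algebraType (cylinder_system tau measurable).
have mtau' u' : measurable_fun setT (tau u' : T' -> R).
  move=> _ A mA; rewrite setTI; apply: sub_sigma_algebra.
  exists [:: u'], (fun=> A); split => //.
  by rewrite cylinder_cons; apply/seteqP; split => [w Aw|w []].
have sG k : <<s cylinder_system tau measurable >> (G k).
  suff : @measurable _ T' (G k) by [].
  apply: measurableI; first exact: (measurable_alive mtau').
  rewrite (_ : [set w | _] = \bigcap_(j in [set` index_enum 'I_n.+1])
      \bigcup_(i in [set i | inord i = k j]) [set w | N j w = i]); last first.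
    apply/seteqP; split => w /=.
      by move=> <- j _; exists (N j w) => //=; rewrite ffunE.
    move=> H; apply/ffunP => j; rewrite ffunE.
    by have [|i /= <- ->//] := H j; rewrite /= mem_index_enum.
  rewrite bigcap_seq; apply: big_ind => //; first exact: (@measurableI _ T').
  move=> j _; apply: bigcup_measurable => i _.
  apply: (@measurable_truncn_eq _ _ T'); apply: measurable_funM => //.
  rewrite /age; case: (ltnP j n) => _; first exact: mtau'.
  exact: (measurable_clipped_age mtau').
have mG k : measurable (G k).
  apply: smallest_sub (sG k); first exact: sigma_algebra_measurable.
  by move=> _ [r [A [mA ->]]]; exact: measurable_cylinder.
have malive := measurable_alive mtau t u.
have mX j s : 0 <= s -> measurable_fun setT (X (v j) s).
  exact: (BM_measurable (BBM_motion bbm (v j))).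
have mZ k : measurable_fun setT (Z k).
  apply: measurable_prod => j _; apply: measurableT_comp => //.
  by apply: measurable_funM => //; apply: mX; rewrite divr_ge0.
have Z0 k w : 0 <= Z k w by apply: prodr_ge0 => j _; exact: expR_ge0.
have intG k : (\int[P]_w (\1_(G k) w * Z k w)%:E =
    (fine (P (G k)) * \prod_j expR (l ^+ 2 * ((k j)%:R / m.+1%:R) / 2))%:E)%E.
  apply: (expectation_prod_event (Y := fun j => X (v j) ((k j)%:R / m.+1%:R))
    (f := fun _ x => expR (l * x)) (s := index_enum 'I_n.+1)) => //.
  - by move=> j; apply: mX; rewrite divr_ge0.
  - by move=> _; apply: measurableT_comp => //; apply: measurable_funM.
  - move=> j _; apply: BM_expectation_expR; first exact: (BBM_motion bbm).
    by rewrite divr_ge0.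
  - exact: index_enum_uniq.
  move=> A mA; apply: (sigma_tau_BM_independent v_inj _ mA (sG k)) => j.
  by rewrite divr_ge0.
have leG k : (\int[P]_w (\1_(G k) w * Z k w)%:E <=
    (expR (l ^+ 2 * t / 2))%:E * \int[P]_w (\1_(G k) w)%:E)%E.
  rewrite intG integral_indic// setIT.
  (* The bound on the times of the pattern [k] is read off at a point of [G k], so the empty piece
     is treated apart. *)
  have [->|/set0P[w [aw /= Nk]]] := eqVneq (G k) set0.
    by rewrite !measure0 mule0 mul0r.
  rewrite EFinM fineK ?fin_num_measure// muleC; apply: lee_wpmul2r => //.
  rewrite lee_fin -expR_sum ler_expR -mulr_suml -mulr_sumr.
  rewrite ler_pM2r// ler_wpM2l ?sqr_ge0// -(sum_age w aw); apply: ler_sum => j _.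
  by rewrite -Nk NhE//; exact: grid_le.
have -> : (\int[P]_w (\1_[set w | alive tau t w u] w *
    expR (l * grid_position tau X m t u w))%:E =
    \int[P]_w (\sum_k (\1_(G k) w * Z k w)%:E))%E.
  apply: eq_integral => w _; rewrite sumEFin (sumG (fun k => Z k w)); congr (_%:E).
  have [aw|naw] := pselect (alive tau t w u); last first.
    by rewrite indicE memNset// !mul0r.
  congr (_ * _); rewrite gpE mulr_sumr expR_sum; apply: eq_bigr => j _.
  by rewrite NhE.
have mG1 k : measurable_fun setT (fun w => (\1_(G k) w)%:E : \bar R).
  exact/measurable_EFinP/measurable_indic.
have <- : (\sum_k \int[P]_w (\1_(G k) w)%:E = P [set w | alive tau t w u])%E.
  rewrite -ge0_integral_sum//.
  rewrite -[in RHS](setIT [set w | _]) -integral_indic//.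
  apply: eq_integral => w _; rewrite sumEFin; congr (_%:E).
  by rewrite -[RHS]mulr1 -(sumG (fun=> 1)); apply: eq_bigr => k _; rewrite mulr1.
rewrite ge0_integral_sum//; last 2 first.
- by move=> k; apply/measurable_EFinP; apply: measurable_funM.
- by move=> k w _; rewrite lee_fin mulr_ge0.
rewrite ge0_sume_distrr; last by move=> k _; exact: integral_ge0.
exact: lee_sum.
Qed.

(** Fatou's lemma along the mesh: the bound for [grid_position] is uniform in [m]. *)
Lemma clipped_position_exp_moment (l t : R) u :
  (\int[P]_w (\1_[set w | alive tau t w u] w *
     expR (l * clipped_position tau X t u w))%:E <=
   (expR (l ^+ 2 * t / 2))%:E * P [set w | alive tau t w u])%E.
Proof.
have malive := measurable_alive mtau t u.
pose g m w := (\1_[set w | alive tau t w u] w * expR (l * grid_position tau X m t u w))%:E.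
have mg m : measurable_fun setT (g m).
  apply/measurable_EFinP; apply: measurable_funM; first exact: measurable_indic.
  apply: measurableT_comp => //; apply: measurable_funM => //.
  exact: (measurable_grid_position bbm).
have g0 m w : setT w -> (0 <= g m w)%E by rewrite lee_fin mulr_ge0// expR_ge0.
have gE w : limn_einf (g ^~ w) = (\1_[set w | alive tau t w u] w *
     expR (l * clipped_position tau X t u w))%:E.
  suff /cvg_limn_einf_sup[->//] : g ^~ w @ \oo --> (\1_[set w | alive tau t w u] w *
     expR (l * clipped_position tau X t u w))%:E.
  apply/cvg_EFin; first exact: nearW.
  apply: cvgM; first exact: cvg_cst.
  apply: (cvg_comp _ expR); last exact: continuous_expR.
  by apply: cvgM; [exact: cvg_cst|exact: (grid_position_cvg bbm)].
under eq_integral do rewrite -gE.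
have /le_trans := fatou P measurableT mg g0; apply.
rewrite limn_einf_lim; apply: lime_le; first exact: is_cvg_einfs.
apply: nearW => m; apply: le_trans (grid_position_exp_moment m l t u).
by apply: ereal_inf_lbound; exists m => /=.
Qed.

(* Averaging the exponential moment over l with law N(0, s^2) produces the
   Gaussian moment, since E exp(l z) = exp (s^2 z^2 / 2). *)
Lemma clipped_position_gauss_moment (t : R) u : 0 <= t ->
  (\int[P]_w (\1_[set w | alive tau t w u] w *
     expR ((4 * (t + 1))^-1 * clipped_position tau X t u w ^+ 2))%:E <=
   (normal_peak (Num.sqrt (2 * (t + 1))^-1) / normal_peak (Num.sqrt (t + 2)^-1))%:E
     * P [set w | alive tau t w u])%E.
Proof.
move=> t0.
(* s^2/2 = 1/(4 (t + 1)) is the wanted exponent. After Fubini the factor exp(t x^2/2) remains, and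
   1/s^2 = (t + 2) + t leaves a Gaussian density of variance 1/(t + 2). *)
pose s := Num.sqrt (2 * (t + 1))^-1.
have t1 : 0 < t + 1 by rewrite ltr_wpDl.
have s2 : s ^+ 2 = (2 * (t + 1))^-1 by rewrite sqr_sqrtr// invr_ge0 mulr_ge0// ltW.
have s0 : s != 0 by rewrite gt_eqF// sqrtr_gt0 invr_gt0 mulr_gt0.
have s'2 : Num.sqrt (t + 2)^-1 ^+ 2 = (t + 2)^-1 by rewrite sqr_sqrtr// invr_ge0 addr_ge0.
have s'0 : Num.sqrt (t + 2)^-1 != 0 by rewrite gt_eqF// sqrtr_gt0 invr_gt0 ltr_wpDl.
have malive := measurable_alive mtau t u.
have mpos := measurable_clipped_position bbm t u.
pose g (p : Omega * measurableTypeR R) : \bar R :=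
  (\1_[set w | alive tau t w u] p.1 *
   (normal_pdf 0 s p.2 * expR (clipped_position tau X t u p.1 * p.2)))%:E.
have mg : measurable_fun setT g.
  apply/measurable_EFinP; apply: measurable_funM.
    exact: (@measurableT_comp _ _ _ _ _ _ (\1_[set w | alive tau t w u] : Omega -> R) _ fst).
  apply: measurable_funM.
    by apply: (measurableT_comp (f := normal_pdf 0 s)) => //; exact: measurable_normal_pdf.
  apply: measurableT_comp => //; apply: measurable_funM => //.
  exact: (measurableT_comp mpos).
have g0 p : (0 <= g p)%E.
  by rewrite lee_fin mulr_ge0// mulr_ge0 ?normal_pdf_ge0// expR_ge0.
have -> : (\int[P]_w (\1_[set w | alive tau t w u] w *
     expR ((4 * (t + 1))^-1 * clipped_position tau X t u w ^+ 2))%:E =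
   \int[P]_w \int[lebesgue_measure]_x g (w, x))%E.
  apply: eq_integral => w _; rewrite /g /=.
  under [RHS]eq_integral do rewrite EFinM.
  rewrite ge0_integralZl//=; last 2 first.
  - apply/measurable_EFinP; apply: measurable_funM; first exact: measurable_normal_pdf.
    by apply: measurableT_comp => //; exact: measurable_funM.
  - by move=> x _; rewrite lee_fin mulr_ge0 ?normal_pdf_ge0// expR_ge0.
  rewrite integral_normal_expR// -EFinM; congr ((_ * expR _)%:E).
  rewrite s2; field; rewrite gt_eqF//.
rewrite (fubini_tonelli g mg g0).
apply: (@le_trans _ _ (\int[lebesgue_measure]_x
    ((normal_pdf 0 s x * expR (t / 2 * x ^+ 2))%:E * P [set w | alive tau t w u]))%E).
  apply: ge0_le_integral => //.
  - by move=> x _; apply: integral_ge0.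
  - exact: measurable_fun_fubini_tonelli_G.
  - apply: emeasurable_funM => //; apply/measurable_EFinP; apply: measurable_funM.
      exact: measurable_normal_pdf.
    apply: measurableT_comp => //; apply: measurable_funM => //.
  move=> x _; rewrite /g /=.
  under eq_integral do rewrite mulrCA EFinM (mulrC (clipped_position _ _ _ _ _)).
  rewrite ge0_integralZl//=; last 2 first.
  - apply/measurable_EFinP; apply: measurable_funM; first exact: measurable_indic.
    by apply: measurableT_comp => //; exact: measurable_funM.
  - by rewrite lee_fin normal_pdf_ge0.
  rewrite EFinM -muleA; apply: lee_wpmul2l; first by rewrite lee_fin normal_pdf_ge0.
  apply: (le_trans (clipped_position_exp_moment _ _ _)).
  by rewrite (_ : x ^+ 2 * t / 2 = t / 2 * x ^+ 2)//; ring.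
have PE : P [set w | alive tau t w u] = (fine (P [set w | alive tau t w u]))%:E.
  by rewrite fineK// fin_num_measure.
rewrite PE ge0_integralZr//=.
- rewrite (integral_normal_expR_sqr (s' := Num.sqrt (t + 2)^-1))//.
  by rewrite s2 s'2 !invrK -mulr_natr; field.
- apply/measurable_EFinP; apply: measurable_funM; first exact: measurable_normal_pdf.
  by apply: measurableT_comp => //; apply: measurable_funM.
- by move=> x _; rewrite lee_fin mulr_ge0 ?normal_pdf_ge0// expR_ge0.
- by rewrite lee_fin fine_ge0.
Qed.

Definition weight (t : R) (u : seq bool) (w : Omega) : R :=
  \1_[set w | alive tau t w u] w *
  expR ((4 * (t + 1))^-1 * clipped_position tau X t u w ^+ 2).

Lemma measurable_weight t u : measurable_fun setT (weight t u).
Proof.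
apply: measurable_funM; first exact/measurable_indic/measurable_alive.
apply: measurableT_comp => //; apply: measurable_funM => //.
apply: measurable_funX; exact: (measurable_clipped_position bbm).
Qed.

End moments.

Definition weight_const {R : realType} (t : R) : R :=
  normal_peak (Num.sqrt (2 * (t + 1))^-1) / normal_peak (Num.sqrt (t + 2)^-1) * expR (3 * t).

Lemma weight_const_ge0 {R : realType} (t : R) : 0 <= weight_const t.
Proof. by rewrite mulr_ge0 ?expR_ge0// divr_ge0// normal_peak_ge0. Qed.

Lemma weight_ge0 {R : realType} {d} {Omega : measurableType d}
    (tau : seq bool -> Omega -> R) X t u w : 0 <= weight tau X t u w.
Proof. by rewrite mulr_ge0// expR_ge0. Qed.

Lemma expectation_weight_le {R : realType} {d} {Omega : measurableType d}
    (P : probability Omega R) (tau : seq bool -> Omega -> R) X (t : R) u :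
  is_BBM P tau X -> 0 <= t ->
  (\int[P]_w (weight tau X t u w)%:E <= (weight_const t * 4 ^- size u)%:E)%E.
Proof.
move=> bbm t0; apply: (le_trans (clipped_position_gauss_moment bbm u t0)).
set c := normal_peak _ / normal_peak _.
have -> : weight_const t * 4 ^- size u = c * (expR (3 * t) * 4 ^- size u).
  by rewrite /weight_const mulrA.
rewrite [leRHS]EFinM; apply: lee_wpmul2l.
  by rewrite lee_fin divr_ge0// normal_peak_ge0.
apply: (le_trans _ (birth_probability_le bbm t u)).
have mtau := BBM_lifetime_measurable bbm.
apply: le_measure.
- exact: (mem_set (measurable_alive mtau t u)).
- exact: (mem_set (measurable_birth_le mtau t u)).
- by move=> w /andP[].
Qed.

(** * Countable sums *)

Lemma cvg_minl {R : realType} (u : nat -> R) (l c : R) :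
  u @ \oo --> l -> (fun n => Num.min (u n) c) @ \oo --> Num.min l c.
Proof.
move=> ul; apply: (cvg_comp u (fun x => Num.min x c) ul).
by apply: (continuous_minr (f := idfun)) => x; [exact: cvg_id|exact: cvg_cst].
Qed.

Lemma ler_lim_fun {R : realType} (u v : nat -> R) (a b : R) :
  u @ \oo --> a -> v @ \oo --> b -> (forall n, u n <= v n) -> a <= b.
Proof.
move=> ua vb uv; have <- : limn u = a by exact/cvg_lim.
have <- : limn v = b by exact/cvg_lim.
by apply: ler_lim; [apply/cvg_ex; exists a|apply/cvg_ex; exists b|exact: nearW].
Qed.

Section countable_sums.
Context {R : realType} {T : countType}.

(** Moves a family over [T] to [nat], with value 0 off the range of the encoding, so that results on
    series and on the counting measure apply. *)
Definition along_pickle (a : T -> \bar R) (k : nat) : \bar R :=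
  oapp a 0%E (pickle_inv k).

Lemma along_pickle_ge0 (a : T -> \bar R) k :
  (forall j, 0 <= a j)%E -> (0 <= along_pickle a k)%E.
Proof. by move=> a0; rewrite /along_pickle; case: pickle_inv => /=. Qed.

Lemma esum_pickle (a : T -> \bar R) : (forall j, 0 <= a j)%E ->
  (\esum_(j in setT) a j = \sum_(k <oo) along_pickle a k)%E.
Proof.
move=> a0; rewrite nneseries_esumT; last by move=> k; exact: along_pickle_ge0.
transitivity (\esum_(k in range (@choice.pickle T)) along_pickle a k)%E.
  rewrite (@reindex_esum R T nat setT (range (@choice.pickle T)) choice.pickle).
    by apply: eq_esum => j _; rewrite /along_pickle pickleK_inv.
  by split => //.
rewrite esum_mkcond; apply: eq_esum => k _; case: ifPn => //.
rewrite notin_setE /along_pickle => kT.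
have := @pickle_invK T k; case: pickle_inv => //= j jk.
by exfalso; apply: kT; exists j.
Qed.

(** Dominated convergence for the counting measure on [nat]. *)
Lemma esum_dominated_cvg (a_ : nat -> T -> R) (a b : T -> R) :
  (forall n j, 0 <= a_ n j <= b j) -> (forall j, a_ ^~ j @ \oo --> a j) ->
  (\esum_(j in setT) (b j)%:E < +oo)%E ->
  (fun n => \esum_(j in setT) (a_ n j)%:E)%E @ \oo --> (\esum_(j in setT) (a j)%:E)%E.
Proof.
move=> ab a_a bfin.
have b0 j : 0 <= b j by have /andP[] := ab 0%N j; exact: le_trans.
have a0 j : 0 <= a j.
  have <- : limn (a_ ^~ j) = a j by apply/cvg_lim => //; exact: a_a.
  apply: limr_ge; first by apply/cvg_ex; exists (a j); exact: a_a.
  by apply: nearW => n; case/andP: (ab n j).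
pose pk (f : T -> R) := along_pickle (fun j => (f j)%:E).
have pk0 f k : (forall j, 0 <= f j) -> (0 <= pk f k)%E.
  by move=> f0; apply: along_pickle_ge0 => j; rewrite lee_fin.
have E f : (forall j, 0 <= f j) ->
    (\esum_(j in setT) (f j)%:E = \int[counting]_k pk f k)%E.
  by move=> f0; rewrite esum_pickle// ge0_integral_count// => k; exact: pk0.
have a_0 n j : 0 <= a_ n j by case/andP: (ab n j).
rewrite E//; under eq_fun do rewrite E//.
have [] := @dominated_convergence _ _ R counting setT measurableT (fun n => pk (a_ n))
  (pk a) (pk b) => //.
- apply: aeW => k _; rewrite /pk /along_pickle; case: pickle_inv => [j|] /=.
    by apply/cvg_EFin; [exact: nearW|exact: a_a].
  exact: cvg_cst.
- apply/integrableP; split => //.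
  under eq_integral do rewrite gee0_abs ?pk0//.
  by rewrite -E.
- apply: aeW => k n _; rewrite /pk /along_pickle; case: pickle_inv => [j|] /=.
    by rewrite ger0_norm// lee_fin; case/andP: (ab n j).
  by rewrite normr0.
Qed.

(** |b_n - b| = b_n + b - 2 min(b_n, b), where the minimum is dominated by [b] itself. *)
Lemma scheffe (b_ : nat -> T -> R) (b : T -> R) :
  (forall n j, 0 <= b_ n j) -> (forall j, b_ ^~ j @ \oo --> b j) ->
  (\esum_(j in setT) (b j)%:E < +oo)%E ->
  (forall n, \esum_(j in setT) (b_ n j)%:E < +oo)%E ->
  (fun n => \esum_(j in setT) (b_ n j)%:E)%E @ \oo --> (\esum_(j in setT) (b j)%:E)%E ->
  (fun n => \esum_(j in setT) (`|b_ n j - b j|)%:E)%E @ \oo --> 0%E.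
Proof.
move=> b_0 b_b bfin b_fin b_sum.
have b0 j : 0 <= b j.
  have <- : limn (b_ ^~ j) = b j by apply/cvg_lim => //; exact: b_b.
  apply: limr_ge; first by apply/cvg_ex; exists (b j); exact: b_b.
  exact: nearW.
pose m n j := Num.min (b_ n j) (b j).
have m0 n j : 0 <= m n j by rewrite le_min b_0 b0.
have m_sum : (fun n => \esum_(j in setT) (m n j)%:E)%E @ \oo --> (\esum_(j in setT) (b j)%:E)%E.
  apply: (esum_dominated_cvg (b := b)) => //.
    by move=> n j; rewrite m0 ge_min lexx orbT.
  by move=> j; rewrite -[X in _ --> X]minxx; exact: cvg_minl.
have m_fin n : (\esum_(j in setT) (m n j)%:E < +oo)%E.
  by apply: le_lt_trans bfin; apply: le_esum => j _; rewrite lee_fin ge_min lexx orbT.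
have m_num n : (\esum_(j in setT) (m n j)%:E \is a fin_num)%E.
  by rewrite ge0_fin_numE// esum_ge0// => j _; rewrite lee_fin.
have b_num : (\esum_(j in setT) (b j)%:E \is a fin_num)%E.
  by rewrite ge0_fin_numE// esum_ge0// => j _; rewrite lee_fin.
have E n : (\esum_(j in setT) (`|b_ n j - b j|)%:E =
    (\esum_(j in setT) (b_ n j)%:E + \esum_(j in setT) (b j)%:E)
    - (\esum_(j in setT) (m n j)%:E + \esum_(j in setT) (m n j)%:E))%E.
  rewrite -!esumD//; [|by move=> j _; rewrite lee_fin..].
  have <- : (\esum_(j in setT) (`|b_ n j - b j|)%:E +
      \esum_(j in setT) ((m n j)%:E + (m n j)%:E) =
      \esum_(j in setT) ((b_ n j)%:E + (b j)%:E))%E.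
    rewrite -esumD//; [|by move=> j _; rewrite ?adde_ge0// lee_fin..].
    apply: eq_esum => j _; rewrite -!EFinD; congr (_%:E).
    by rewrite /m; case: leP => bj; [rewrite ler0_norm|rewrite gtr0_norm];
      rewrite ?subr_le0 ?subr_gt0//; ring.
  rewrite addeK// esumD//; [|by move=> j _; rewrite lee_fin..].
  by rewrite fin_numD m_num.
under eq_fun do rewrite E.
rewrite -(@subee _ (\esum_(j in setT) (b j)%:E + \esum_(j in setT) (b j)%:E)%E); last first.
  by rewrite fin_numD b_num.
apply: cvgeB.
- by rewrite fin_num_adde_defl// fin_numN fin_numD b_num.
- apply: cvgeD => //; [by rewrite fin_num_adde_defl|exact: cvg_cst].
- by apply: cvgeD => //; rewrite fin_num_adde_defl.
Qed.

(** min(a_n, b) has the fixed majorant [b], and a_n exceeds it by at most |b_n - b|, whose sum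
    vanishes in the limit. *)
Lemma esum_dominated_cvg_moving (a_ b_ : nat -> T -> R) (a b : T -> R) :
  (forall n j, 0 <= a_ n j <= b_ n j) -> (forall j, a_ ^~ j @ \oo --> a j) ->
  (\esum_(j in setT) (b j)%:E < +oo)%E ->
  (fun n => \esum_(j in setT) (`|b_ n j - b j|)%:E)%E @ \oo --> 0%E ->
  (fun n => \esum_(j in setT) (a_ n j)%:E)%E @ \oo --> (\esum_(j in setT) (a j)%:E)%E.
Proof.
move=> ab a_a bfin b_b.
have a_0 n j : 0 <= a_ n j by case/andP: (ab n j).
have b_j j : b_ ^~ j @ \oo --> b j.
  apply/cvgrPdist_le => e e0.
  have /fine_cvgP[fin /cvgrPdist_lt /(_ e e0)] := b_b.
  apply: filterS2 fin => n fin; rewrite sub0r normrN => /ltW; apply: le_trans.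
  rewrite distrC; apply: le_trans (ler_norm _).
  rewrite -lee_fin fineK//; apply: esum_ge; exists [set j].
    by split => //; exact: finite_set1.
  by rewrite fsbig_set1.
have a_le j : a j <= b j.
  by apply: (ler_lim_fun (a_a j) (b_j j)) => n; case/andP: (ab n j).
have a0 j : 0 <= a j.
  by apply: (ler_lim_fun (cvg_cst 0) (a_a j)) => n; exact: a_0.
have m_cvg : (fun n => \esum_(j in setT) (Num.min (a_ n j) (b j))%:E)%E @ \oo -->
    (\esum_(j in setT) (a j)%:E)%E.
  apply: (esum_dominated_cvg (b := b)) => //.
    by move=> n j; rewrite le_min a_0 (le_trans (a0 j))//= ge_min lexx orbT.
  by move=> j; rewrite -[X in _ --> X](min_idPl (a_le j)); exact: cvg_minl.
apply: (squeeze_cvge (h := fun n => \esum_(j in setT) (Num.min (a_ n j) (b j))%:E +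
    \esum_(j in setT) (`|b_ n j - b j|)%:E)%E _ _ m_cvg).
- apply: nearW => n; apply/andP; split.
    by apply: le_esum => j _; rewrite lee_fin ge_min lexx.
  have b0 j : 0 <= b j by exact: le_trans (a0 j) (a_le j).
  rewrite -esumD//; [|by move=> j _; rewrite lee_fin ?le_min ?a_0 ?b0..].
  apply: le_esum => j _; rewrite -EFinD lee_fin -lerBlDl.
  have [_|ba] := leP (a_ n j) (b j); first by rewrite subrr.
  by apply: le_trans (ler_norm _); rewrite lerD2r; case/andP: (ab n j).
- rewrite -[X in _ --> X]adde0; apply: cvgeD => //.
  by rewrite fin_num_adde_defl.
Qed.

End countable_sums.

(** * Point measures and Gaussian tails *)

Section dirac_sums.
Context {R : realType} {T : countType}.
Variables (D : set T) (y : T -> R).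

Definition restrict0 (f : R -> \bar R) (j : T) : \bar R :=
  if `[< D j >] then f (y j) else 0%E.

Lemma restrict0_ge0 f j : (forall x, 0 <= f x)%E -> (0 <= restrict0 f j)%E.
Proof. by rewrite /restrict0; case: ifP. Qed.

Lemma esum_restrict0 f : (\esum_(j in D) f (y j) = \esum_(j in setT) restrict0 f j)%E.
Proof.
rewrite esum_mkcond; apply: eq_esum => j _; rewrite /restrict0.
by have [Dj|Dj] := pselect (D j);
  [rewrite mem_set// asboolT|rewrite memNset// asboolF].
Qed.

(** The measure is rewritten as a series over [nat] of Dirac masses and zero measures, which can be
    integrated term by term. *)
Lemma ge0_integral_dirac_sum (f : R -> \bar R) :
  measurable_fun setT f -> (forall x, 0 <= f x)%E ->
  (\int[dirac_sum D y]_x f x = \esum_(j in setT) restrict0 f j)%E.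
Proof.
move=> mf f0.
pose m_ (k : nat) : {measure set (measurableTypeR R) -> \bar R} :=
  if pickle_inv k is Some j then
    (if `[< D j >] then (\d_(y j : measurableTypeR R) : {measure set _ -> \bar R}) else mzero)
  else mzero.
have intm k (g : R -> \bar R) : measurable_fun setT g ->
    (\int[m_ k]_x g x = along_pickle (restrict0 g) k)%E.
  move=> mg; rewrite /m_ /along_pickle /restrict0; case: pickle_inv => [j|] /=.
    case: ifPn => _; last by rewrite integral_measure_zero.
    by rewrite integral_dirac// diracT mul1e.
  by rewrite integral_measure_zero.
have mE k A : measurable A -> m_ k A = along_pickle (restrict0 (fun x => (\1_A x)%:E)) k.
  move=> mA; rewrite -intm; last exact/measurable_EFinP/measurable_indic.
  by rewrite integral_indic// setIT.
rewrite esum_pickle; last by move=> j; exact: restrict0_ge0.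
rewrite (eq_measure_integral (mseries m_ 0)); last first.
  move=> A mA _; rewrite /mseries/=.
  transitivity (\esum_(j in setT) restrict0 (fun x => (\1_A x)%:E) j)%E.
    exact: (esum_restrict0 (fun x => (\1_A x)%:E)).
  rewrite esum_pickle; last by move=> j; apply: restrict0_ge0 => x; rewrite lee_fin.
  by apply: eq_eseriesr => k _; rewrite mE.
rewrite ge0_integral_measure_series//.
by apply: eq_eseriesr => k _; rewrite intm.
Qed.

Let dirac_sum_esum1 (A : set R) :
  (dirac_sum D y A = \esum_(j in D `&` y @^-1` A) (1 : \bar R))%E.
Proof.
rewrite /dirac_sum esum_mkcondr; apply: eq_esum => j _.
by rewrite diracE; have [yA|yA] := pselect (A (y j));
  [rewrite !mem_set|rewrite !memNset].
Qed.

Lemma dirac_sum_finite (A : set R) : finite_set (D `&` y @^-1` A) ->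
  dirac_sum D y A = #|` fset_set (D `&` y @^-1` A)|%fset%:R%:E.
Proof.
move=> finE; rewrite dirac_sum_esum1 esum_fset// fsbig_finite//= sumEFin.
by rewrite big_const_seq count_predT iter_addr_0.
Qed.

Lemma dirac_sum_infinite (A : set R) : infinite_set (D `&` y @^-1` A) ->
  dirac_sum D y A = +oo%E.
Proof.
move=> infE; rewrite dirac_sum_esum1; apply/eqyP => r r0.
have [B BE Br] := infinite_set_fset (Num.truncn r).+1 infE.
apply: esum_ge; exists [set` B] => //.
apply: (@le_trans _ _ (Num.truncn r).+1%:R%:E); first by rewrite lee_fin ltW// truncnS_gt.
by rewrite fsbig_finite//= sumEFin set_fsetK big_const_seq count_predT iter_addr_0 lee_fin ler_nat.
Qed.

Lemma dirac_sum_fin_set (A : set R) :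
  (dirac_sum D y A < +oo)%E -> finite_set (D `&` y @^-1` A).
Proof. by apply: contraPP => /dirac_sum_infinite ->; rewrite ltxx. Qed.

Lemma dirac_sum_integer : integer_valued (dirac_sum D y).
Proof.
move=> A mA; have [finE|infE] := pselect (finite_set (D `&` y @^-1` A)).
  by right; eexists; exact: dirac_sum_finite.
by left; exact: dirac_sum_infinite.
Qed.

Lemma dirac_sum_gt0 (A : set R) : (0 < dirac_sum D y A)%E <-> exists2 j, D j & A (y j).
Proof.
split => [|[j Dj Aj]].
  apply: contraPP => nD; apply/negP; rewrite -leNgt /dirac_sum esum1// => j Dj.
  by rewrite diracE memNset// => /= yj; apply: nD; exists j.
apply: (@lt_le_trans _ _ 1%E) => //; apply: esum_ge; exists [set j].
  by split; [exact: finite_set1|move=> _ ->].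
by rewrite fsbig_set1 diracE mem_set.
Qed.

End dirac_sums.

Section gaussian_tail.
Context {R : realType}.

(** The function f_k of the overview, with a real parameter. It equals 1 on the positive half-line,
    so its integrability bounds the mass there as well. *)
Definition tail (k x : R) : R := expR (- (Num.min x 0 ^+ 2 / k)).

Lemma tail_ge0 k x : 0 <= tail k x. Proof. exact: expR_ge0. Qed.

Lemma tail_le1 k x : 0 < k -> tail k x <= 1.
Proof.
by move=> k0; rewrite -expR0 ler_expR oppr_le0 divr_ge0 ?sqr_ge0// ltW.
Qed.

Lemma tail_neg k x : x <= 0 -> tail k x = expR (- (x ^+ 2 / k)).
Proof. by move=> x0; rewrite /tail min_l. Qed.

Lemma tail_homo k : 0 < k -> {homo tail k : x y / x <= y}.
Proof.
move=> k0 x y xy; rewrite ler_expR lerN2 ler_pM2r ?invr_gt0//.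
rewrite -[leRHS]sqrrN -[leLHS]sqrrN ler_sqr ?nnegrE ?oppr_ge0 ?ge_min ?lexx ?orbT//.
by rewrite lerN2 le_min !ge_min xy lexx !orbT.
Qed.

Lemma tail_le k k' x : 0 < k -> k <= k' -> tail k x <= tail k' x.
Proof.
move=> k0 kk'; rewrite ler_expR lerN2 ler_wpM2l ?sqr_ge0// lef_pV2//.
by rewrite posrE (lt_le_trans k0).
Qed.

Lemma continuous_tail k : continuous (tail k).
Proof.
move=> x; apply: (cvg_comp _ expR); last exact: continuous_expR.
apply: (@cvgN _ R^o); apply: cvgM; last exact: cvg_cst.
apply: (cvg_comp (fun x => Num.min x 0) (fun x => x ^+ 2)); last exact: sqr_continuous.
by apply: (continuous_minr (f := idfun)) => z; [exact: cvg_id|exact: cvg_cst].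
Qed.

Lemma measurable_tail k : measurable_fun setT (tail k).
Proof. apply: continuous_measurable_fun; exact: continuous_tail. Qed.

(** min(x, 0)^2 <= 2 min(x + z, 0)^2 + 2 z^2, and this factor 2 turns [k] into [2 * k] in the tail
    on the right. *)
Lemma tail_shift k x z : 0 < k -> tail k (x + z) <= tail (2 * k) x * expR (z ^+ 2 / k).
Proof.
move=> k0; rewrite -expRD ler_expR.
rewrite -subr_ge0 (_ : _ - _ =
    (2 * Num.min (x + z) 0 ^+ 2 + 2 * z ^+ 2 - Num.min x 0 ^+ 2) / (2 * k)); last first.
  by field; rewrite gt_eqF.
apply: divr_ge0; last by rewrite mulr_ge0// ltW.
(* When [x] and [x + z] are both non-positive, the numerator is exactly (x + 2z)^2. *)
have h1 := sqr_ge0 (x + 2 * z); have h2 := sqr_ge0 (x + z); have h3 := sqr_ge0 z.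
have [xz|xz] := leP (x + z) 0; have [x0|x0] := leP x 0; rewrite ?expr0n /= ?mulr0.
- by nra.
- by nra.
- have h4 : 0 <= - x * (x + z) by rewrite mulr_ge0 ?oppr_ge0// ltW.
  by nra.
- by nra.
Qed.

Lemma alpha_le_tail n x : 0 <= alpha n x <= tail n%:R x.
Proof.
rewrite /alpha; case: ifPn => [x1|].
  by rewrite expR_ge0/= tail_neg// (le_trans x1).
rewrite -ltNge => x1; case: ifPn => [x0|_]; last by rewrite lexx tail_ge0.
rewrite mulNr oppr_ge0 -mulrN mulr_ge0_le0 ?expR_ge0//= ?(ltW x0)//.
rewrite tail_neg ?(ltW x0)// -[leRHS]mulr1; apply: ler_pM; rewrite ?expR_ge0 ?oppr_ge0 ?(ltW x0)//; last first.
  by rewrite lerNl ltW.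
rewrite ler_expR lerN2 -[leRHS]mul1r ler_wpM2r ?invr_ge0//.
nra.
Qed.

Lemma continuous_alpha n : continuous (alpha n : R -> R).
Proof.
(* A single formula in minima and maxima makes continuity across -1 and 0 immediate. *)
pose g (x : R) := expR (- (Num.min x (-1) ^+ 2 / n%:R)) * Num.max (Num.min (- x) 1) 0.
have -> : alpha n = g.
  apply/funext => x; rewrite /alpha /g.
  have [x1|x1] := leP x (-1).
    rewrite (min_idPr (_ : 1 <= - x)); last by rewrite lerNr.
    by rewrite (max_idPl _)// mulr1.
  rewrite sqrrN expr1n; have [x0|x0] := ltP x 0.
    rewrite (min_idPl (_ : - x <= 1)); last by rewrite lerNl ltW.
    by rewrite (max_idPl _) ?oppr_ge0 ?ltW// div1r mulNr mulrN.
  by rewrite (max_idPr _) ?mulr0// ge_min oppr_le0 x0.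
have idc : continuous (idfun : R -> R) by move=> x; exact: cvg_id.
move=> x; apply: cvgM.
  apply: (cvg_comp _ expR); last exact: continuous_expR.
  apply: (@cvgN _ R^o); apply: cvgM; last exact: cvg_cst.
  apply: (cvg_comp (fun x => Num.min x (-1)) (fun x => x ^+ 2)); last exact: sqr_continuous.
  by apply: (continuous_minr (f := idfun)) => // z; exact: cvg_cst.
apply: (continuous_maxr (f := fun x => Num.min (- x) 1)); last by move=> z; exact: cvg_cst.
apply: (continuous_minr (f := fun x => - x)); last by move=> z; exact: cvg_cst.
by move=> z; apply: (@cvgN _ R^o); exact: cvg_id.
Qed.

End gaussian_tail.

Lemma measurable_nneseries {R : realType} {d} {T : measurableType d}
    (h : nat -> T -> \bar R) : (forall k x, 0 <= h k x)%E ->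
  (forall k, measurable_fun setT (h k)) ->
  measurable_fun setT (fun x => \sum_(k <oo) h k x)%E.
Proof. by move=> h0 mh; apply: (ge0_emeasurable_sum (P := predT)). Qed.

Section M2_tails.
Context {R : realType}.
Implicit Types eta : measure_on_line R.

Lemma tail_chebyshev eta (A : set R) (k c : R) : measurable A -> 0 < c ->
  (forall x, A x -> c <= tail k x) ->
  (eta A <= (c^-1)%:E * \int[eta]_x (tail k x)%:E)%E.
Proof.
move=> mA c0 cA.
rewrite -ge0_integralZl//=; last 3 first.
- by apply/measurable_EFinP; exact: measurable_tail.
- by move=> x _; rewrite lee_fin tail_ge0.
- by rewrite lee_fin invr_ge0 ltW.
rewrite -[X in eta X]setIT -integral_indic//.
apply: ge0_le_integral => //.
- exact/measurable_EFinP/measurable_indic.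
- under eq_fun do rewrite -EFinM; apply/measurable_EFinP; apply: measurable_funM => //.
  exact: measurable_tail.
- move=> x _; rewrite -EFinM lee_fin indicE.
  have [|] := boolP (x \in A); last by rewrite mulr_ge0 ?tail_ge0// invr_ge0 ltW.
  by move=> /set_mem Ax; rewrite mulrC ler_pdivlMr// mul1r cA.
Qed.

(** Markov's inequality bounds the mass of [a, +oo[, a <= 0, by exp(a^2/k) times the integral of
    f_k. At a = -m the logarithm is at most m^2/k plus a constant, and k is arbitrary. *)
Lemma tail_integrable_inM2 eta : integer_valued eta -> (eta [set: R] != 0)%E ->
  (forall k : nat, \int[eta]_x (tail k.+1%:R x)%:E < +oo)%E -> inM2 eta.
Proof.
move=> int_eta eta0 fin_tail.
have half_line (a : R) : a <= 0 -> forall k : nat, (eta `[a, +oo[%classic <=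
    ((expR (- (a ^+ 2 / k.+1%:R)))^-1)%:E * \int[eta]_x (tail k.+1%:R x)%:E)%E.
  move=> a0 k; apply: tail_chebyshev => //; first exact: expR_gt0.
  by move=> x; rewrite /= in_itv/= andbT => ax; rewrite -tail_neg//; exact: tail_homo.
have half_line_fin (a : R) : a <= 0 -> (eta `[a, +oo[%classic < +oo)%E.
  move=> a0; apply: le_lt_trans (half_line a a0 0%N) _.
  by rewrite lte_mul_pinfty// lee_fin invr_ge0 expR_ge0.
have le_half_line (A : set R) (a : R) : measurable A -> (forall x, A x -> a <= x) ->
    (eta A <= eta `[a, +oo[%classic)%E.
  by move=> mA Aa; apply: le_measure; [exact: (mem_set mA)|exact: (mem_set (measurable_itv _))|
    move=> x Ax; rewrite /= in_itv/= andbT Aa].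
split => //.
- split => // K cK; have [M [_ KM]] := compact_bounded cK.
  have M1 : M < Num.max M 0 + 1 by rewrite ltr_pwDr// le_max lexx.
  apply: le_lt_trans (half_line_fin (- (Num.max M 0 + 1)) _); last first.
    by rewrite oppr_le0 addr_ge0// le_max lexx orbT.
  apply: le_half_line; first by
    apply: closed_measurable; apply: compact_closed => //; exact: Rhausdorff.
  by move=> x /(KM _ M1) /=; rewrite ler_norml => /andP[].
- exact: half_line_fin.
apply/cvgrPdist_le => e e0.
(* One half of [e] pays for the Gaussian exponent, the other for [ln C], which is negligible against
   m^2. *)
have [k ke] : exists k : nat, k.+1%:R^-1 <= e / 2 :> R.
  have [N _ /(_ N (leqnn _))/ltW] := near_infty_natSinv_lt (PosNum (divr_gt0 e0 (ltr0n R 2))).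
  by exists N.
pose S := fine (\int[eta]_x (tail k.+1%:R x)%:E)%E.
have SE : (\int[eta]_x (tail k.+1%:R x)%:E = S%:E)%E.
  by rewrite fineK// ge0_fin_numE// integral_ge0// => x _; rewrite lee_fin tail_ge0.
have S0 : 0 <= S by rewrite fine_ge0// integral_ge0// => x _; rewrite lee_fin tail_ge0.
pose C := Num.max S 1.
have C1 : 1 <= C by rewrite le_max lexx orbT.
near=> m.
have m1 : (1 : R) <= m%:R by near: m; exact: nbhs_infty_ger.
have m0 : (0 : R) < m%:R by exact: lt_le_trans m1.
have mC : ln C <= e / 2 * m%:R.
  rewrite mulrC -ler_pdivrMr ?divr_gt0//; near: m; exact: nbhs_infty_ger.
have etam : (eta `[(- m%:R)%R, (- m%:R + 1)%R]%classic <= (expR (m%:R ^+ 2 / k.+1%:R) * S)%:E)%E.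
  apply: (@le_trans _ _ (eta `[(- m%:R)%R, +oo[%classic)%E).
    apply: le_half_line; first exact: measurable_itv.
    by move=> x; rewrite /= in_itv/= => /andP[].
  apply: le_trans (half_line _ _ k) _; first by rewrite oppr_le0 ltW.
  by rewrite SE -EFinM sqrrN -expRN opprK.
have lnm : ln (Num.max (fine (eta `[- m%:R, - m%:R + 1]%classic)) 1) <=
    m%:R ^+ 2 / k.+1%:R + ln C.
  rewrite -[m%:R ^+ 2 / k.+1%:R]expRK -lnM ?posrE ?expR_gt0//; last exact: lt_le_trans C1.
  rewrite ler_ln ?posrE; last 2 first.
  - by rewrite lt_max ltr01 orbT.
  - by rewrite mulr_gt0 ?expR_gt0//; exact: lt_le_trans C1.
  have e1 : 1 <= expR (m%:R ^+ 2 / k.+1%:R : R).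
    by rewrite -expR0 ler_expR divr_ge0// sqr_ge0.
  rewrite ge_max; apply/andP; split; last first.
    by rewrite -[leLHS]mul1r ler_pM.
  apply: (@le_trans _ _ (expR (m%:R ^+ 2 / k.+1%:R) * S)).
    rewrite -lee_fin fineK// ge0_fin_numE//; exact: le_lt_trans etam (ltry _).
  by rewrite ler_pM2l ?expR_gt0// le_max lexx.
have ln0 : 0 <= ln (Num.max (fine (eta `[- m%:R, - m%:R + 1]%classic)) 1).
  by rewrite ln_ge0// le_max lexx orbT.
rewrite sub0r normrN ger0_norm ?divr_ge0 ?sqr_ge0//.
rewrite ler_pdivrMr ?exprn_gt0//; apply: (le_trans lnm).
rewrite [e in leRHS]splitr mulrDl; apply: lerD.
  by rewrite mulrC ler_pM2r ?exprn_gt0.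
apply: (le_trans mC); rewrite ler_pM2l ?divr_gt0// expr2.
by rewrite -[leLHS]mul1r ler_pM.
Unshelve. all: by end_near. Qed.

Lemma geometric_nneseries_lty (a : nat -> \bar R) (q : R) : 0 < q < 1 ->
  (forall n, 0 <= a n < +oo)%E -> (\forall n \near \oo, (a n <= (q ^+ n)%:E)%E) ->
  (\sum_(n <oo) a n < +oo)%E.
Proof.
move=> /andP[q0 q1] a0 [N _ aN].
have aE n : a n = (fine (a n))%:E.
  by rewrite fineK// ge0_fin_numE; case/andP: (a0 n).
have f0 n : 0 <= fine (a n) by rewrite fine_ge0//; case/andP: (a0 n).
have r0 n : 0 <= fine (a n) / q ^+ n by rewrite divr_ge0// exprn_ge0// ltW.
(* Division by q^n lets one constant dominate the finitely many terms before [N]. *)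
pose C := 1 + \sum_(n < N) fine (a n) / q ^+ n.
have C1 : 1 <= C by rewrite lerDl sumr_ge0.
have aC n : (a n <= (C * q ^+ n)%:E)%E.
  have [Nn|nN] := leqP N n.
    apply: le_trans (aN n Nn) _; rewrite lee_fin -[leLHS]mul1r ler_pM//.
    by rewrite exprn_ge0// ltW.
  rewrite aE lee_fin -ler_pdivrMr ?exprn_gt0// /C (bigD1 (Ordinal nN))//= addrCA.
  by rewrite lerDl addr_ge0// sumr_ge0.
have geo : (fun n => \sum_(0 <= i < n) (geometric C q i)) @ \oo --> C / (1 - q).
  by apply: cvg_geometric_series; rewrite ger0_norm// ltW.
apply: (@le_lt_trans _ _ (C / (1 - q))%:E); last exact: ltry.
apply: (@le_trans _ _ (\sum_(n <oo) (C * q ^+ n)%:E)%E).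
  by apply: lee_nneseries => // n _ _; case/andP: (a0 n).
rewrite le_eqVlt; apply/orP; left; apply/eqP.
apply/cvg_lim => //.
under eq_fun do rewrite sumEFin.
by apply/cvg_EFin; [exact: nearW|exact: geo].
Qed.

(** The negative axis is cut into the intervals [-(n+1), -n], where the tail is at most exp(-n^2/k).
    By the growth condition their masses are eventually at most exp((n+1)^2/(8k)), so the
    contributions decay geometrically. *)
Lemma inM2_tail_integrable eta (k : R) : inM2 eta -> 0 < k ->
  (\int[eta]_x (tail k x)%:E < +oo)%E.
Proof.
move=> [[_ lf] _ half_line growth] k0.
pose I_ (n : nat) : set R := `[- n.+1%:R, - n.+1%:R + 1]%classic.
have mI n : measurable (I_ n) by exact: measurable_itv.
pose g x : \bar R := ((\1_(`[0, +oo[%classic : set R) x)%:E +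
  \sum_(n <oo) (expR (- (n%:R ^+ 2 / k)) * \1_(I_ n) x)%:E)%E.
have mterm n : measurable_fun setT (fun x : R => (expR (- (n%:R ^+ 2 / k)) * \1_(I_ n) x)%:E).
  apply/measurable_EFinP; apply: measurable_funM => //; exact: measurable_indic.
have term0 n (x : R) : (0 <= (expR (- (n%:R ^+ 2 / k)) * \1_(I_ n) x)%:E)%E.
  by rewrite lee_fin mulr_ge0// expR_ge0.
have series0 (x : R) : (0 <= \sum_(n <oo) (expR (- (n%:R ^+ 2 / k)) * \1_(I_ n) x)%:E)%E.
  exact: nneseries_ge0.
have tail_g x : ((tail k x)%:E <= g x)%E.
  have [x0|x0] := leP 0 x.
    apply: (@le_trans _ _ 1%E); first by rewrite lee_fin tail_le1.
    by rewrite /g indicE mem_set/= ?in_itv/= ?x0// leeDl.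
  pose n := Num.truncn (- x).
  have /andP[nx xn] : n%:R <= - x < n.+1%:R by rewrite truncn_itv// oppr_ge0 ltW.
  have xI : I_ n x.
    rewrite /I_/= in_itv/= lerNl (ltW xn)/= -natr1 opprD addrNK lerNr nx//.
  rewrite /g (nneseriesD1 (n := n))//= addeCA.
  rewrite indicE (mem_set xI) mulr1.
  apply: le_trans (leeDl _ _); last first.
    by rewrite adde_ge0// ?lee_fin// nneseries_ge0.
  rewrite lee_fin (tail_neg k (ltW x0)) ler_expR lerN2 ler_pM2r ?invr_gt0//.
  by rewrite -[leRHS]sqrrN ler_sqr ?nnegrE// oppr_ge0 ltW.
apply: (@le_lt_trans _ _ (\int[eta]_x g x)%E).
  apply: ge0_le_integral => //.
  - by move=> x _; rewrite lee_fin tail_ge0.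
  - by apply/measurable_EFinP; exact: measurable_tail.
  - apply: emeasurable_funD; first by apply/measurable_EFinP; exact: measurable_indic.
    by apply: measurable_nneseries.
rewrite ge0_integralD//=; last 2 first.
- by apply/measurable_EFinP; exact: measurable_indic.
- by apply: measurable_nneseries.
rewrite integral_indic// setIT integral_nneseries//.
apply: lte_add_pinfty => //.
have Ifin n : (eta (I_ n) < +oo)%E by apply: lf; exact: segment_compact.
have termE n : (\int[eta]_x (expR (- (n%:R ^+ 2 / k)) * \1_(I_ n) x)%:E =
    (expR (- (n%:R ^+ 2 / k)))%:E * eta (I_ n))%E.
  under eq_integral do rewrite EFinM.
  rewrite ge0_integralZl//.
  - by rewrite integral_indic ?setIT//; exact: mI.
  - by apply/measurable_EFinP; exact: (measurable_indic (mI n)).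
under eq_eseriesr do rewrite termE.
apply: (geometric_nneseries_lty (q := expR (- (2 * k)^-1))).
- by rewrite expR_gt0/= -expR0 ltr_expR oppr_lt0 invr_gt0 mulr_gt0.
- by move=> n; rewrite mule_ge0 ?lee_fin ?expR_ge0//= lte_mul_pinfty// lee_fin expR_ge0.
have e0 : 0 < (8 * k)^-1 by rewrite invr_gt0 mulr_gt0.
have := growth => /cvgrPdist_le /(_ _ e0) [N _ HN].
near=> n.
have n1 : (1 : R) <= n%:R by near: n; exact: nbhs_infty_ger.
have Nn : (N <= n.+1)%N by rewrite ltnW// ltnS; near: n; exact: nbhs_infty_ge.
have := HN _ Nn; rewrite sub0r normrN -/(I_ n).
have E : eta (I_ n) = (fine (eta (I_ n)))%:E by rewrite fineK// ge0_fin_numE.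
move=> /(le_trans (ler_norm _)); rewrite ler_pdivrMr ?exprn_gt0// => Hln.
have Hfine : fine (eta (I_ n)) <= expR ((8 * k)^-1 * n.+1%:R ^+ 2).
  apply: (@le_trans _ _ (Num.max (fine (eta (I_ n))) 1)); first by rewrite le_max lexx.
  by rewrite -[leLHS]lnK ?ler_expR// posrE lt_max ltr01 orbT.
rewrite E -EFinM lee_fin -expRM_natr.
apply: (@le_trans _ _ (expR (- (n%:R ^+ 2 / k)) * expR ((8 * k)^-1 * n.+1%:R ^+ 2))).
  by rewrite ler_pM2l ?expR_gt0.
rewrite -expRD ler_expR -natr1.
(* The numerator is (7n + 1)(n - 1), non-negative as n >= 1. *)
rewrite -subr_ge0 (_ : _ - _ = (8 * n%:R ^+ 2 - (n%:R + 1) ^+ 2 - 4 * n%:R) / (8 * k)); last first.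
  by field; rewrite gt_eqF.
apply: divr_ge0; last by rewrite mulr_ge0// ltW.
nra.
Unshelve. all: by end_near. Qed.

End M2_tails.

(** * Convergence in the metric of M_2 *)

Section distances.
Context {R : realType}.
Implicit Types eta : measure_on_line R.

Lemma test_dist_le (f : nat -> R -> R) eta1 eta2 (n : nat) (e : R) : 0 <= e ->
  (forall k, (k < n)%N -> `|pairing (f k) eta1 - pairing (f k) eta2| <= e) ->
  test_dist f eta1 eta2 <= e + 2 ^- n.
Proof.
move=> e0 fe; rewrite /test_dist; apply: limr_le; first exact: cvg_test_dist.
apply: nearW => N; rewrite /series/=.
(* Bound for the partial sums: [e] times a geometric sum, plus the geometric sum from [n] on, where
   only the truncation at 1 is available. *)
pose r N := e * (1 - 2 ^- N) + (if (N <= n)%N then 0 else 2 ^- n - 2 ^- N).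
have p0 k : (0 : R) < 2 ^- k by rewrite invr_gt0 exprn_gt0.
have pS k : (2 ^- k.+1 : R) = 2 ^- k / 2 by rewrite exprSr invfM.
apply: (@le_trans _ _ (r N)); last first.
  rewrite /r; apply: lerD; first by rewrite ler_piMr// lerBlDr lerDl ltW.
  by case: ifP => _; [exact: ltW|rewrite lerBlDr lerDl ltW].
elim: N => [|N ih].
  by rewrite big_nil /r leq0n addr0 expr0 invr1 subrr mulr0.
rewrite big_nat_recr//=; apply: le_trans (lerD ih (lexx _)) _.
have [Nn|nN] := ltnP N n.
  rewrite /r Nn (ltnW Nn) !addr0 -lerBrDl -mulrBr.
  have -> : 1 - 2 ^- N.+1 - (1 - 2 ^- N) = 2 ^- N.+1 :> R by rewrite pS; field.
  rewrite mulrC ler_pM2r//; apply: le_trans (fe N Nn).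
  by rewrite ge_min lexx.
apply: (@le_trans _ _ (r N + 2 ^- N.+1)).
  rewrite -/(r N); apply: lerD => //; apply: ler_piMr; first exact: ltW.
  by rewrite ge_min lexx orbT.
rewrite /r ltnNge nN /=; have -> : (N <= n)%N = (N == n) by rewrite eqn_leq nN andbT.
have e1 : e * (1 - 2 ^- N) <= e * (1 - 2 ^- N.+1).
  by rewrite ler_wpM2l// lerD2l lerN2 pS; have := p0 N; lra.
rewrite -addrA; apply: lerD => //; case: eqP => [->|_].
  by rewrite add0r pS; lra.
by rewrite pS; lra.
Qed.

Lemma test_dist_ge (f : nat -> R -> R) eta1 eta2 (k : nat) :
  2 ^- k.+1 * Num.min `|pairing (f k) eta1 - pairing (f k) eta2| 1 <=
  test_dist f eta1 eta2.
Proof.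
pose t k := 2 ^- k.+1 * Num.min `|pairing (f k) eta1 - pairing (f k) eta2| 1.
have t0 j : 0 <= t j by rewrite mulr_ge0 ?invr_ge0 ?exprn_ge0// le_min normr_ge0 ler01.
apply: (@le_trans _ _ (series t k.+1)).
  by rewrite /series/= big_nat_recr//= lerDr sumr_ge0.
apply: nondecreasing_cvgn_le; last exact: cvg_test_dist.
apply/nondecreasing_seqP => n; rewrite /series/= big_nat_recr//= lerDl.
exact: t0.
Qed.

Lemma test_dist_ge0 (f : nat -> R -> R) eta1 eta2 : 0 <= test_dist f eta1 eta2.
Proof.
apply: le_trans (test_dist_ge f eta1 eta2 0).
by rewrite mulr_ge0 ?invr_ge0 ?exprn_ge0// le_min normr_ge0 ler01.
Qed.

Lemma exp2V_small (e : R) : 0 < e -> exists n : nat, 2 ^- n <= e.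
Proof.
move=> e0; have [N _ /(_ N (leqnn _))/ltW Ne] := near_infty_natSinv_lt (PosNum e0).
exists N; apply: le_trans Ne; rewrite lef_pV2 ?posrE ?exprn_gt0//.
by rewrite -natrX ler_nat ltn_expl.
Qed.

Lemma test_dist_cvg0 (f : nat -> R -> R) (eta_ : nat -> measure_on_line R) eta :
  (forall k, (fun n => pairing (f k) (eta_ n)) @ \oo --> pairing (f k) eta) ->
  (fun n => test_dist f eta (eta_ n)) @ \oo --> 0.
Proof.
move=> fcv; apply/cvgrPdist_le => e e0.
have e2 : 0 < e / 2 by rewrite divr_gt0.
have [N Ne] := exp2V_small e2.
have : \forall n \near \oo, forall k, (k < N)%N ->
    `|pairing (f k) eta - pairing (f k) (eta_ n)| <= e / 2.
  elim: N {Ne} => [|N ih]; first by apply: nearW => n k; rewrite ltn0.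
  have := fcv N => /cvgrPdist_le /(_ _ e2) fN.
  apply: filterS2 ih fN => n ih fN k; rewrite ltnS leq_eqVlt => /predU1P[->//|].
  exact: ih.
apply: filterS => n Hn; rewrite sub0r normrN ger0_norm ?test_dist_ge0//.
rewrite [e]splitr; apply: le_trans (test_dist_le (ltW e2) Hn) _.
by rewrite lerD2l.
Qed.

Lemma cvg_test_dist0 (f : nat -> R -> R) (eta_ : nat -> measure_on_line R) eta k :
  (fun n => test_dist f eta (eta_ n)) @ \oo --> 0 ->
  (fun n => pairing (f k) (eta_ n)) @ \oo --> pairing (f k) eta.
Proof.
move=> d0; apply/cvgrPdist_lt => e e0.
pose m := Num.min e 1.
have m0 : 0 < m by rewrite lt_min e0 ltr01.
have p0 : (0 : R) < 2 ^- k.+1 by rewrite invr_gt0 exprn_gt0.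
have := d0 => /cvgrPdist_lt /(_ (2 ^- k.+1 * m) (mulr_gt0 p0 m0)).
apply: filterS => n; rewrite sub0r normrN ger0_norm ?test_dist_ge0//.
move=> /(le_lt_trans (test_dist_ge f eta (eta_ n) k)).
rewrite ltr_pM2l// /m lt_min => /andP[].
by have [_ ->//|_ _] := leP `|pairing (f k) eta - pairing (f k) (eta_ n)| 1; rewrite ltxx.
Qed.

Lemma dist2_ge0 h eta1 eta2 : 0 <= dist2 h eta1 eta2.
Proof. by rewrite !addr_ge0 ?test_dist_ge0. Qed.

Lemma dist2_cvg0 h (eta_ : nat -> measure_on_line R) eta :
  (forall k, (fun n => pairing (h k) (eta_ n)) @ \oo --> pairing (h k) eta) ->
  (fun n => max_atom (eta_ n)) @ \oo --> max_atom eta ->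
  (forall k, (fun n => pairing (alpha k.+1) (eta_ n)) @ \oo --> pairing (alpha k.+1) eta) ->
  (fun n => dist2 h eta (eta_ n)) @ \oo --> 0.
Proof.
move=> hc mc ac; rewrite -[X in _ --> X]addr0 -[X in X + _]addr0.
apply: cvgD; last exact: (test_dist_cvg0 (f := fun k => alpha k.+1)).
apply: cvgD; first exact: test_dist_cvg0.
by rewrite -(normr0 R) -(subrr (max_atom eta)); apply: cvg_norm; apply: cvgB => //; exact: cvg_cst.
Qed.

Lemma cvg_dist2 h (eta_ : nat -> measure_on_line R) eta :
  (fun n => dist2 h eta (eta_ n)) @ \oo --> 0 ->
  [/\ forall k, (fun n => pairing (h k) (eta_ n)) @ \oo --> pairing (h k) eta,
      (fun n => max_atom (eta_ n)) @ \oo --> max_atom eta &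
      forall k, (fun n => pairing (alpha k.+1) (eta_ n)) @ \oo --> pairing (alpha k.+1) eta].
Proof.
move=> d0.
have sq (u : nat -> R) : (forall n, 0 <= u n <= dist2 h eta (eta_ n)) -> u @ \oo --> 0.
  by move=> ud; apply: (squeeze_cvgr _ (cvg_cst 0) d0); apply: nearW => n; exact: ud.
split.
- move=> k; apply: cvg_test_dist0; apply: sq => n; rewrite test_dist_ge0/=.
  by rewrite /dist2 /vague_dist -addrA lerDl addr_ge0// test_dist_ge0.
- have m0 : (fun n => `|max_atom eta - max_atom (eta_ n)|) @ \oo --> 0.
    apply: sq => n; rewrite normr_ge0/= /dist2 /vague_dist addrAC lerDr.
    by rewrite addr_ge0// test_dist_ge0.
  apply/cvgrPdist_lt => e e0; apply: filterS ((cvgrPdist_lt _ _).1 m0 e e0) => n.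
  by rewrite sub0r normrN normr_id.
- move=> k; apply: (cvg_test_dist0 (f := fun k => alpha k.+1)); apply: sq => n.
  rewrite test_dist_ge0/= /dist2 /vague_dist lerDr.
  by rewrite addr_ge0// test_dist_ge0.
Qed.

End distances.

(** * Random point measures *)

Lemma finite_set_argmax {R : realType} {T : choiceType} (E : set T) (y : T -> R) :
  finite_set E -> E !=set0 -> exists2 j, E j & forall i, E i -> y i <= y j.
Proof.
move=> /finite_seqP[s ->]; elim: s => [[? //]|a s ih _].
case: s ih => [_|b s ih].
  by exists a => [|i]; rewrite /= !inE// => /eqP ->.
have [|j js jmax] := ih; first by exists b; rewrite /= inE eqxx.
have [ya|ya] := leP (y a) (y j).
  exists j => [|i]; first by rewrite /= inE js orbT.
  by rewrite /= inE => /predU1P[->//|]; exact: jmax.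
exists a => [|i]; first by rewrite /= inE eqxx.
by rewrite /= inE => /predU1P[->//|/jmax yi]; exact: le_trans yi (ltW ya).
Qed.

Section max_atom.
Context {R : realType}.
Implicit Types eta : measure_on_line R.

Lemma inM2_half_line eta (a : R) : inM2 eta -> (eta `[a, +oo[%classic < +oo)%E.
Proof.
move=> M2eta; have ta : 0 < tail 1 a by exact: expR_gt0.
have at_ (x : R) : `[a, +oo[%classic x -> tail 1 a <= tail 1 x.
  by rewrite /= in_itv/= andbT => ax; exact: tail_homo.
have := tail_chebyshev eta (measurable_itv _) ta at_.
move=> /le_lt_trans; apply.
by rewrite lte_mul_pinfty ?lee_fin ?invr_ge0 ?tail_ge0//; exact: inM2_tail_integrable.
Qed.

Lemma eq_max_atom eta1 eta2 :
  (forall A : set (measurableTypeR R), measurable A -> eta1 A = eta2 A) ->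
  max_atom eta1 = max_atom eta2.
Proof.
move=> eta12; congr sup; apply/seteqP; split => x /=;
  by rewrite eta12//; exact: measurable_set1.
Qed.

Lemma eq_pairing (f : R -> R) eta1 eta2 :
  (forall A : set (measurableTypeR R), measurable A -> eta1 A = eta2 A) ->
  pairing f eta1 = pairing f eta2.
Proof.
by move=> eta12; congr fine; apply: eq_measure_integral => A mA _; exact: eta12.
Qed.

Lemma eq_inM2 eta1 eta2 :
  (forall A : set (measurableTypeR R), measurable A -> eta1 A = eta2 A) ->
  inM2 eta1 -> inM2 eta2.
Proof.
move=> eta12 M2eta1; have [[int1 _] eta10 _ _] := M2eta1.
apply: tail_integrable_inM2.
- by move=> A mA; rewrite -eta12//; exact: int1.
- by rewrite -eta12.
- move=> k; apply: le_lt_trans (inM2_tail_integrable (k := k.+1%:R) M2eta1 _) => //.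
  by rewrite (eq_measure_integral eta1)// => A mA _; rewrite -eta12.
Qed.

Context {T : countType}.
Variables (D : set T) (y : T -> R).

Lemma inM2_dirac_sum_neq0 : inM2 (dirac_sum D y) -> D !=set0.
Proof.
move=> [_ eta0 _ _]; have : (0 < dirac_sum D y [set: R])%E.
  by rewrite lt_neqAle eq_sym eta0/=; exact: measure_ge0.
by move=> /dirac_sum_gt0[j Dj _]; exists j.
Qed.

(** Only finitely many atoms lie at or above the level of a given atom, so the supremum is
    attained. *)
Lemma inM2_dirac_sum_max : inM2 (dirac_sum D y) ->
  exists2 j, D j /\ y j = max_atom (dirac_sum D y) & forall i, D i -> y i <= y j.
Proof.
move=> M2eta; have [j0 Dj0] := inM2_dirac_sum_neq0 M2eta.
have finE := dirac_sum_fin_set (inM2_half_line (y j0) M2eta).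
have [|j [Dj _] jmax] := finite_set_argmax y finE.
  by exists j0; split => //=; rewrite in_itv/= lexx.
have {}jmax i : D i -> y i <= y j.
  move=> Di; have [yi|/ltW yi] := leP (y j0) (y i).
    by apply: jmax; split => //=; rewrite in_itv/= yi.
  by apply: le_trans yi _; apply: jmax; split => //=; rewrite in_itv/= lexx.
exists j => //; split => //; apply/eqP; rewrite eq_le; apply/andP; split.
  apply: ub_le_sup; last by apply/dirac_sum_gt0; exists j.
  by exists (y j) => _ /dirac_sum_gt0[i Di <-]; exact: jmax.
apply: ge_sup; first by exists (y j); apply/dirac_sum_gt0; exists j.
by move=> _ /dirac_sum_gt0[i Di <-]; exact: jmax.
Qed.

Lemma lt_max_atom (c : R) : inM2 (dirac_sum D y) ->
  c < max_atom (dirac_sum D y) <-> exists2 j, D j & c < y j.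
Proof.
move=> /inM2_dirac_sum_max[j [Dj <-] jmax].
split => [cy|[i Di ci]]; first by exists j.
exact: lt_le_trans ci (jmax i Di).
Qed.

End max_atom.

Section random_dirac_sum.
Context {R : realType} {d : measure_display} {Omega : measurableType d}.
Context {T : countType}.
Variables (on : T -> Omega -> Prop) (z : T -> Omega -> R).
Hypothesis measurable_on : forall j, measurable [set w | on j w].
Hypothesis measurable_z : forall j, measurable_fun setT (z j).

Let Theta w : measure_on_line R := dirac_sum [set j | on j w] (z^~ w).

Lemma measurable_random_integral (f : R -> R) :
  measurable_fun setT f -> (forall x, 0 <= f x) ->
  measurable_fun setT (fun w => \int[(Theta w)]_x (f x)%:E)%E.
Proof.
move=> mf f0.
have E w : (\int[(Theta w)]_x (f x)%:E =
    \sum_(k <oo) along_pickle (restrict0 [set j | on j w] (z^~ w) (EFin \o f)) k)%E.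
  rewrite /Theta ge0_integral_dirac_sum//; last exact/measurable_EFinP.
  by rewrite esum_pickle// => j; apply: restrict0_ge0 => x; rewrite lee_fin.
under eq_fun do rewrite E.
apply: measurable_nneseries => [k w|k].
  by apply: along_pickle_ge0 => j; apply: restrict0_ge0 => x; rewrite lee_fin.
rewrite /along_pickle; case: pickle_inv => [j|] /=; last exact: measurable_cst.
rewrite [X in measurable_fun _ X](_ : _ = fun w => (\1_[set w | on j w] w * f (z j w))%:E).
  apply/measurable_EFinP; apply: measurable_funM; first exact: measurable_indic.
  exact: measurableT_comp.
apply/funext => w; rewrite /restrict0 indicE; case: asboolP => /= ow.
  by rewrite mem_set// mul1r.
by rewrite memNset// mul0r.
Qed.

Lemma measurable_random_pairing (f : R -> R) :
  measurable_fun setT f -> (forall x, 0 <= f x) ->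
  measurable_fun setT (fun w => pairing f (Theta w)).
Proof.
by move=> mf f0; apply: measurableT_comp => //; exact: measurable_random_integral.
Qed.

(** Membership reduces to countably many conditions: some particle is present, and every tail
    integral is finite. *)
Lemma measurable_random_inM2 : measurable [set w | inM2 (Theta w)].
Proof.
rewrite [X in measurable X](_ : _ = (\bigcup_j [set w | on j w]) `&`
  \bigcap_k [set w | (\int[(Theta w)]_x (tail k.+1%:R x)%:E < +oo)%E]).
  apply: measurableI; first exact: countable_bigcupT_measurable.
  apply: bigcapT_measurable => k.
  rewrite -[X in measurable X]setTI; apply: emeasurable_fun_infty_o => //.
  by apply: measurable_random_integral; [exact: measurable_tail|move=> x; exact: tail_ge0].
apply/seteqP; split => [w M2w|w [[j _ ow] fin_tail]].
  split; first by have [j ow] := inM2_dirac_sum_neq0 M2w; exists j.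
  by move=> k _; exact: inM2_tail_integrable.
apply: tail_integrable_inM2 => [||k]; [exact: dirac_sum_integer| |exact: fin_tail].
rewrite gt_eqF//; apply/dirac_sum_gt0; by exists j.
Qed.

(** The event is restricted to [inM2] because a largest atom exists there, so that exceeding [c]
    means that some particle does. *)
Lemma measurable_random_max (c : R) :
  measurable [set w | inM2 (Theta w) /\ c < max_atom (Theta w)].
Proof.
rewrite [X in measurable X](_ : _ = [set w | inM2 (Theta w)] `&`
  \bigcup_j ([set w | on j w] `&` z j @^-1` `]c, +oo[)).
  apply: measurableI; first exact: measurable_random_inM2.
  apply: countable_bigcupT_measurable => // j; apply: measurableI => //.
  by rewrite -[X in measurable X]setTI; exact: measurable_z.
apply/seteqP; split => w [M2w].
  move=> /(lt_max_atom _ M2w)[j ow cz]; split => //; exists j => //; split => //=.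
  by rewrite in_itv/= cz.
move=> [j _ [ow]]; rewrite /= in_itv/= andbT => cz; split => //.
by apply/(lt_max_atom _ M2w); exists j.
Qed.

End random_dirac_sum.

Section extension.
Context {R : realType} (h : nat -> R -> R) (F : M2 h -> R).
Hypothesis F_continuous : continuous F.
Implicit Types eta : measure_on_line R.

Lemma extend_M2E eta (M2eta : inM2 eta) : extend_M2 F eta = F (mkM2 h M2eta).
Proof.
rewrite /extend_M2; case: pselect => // M2eta'.
by congr (F (mkM2 h _)); exact: Prop_irrelevance.
Qed.

Lemma extend_M2_near eta (M2eta : inM2 eta) (V : set R) :
  nbhs (extend_M2 F eta) V -> exists2 e : R, 0 < e &
  forall eta', inM2 eta' -> dist2 h eta eta' < e -> V (extend_M2 F eta').
Proof.
rewrite extend_M2E => FV; have /nbhs_ballP[e e0 eV] := F_continuous FV; exists e => //.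
move=> eta' M2eta' ee; rewrite (extend_M2E M2eta').
exact: (eV (mkM2 h M2eta')).
Qed.

Lemma extend_M2_cvg (eta_ : nat -> measure_on_line R) eta :
  inM2 eta -> (forall n, inM2 (eta_ n)) ->
  (fun n => dist2 h eta (eta_ n)) @ \oo --> 0 ->
  (fun n => extend_M2 F (eta_ n)) @ \oo --> extend_M2 F eta.
Proof.
move=> M2eta M2eta_ d0 V /(extend_M2_near M2eta)[e e0 eV].
have := d0 => /cvgrPdist_lt /(_ e e0); apply: filterS => n.
by rewrite sub0r normrN ger0_norm ?dist2_ge0//; exact: eV.
Qed.

(** The two measures are at distance 0 but may differ on non-measurable sets; continuity of [F]
    along the constant sequence [eta2] identifies the values. *)
Lemma eq_extend_M2 eta1 eta2 :
  (forall A : set (measurableTypeR R), measurable A -> eta1 A = eta2 A) ->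
  extend_M2 F eta1 = extend_M2 F eta2.
Proof.
move=> eta12; have [M21|nM21] := pselect (inM2 eta1); last first.
  rewrite /extend_M2; case: pselect => // _; case: pselect => // M22.
  by exfalso; apply: nM21; apply: eq_inM2 M22 => A mA; rewrite eta12.
have M22 := eq_inM2 eta12 M21.
have d0 : dist2 h eta1 eta2 = 0.
  rewrite -(dist2xx h eta1) /dist2 (eq_max_atom eta12) /vague_dist /test_dist.
  congr (limn _ + _ + limn _); congr series; apply/funext => k;
    by rewrite (eq_pairing _ eta12).
have := @extend_M2_cvg (fun=> eta2) eta1 M21 (fun=> M22).
rewrite d0 => /(_ (cvg_cst _)) e2; apply/esym.
by apply: cvg_unique (cvg_cst _) e2.
Qed.

(** A substitute for separability: countably many sets, given by a precision and by rational
    approximations of the maximum and of finitely many test integrals. The condition on the maximum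
    is half-open, so that events [c < max_atom] suffice to express it. *)
Definition cell (p : nat * rat * (seq rat * seq rat)) : set (measure_on_line R) :=
  let e := p.1.1.+1%:R^-1 in
  [set eta | [/\ inM2 eta, ratr p.1.2 - e < max_atom eta <= ratr p.1.2 + e,
    forall k, (k < p.1.1)%N -> `|pairing (h k) eta - ratr (nth 0 p.2.1 k)| < e &
    forall k, (k < p.1.1)%N -> `|pairing (alpha k.+1) eta - ratr (nth 0 p.2.2 k)| < e]].

(** With e = 1/(n+1), each test distance is at most 2e + 2^-n <= 3e and the maxima differ by at most
    2e; hence the constant 8. *)
Lemma cell_dist2 p eta1 eta2 : cell p eta1 -> cell p eta2 ->
  dist2 h eta1 eta2 <= 8 / p.1.1.+1%:R.
Proof.
case: p => [[n q] [l1 l2]] [_ /= m1 h1 a1] [_ /= m2 h2 a2]; set e := _^-1 in m1 m2 h1 h2 a1 a2 *.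
have e0 : 0 < e by rewrite invr_gt0.
have n2 : 2 ^- n <= e.
  by rewrite /e lef_pV2 ?posrE ?exprn_gt0// -natrX ler_nat ltn_expl.
have td (f : nat -> R -> R) (l : seq rat) :
    (forall k, (k < n)%N -> `|pairing (f k) eta1 - ratr (nth 0 l k)| < e) ->
    (forall k, (k < n)%N -> `|pairing (f k) eta2 - ratr (nth 0 l k)| < e) ->
    test_dist f eta1 eta2 <= 3 * e.
  move=> f1 f2; apply: (@le_trans _ _ (2 * e + 2 ^- n)); last by move: n2; lra.
  apply: test_dist_le => [|k kn]; first by rewrite mulr_ge0// ltW.
  apply: le_trans (ler_distD (ratr (nth 0 l k)) _ _) _.
  rewrite mulr_natl mulr2n; apply: lerD; first exact/ltW/f1.
  by rewrite distrC; exact/ltW/f2.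
have {}td1 := td _ _ h1 h2; have {}td2 := td _ _ a1 a2.
have mm : `|max_atom eta1 - max_atom eta2| <= 2 * e.
  by rewrite ler_norml; move: m1 m2 => /andP[? ?] /andP[? ?]; apply/andP; split; lra.
by rewrite /dist2 /vague_dist; move: td1 td2 mm; set u := test_dist _ _ _; set v := test_dist _ _ _; lra.
Qed.

Lemma rat_approx (u : nat -> R) (n : nat) (e : R) : 0 < e ->
  exists l : seq rat, forall k, (k < n)%N -> `|u k - ratr (nth 0 l k)| < e.
Proof.
move=> e0.
have /choice[q qP] : forall k, exists q : rat, `|u k - ratr q| < e.
  move=> k; have [|q] := @rat_in_itvoo _ (u k - e) (u k + e).
    by rewrite ltrBlDr -addrA ltrDl addr_gt0.
  rewrite in_itv/= => /andP[q1 q2]; exists q; rewrite ltr_norml.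
  by apply/andP; split; lra.
by exists (mkseq q n) => k kn; rewrite nth_mkseq.
Qed.

Lemma cell_cover eta (n : nat) : inM2 eta -> exists2 p, p.1.1 = n & cell p eta.
Proof.
move=> M2eta; have e0 : 0 < n.+1%:R^-1 :> R by rewrite invr_gt0.
have [l1 l1P] := rat_approx (fun k => pairing (h k) eta) n e0.
have [l2 l2P] := rat_approx (fun k => pairing (alpha k.+1) eta) n e0.
have [l lP] := rat_approx (fun=> max_atom eta) 1 e0.
exists (n, nth 0 l 0, (l1, l2)) => //; split => //=.
move: (lP 0%N isT) e0; rewrite /= ltr_norml; move: (max_atom eta) (ratr _) (_^-1) => m r e.
by move=> /andP[? ?] e0; apply/andP; split; lra.
Qed.

Context {d : measure_display} {Omega : measurableType d}.
Variable Theta : Omega -> measure_on_line R.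
Hypothesis measurable_inM2 : measurable [set w | inM2 (Theta w)].
Hypothesis measurable_max :
  forall c, measurable [set w | inM2 (Theta w) /\ c < max_atom (Theta w)].
Hypothesis measurable_vague : forall k, measurable_fun setT (fun w => pairing (h k) (Theta w)).
Hypothesis measurable_alpha :
  forall k, measurable_fun setT (fun w => pairing (alpha k.+1) (Theta w)).

Lemma measurable_cell p : measurable (Theta @^-1` cell p).
Proof.
case: p => [[n q] [l1 l2]]; set e : R := n.+1%:R^-1.
have mp (f : nat -> R -> R) (l : seq rat) :
    (forall k, measurable_fun setT (fun w => pairing (f k) (Theta w))) ->
    measurable [set w | forall k, (k < n)%N -> `|pairing (f k) (Theta w) - ratr (nth 0 l k)| < e].
  move=> mf; rewrite [X in measurable X](_ : _ =
      \bigcap_(k in `I_n) [set w | `|pairing (f k) (Theta w) - ratr (nth 0 l k)| < e])//.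
  apply: fin_bigcap_measurable => [|k kn]; first exact: finite_II.
  rewrite -[X in measurable X]setTI; apply: measurable_fun_ltr => //.
  by apply: measurableT_comp => //; exact: measurable_funB.
rewrite [X in measurable X](_ : _ = ([set w | inM2 (Theta w) /\ ratr q - e < max_atom (Theta w)]
   `\` [set w | inM2 (Theta w) /\ ratr q + e < max_atom (Theta w)]) `&`
  ([set w | forall k, (k < n)%N -> `|pairing (h k) (Theta w) - ratr (nth 0 l1 k)| < e] `&`
   [set w | forall k, (k < n)%N -> `|pairing (alpha k.+1) (Theta w) - ratr (nth 0 l2 k)| < e])).
  apply: measurableI; first exact: measurableD.
  by apply: measurableI; [exact: mp|exact: (mp (fun k => alpha k.+1))].
apply/seteqP; split => [w [M2w /andP[m1 m2] h1 a1]|w [[[M2w m1] nm2] [h1 a1]]].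
  by split => //; split => // -[_]; rewrite ltNge m2.
by split => //; rewrite /= m1/= leNgt; apply/negP => m2; exact: nm2.
Qed.

(** By continuity every point of {F > a} lies in a cell contained in that set, so the preimage is a
    countable union of preimages of cells. Outside M_2 the extension is 0, which adds the complement
    exactly when [a < 0]. *)
Lemma measurable_extend_M2 : measurable_fun setT (fun w => extend_M2 F (Theta w)).
Proof.
apply: (measurability _ (RGenOInfty.measurableE R)) => _ [_ [a ->] <-]; rewrite setTI.
pose G p := forall eta, cell p eta -> a < extend_M2 F eta.
rewrite [X in measurable X](_ : _ = (\bigcup_p (Theta @^-1` cell p `&` [set w | G p])) `|`
  (~` [set w | inM2 (Theta w)] `&` [set w | a < 0])).
  have mcst (Q : Prop) : measurable [set w : Omega | Q].
    have [HQ|nQ] := pselect Q; first by rewrite (_ : mkset _ = setT)//; apply/seteqP; split.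
    by rewrite (_ : mkset _ = set0)//; apply/seteqP; split.
  apply: measurableU; last by apply: measurableI => //; exact: measurableC.
  by apply: countable_bigcupT_measurable => // p; apply: measurableI => //; exact: measurable_cell.
apply/seteqP; split => [w|w].
  rewrite /= in_itv/= andbT; have [M2w aF|nM2w] := pselect (inM2 (Theta w)); last first.
    by rewrite /extend_M2; case: pselect => // _ a0; right.
  have [e e0 eV] := extend_M2_near M2w (open_nbhs_nbhs (conj (@open_gt _ a) aF)).
  have [N _ /(_ N (leqnn _)) Ne] := near_infty_natSinv_lt (PosNum (divr_gt0 e0 (ltr0n R 8))).
  have [p pN pw] := cell_cover N M2w.
  left; exists p => //; split => // eta peta; apply: eV; first by case: peta.
  apply: le_lt_trans (cell_dist2 pw peta) _.
  by rewrite pN mulrC -ltr_pdivlMr.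
rewrite /= in_itv/= andbT => -[[p _ [pw]]|[nM2w a0]]; first exact.
by rewrite /extend_M2; case: pselect.
Qed.

End extension.

(** * Decreasing enumeration of the atoms *)

Section sorted_enumeration.
Context {R : realType}.
Implicit Types eta : measure_on_line R.

(** The number of atoms beyond [a]; [aboveE] shows that nothing is lost in passing to a natural
    number. *)
Definition above eta (a : R) : nat := Num.truncn (fine (eta `]a, +oo[%classic)).

Definition sorted_dom eta : set nat := [set j | exists a, (j < above eta a)%N].

(** The atoms in decreasing order with multiplicity, from [j = 0], as a generalised inverse of
    [above]. It is determined by [eta], without reference to an enumeration. *)
Definition sorted_pos eta (j : nat) : R := sup [set a | (j < above eta a)%N].

Variables (eta : measure_on_line R) (I : set nat) (x : nat -> R).
Hypothesis M2eta : inM2 eta.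
Hypothesis atoms : sums_diracs I x eta.

Let A a : set nat := I `&` x @^-1` `]a, +oo[.

Let finA a : finite_set (A a).
Proof.
apply: dirac_sum_fin_set; rewrite -(atoms (measurable_itv _)).
have aa : (eta `]a, +oo[%classic <= eta `[a, +oo[%classic)%E.
  apply: le_measure; [exact: (mem_set (measurable_itv _))..|].
  by move=> z; rewrite /= !in_itv/= !andbT => /ltW.
by apply: le_lt_trans aa _; exact: inM2_half_line.
Qed.

Lemma aboveE a : eta `]a, +oo[%classic = (above eta a)%:R%:E.
Proof.
by rewrite /above (atoms (measurable_itv _)) (dirac_sum_finite (finA a))/= natrK.
Qed.

Lemma above_card a : above eta a = #|` fset_set (I `&` x @^-1` `]a, +oo[)|%fset.
Proof.
by rewrite /above (atoms (measurable_itv _)) (dirac_sum_finite (finA a))/= natrK.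
Qed.

Let card_subset (U V : set nat) : finite_set V -> U `<=` V ->
  (#|` fset_set U| <= #|` fset_set V|)%fset%N.
Proof.
move=> finV UV; have finU := sub_finite_set UV finV.
by apply: fsubset_leq_card; rewrite -fset_set_sub.
Qed.

Let card_proper (U V : set nat) i : finite_set V -> U `<=` V -> V i -> ~ U i ->
  (#|` fset_set U| < #|` fset_set V|)%fset%N.
Proof.
move=> finV UV Vi nUi; have finU := sub_finite_set UV finV.
apply: fproper_ltn_card; rewrite fproperEneq; apply/andP; split; last by rewrite -fset_set_sub.
apply/negP => /eqP UVE; apply: nUi; have : i \in fset_set V by rewrite in_fset_set// mem_set.
by rewrite -UVE in_fset_set// => /set_mem.
Qed.

Lemma above_homo a b : a <= b -> (above eta b <= above eta a)%N.
Proof.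
move=> ab; rewrite !above_card; apply: card_subset; first exact: finA.
by move=> i [Ii]; rewrite /= !in_itv/= !andbT => bx; split => //=; exact: le_lt_trans bx.
Qed.

(** Right-continuity of the counting function: [b] is the midpoint between [a] and the lowest atom
    beyond it. *)
Lemma above_right a : exists2 b, a < b & above eta b = above eta a.
Proof.
have [A0|/set0P A0] := eqVneq (A a) set0.
  exists (a + 1); rewrite ?ltrDl// !above_card; congr (#|` fset_set _|%fset).
  rewrite -!/(A _) A0 -subset0 => i [Ii]; rewrite /= in_itv/= andbT => ax.
  suff : A a i by rewrite A0.
  by split => //=; rewrite in_itv/= andbT (lt_trans _ ax)// ltrDl.
have [i [Ii]] := finite_set_argmax (fun i => - x i) (finA a) A0.
rewrite /= in_itv/= andbT => ax imax.
exists ((a + x i) / 2); first by rewrite ltr_pdivlMr// mulr_natr mulr2n ltrD2l.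
rewrite !above_card; congr (#|` fset_set _|%fset); apply/seteqP; split => j [Ij];
    rewrite /= !in_itv/= !andbT => xj; split => //=.
  by lra.
have := imax j; rewrite lerN2 => xij.
have {}xij : x i <= x j by apply: xij; split => //=; rewrite in_itv/= andbT.
by lra.
Qed.

(** The supremum defining [sorted_pos] is finite because no atom lies beyond [max_atom], and by
    [above_right] it is not attained, whence the strict inequality. Later facts on the ordering go
    through this equivalence. *)
Lemma lt_sorted_pos j a : sorted_dom eta j ->
  (a < sorted_pos eta j) = (j < above eta a)%N.
Proof.
move=> Jj; have ub : has_ubound [set a | (j < above eta a)%N].
  exists (max_atom eta) => b /= jb; rewrite leNgt; apply/negP => mb.
  suff : above eta b = 0%N by move=> b0; rewrite b0 in jb.
  rewrite above_card -(@cardfs0 nat); congr (#|` _|%fset).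
  rewrite (_ : _ `&` _ = set0) ?fset_set0// -subset0 => i [Ii].
  rewrite /= in_itv/= andbT => bx; move: mb; apply/negP; rewrite -leNgt.
  rewrite (eq_max_atom (eta2 := dirac_sum I x))// ltW//.
  by apply/lt_max_atom; [exact: eq_inM2 M2eta|exists i].
apply/idP/idP => [ay|ja].
  have [//|b jb ab] := @sup_gt _ [set a | (j < above eta a)%N] a _ ay.
  exact: leq_trans jb (above_homo (ltW ab)).
have [b ab ba] := above_right a.
by apply: lt_le_trans ab _; apply: ub_le_sup => //=; rewrite ba.
Qed.

(** The atoms ahead of [i] in decreasing order, ties being broken by the index. *)
Let E i : set nat := I `&` [set i' | x i < x i' \/ (x i' = x i /\ (i' < i)%N)].

Let rank i := #|` fset_set (E i)|%fset.

Let finE i : finite_set (E i).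
Proof.
apply: (sub_finite_set (B := A (x i - 1))) => // j [Ij] xij; split => //=.
by rewrite in_itv/= andbT; case: xij => [|[-> _]]; lra.
Qed.

Let rank_lt i i' : I i -> E i' i -> (rank i < rank i')%N.
Proof.
move=> Ii [_ ii']; apply: (@card_proper _ _ i) => //.
  move=> k [Ik ki]; split => //=; case: ki ii' => [ki|[-> ki]] [ii'|[ii' ltii']].
  - by left; exact: lt_trans ki.
  - by left; rewrite -ii'.
  - by left.
  - by right; split; [|exact: ltn_trans ltii'].
by move=> [_ /= [|[_]]]; rewrite ?ltxx ?ltnn.
Qed.

Let rank_inj i i' : I i -> I i' -> rank i = rank i' -> i = i'.
Proof.
move=> Ii Ii' rii'; case: (ltgtP (x i) (x i')) => [xx|xx|xx].
- have /rank_lt : E i i' by split => //=; left.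
  by move=> /(_ Ii'); rewrite rii' ltnn.
- have /rank_lt : E i' i by split => //=; left.
  by move=> /(_ Ii); rewrite rii' ltnn.
- case: (ltngtP i i') => // ltii'.
    have /rank_lt : E i' i by split => //=; right.
    by move=> /(_ Ii); rewrite rii' ltnn.
  have /rank_lt : E i i' by split => //=; right.
  by move=> /(_ Ii'); rewrite rii' ltnn.
Qed.

Let rank_above i a : I i -> (rank i < above eta a)%N = (a < x i).
Proof.
move=> Ii; rewrite above_card; have [ax|xa] := ltP a (x i).
  apply: (@card_proper _ _ i).
  - exact: finA.
  - move=> j [Ij] ji; split => //=; rewrite in_itv/= andbT.
    by case: ji => [|[->]//]; exact: lt_trans.
  - by split => //=; rewrite in_itv/= ax.
  - by move=> [_ /= [|[_]]]; rewrite ?ltxx ?ltnn.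
apply/negbTE; rewrite -leqNgt; apply: card_subset => // j [Ij].
by rewrite /= in_itv/= andbT => aj; split => //; left; exact: le_lt_trans aj.
Qed.

(** [r i] counts the atoms ahead of [i]. Surjectivity is a cardinality argument: the [above eta a]
    atoms beyond [a] have distinct ranks below [above eta a], so they fill that initial segment. *)
Lemma sorted_bijection : exists r : nat -> nat,
  set_bij I (sorted_dom eta) r /\ forall i, I i -> sorted_pos eta (r i) = x i.
Proof.
have rdom i : I i -> sorted_dom eta (rank i).
  by move=> Ii; exists (x i - 1); rewrite rank_above// ltrBlDr ltrDl.
exists rank; split; last first.
  move=> i Ii; apply/eqP; rewrite eq_le; apply/andP; split; rewrite leNgt; apply/negP.
    by rewrite lt_sorted_pos ?rank_above ?ltxx//; exact: rdom.
  by rewrite -rank_above// -lt_sorted_pos ?ltxx//; exact: rdom.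
split => //.
  by move=> i i' /set_mem Ii /set_mem Ii'; exact: rank_inj.
move=> j [a ja]; pose s : seq nat := fset_set (A a).
have sA k : k \in s -> A a k by rewrite in_fset_set// => /set_mem.
have us : uniq (map rank s).
  rewrite map_inj_in_uniq; first exact: fset_uniq.
  by move=> k k' /sA[Ik _] /sA[Ik' _]; exact: rank_inj.
have ss : {subset map rank s <= iota 0 (above eta a)}.
  move=> q /mapP[k /sA[Ik]]; rewrite /= in_itv/= andbT => ak ->.
  by rewrite mem_iota/= add0n rank_above.
have [|_ sE] := uniq_min_size us ss.
  by rewrite size_iota size_map above_card.
have : j \in iota 0 (above eta a) by rewrite mem_iota.
by rewrite -sE => /mapP[k /sA[Ik _] ->]; exists k.
Qed.

End sorted_enumeration.

(** * Counting atoms with continuous functions *)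

Section ramp.
Context {R : realType}.
Implicit Types eta : measure_on_line R.

Lemma C0plus_itv (f : R -> R) (a b : R) : continuous f -> (forall x, 0 <= f x) ->
  (forall x, f x != 0 -> a <= x <= b) -> C0plus f.
Proof.
move=> cf f0 fab; split => //.
apply: (subclosed_compact _ (@segment_compact R a b)); first exact: closed_closure.
have /closure_id -> := compact_closed (@Rhausdorff R) (@segment_compact R a b).
by apply: closure_subset => x /fab; rewrite /= in_itv.
Qed.

Definition ramp (a b x : R) : R := Num.max 0 (Num.min 1 ((x - a) / (b - a))).

Lemma continuous_ramp a b : continuous (ramp a b).
Proof.
apply: (continuous_maxr (f := cst 0)) => [x|]; first exact: cvg_cst.
apply: (continuous_minr (f := cst 1)) => x; first exact: cvg_cst.
by apply: cvgM; [apply: cvgB; [exact: cvg_id|exact: cvg_cst]|exact: cvg_cst].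
Qed.

Lemma ramp_ge0 a b x : 0 <= ramp a b x.
Proof. by rewrite /ramp le_max lexx. Qed.

Lemma ramp_le1 a b x : ramp a b x <= 1.
Proof. by rewrite /ramp ge_max ler01 ge_min lexx. Qed.

Lemma ramp_left a b x : a < b -> x <= a -> ramp a b x = 0.
Proof.
move=> ab xa; apply/max_idPl; rewrite ge_min; apply/orP; right.
by rewrite pmulr_lle0 ?invr_gt0 ?subr_gt0// subr_le0.
Qed.

Lemma ramp_right a b x : a < b -> b <= x -> ramp a b x = 1.
Proof.
move=> ab bx; rewrite /ramp min_l; first exact: max_r.
by rewrite ler_pdivlMr ?subr_gt0// mul1r lerD2r.
Qed.

Lemma measurable_ramp a b : measurable_fun setT (ramp a b).
Proof. exact: continuous_measurable_fun (@continuous_ramp a b). Qed.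

Variables (eta : measure_on_line R) (I : set nat) (x : nat -> R).
Hypothesis M2eta : inM2 eta.
Hypothesis atoms : sums_diracs I x eta.

Lemma atom_le_max i : I i -> x i <= max_atom eta.
Proof.
move=> Ii; have M2' : inM2 (dirac_sum I x) := eq_inM2 atoms M2eta.
by rewrite (eq_max_atom atoms); have [j [_ <-] jmax] := inM2_dirac_sum_max M2'; exact: jmax.
Qed.

(** [eta] does not charge the half-line beyond its largest atom. *)
Lemma le_integral_max_atom (f g : R -> R) (M : R) : max_atom eta <= M ->
  measurable_fun setT f -> measurable_fun setT g ->
  (forall x, 0 <= f x) -> (forall x, 0 <= g x) -> (forall x, x <= M -> f x <= g x) ->
  (\int[eta]_x (f x)%:E <= \int[eta]_x (g x)%:E)%E.
Proof.
move=> etaM mf mg f0 g0 fg.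
have e (A : set (measurableTypeR R)) : measurable A -> A `<=` setT -> eta A = dirac_sum I x A.
  by move=> mA _; exact: atoms.
rewrite !(eq_measure_integral _ e) !ge0_integral_dirac_sum; first last.
- by move=> z; rewrite lee_fin.
- exact/measurable_EFinP.
- by move=> z; rewrite lee_fin.
- exact/measurable_EFinP.
apply: le_esum => i _; rewrite /restrict0; case: asboolP => // Ii.
by rewrite lee_fin fg// (le_trans _ etaM)// atom_le_max.
Qed.

Lemma eq_pairing_max_atom (f g : R -> R) (M : R) : max_atom eta <= M ->
  measurable_fun setT f -> measurable_fun setT g ->
  (forall x, 0 <= f x) -> (forall x, 0 <= g x) -> (forall x, x <= M -> f x = g x) ->
  pairing f eta = pairing g eta.
Proof.
move=> etaM mf mg f0 g0 fg; congr fine; apply/eqP; rewrite eq_le; apply/andP; split;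
  by apply: (le_integral_max_atom etaM) => // z zM; rewrite fg.
Qed.

Lemma above_gt0 a : (0 < above eta a)%N = (a < max_atom eta).
Proof.
have M2' : inM2 (dirac_sum I x) := eq_inM2 atoms M2eta.
have E : (0 < eta `]a, +oo[%classic)%E = (0 < above eta a)%N.
  by rewrite (aboveE M2eta atoms) lte_fin ltr0n.
rewrite -E (eq_max_atom atoms) (atoms (measurable_itv _)); apply/idP/idP.
  by move=> /dirac_sum_gt0[i Ii]; rewrite /= in_itv/= andbT => ax; apply/lt_max_atom => //; exists i.
by move=> /(lt_max_atom _ M2')[i Ii ax]; apply/dirac_sum_gt0; exists i => //=; rewrite in_itv/= andbT.
Qed.

Lemma integral_ramp a b : a < b ->
  ((above eta b)%:R%:E <= \int[eta]_x (ramp a b x)%:E <= (above eta a)%:R%:E)%E.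
Proof.
move=> ab; have mr : measurable_fun setT (ramp a b : R -> R) := @measurable_ramp a b.
have ind c : (\int[eta]_x (\1_`]c, +oo[%classic x)%:E = (above eta c)%:R%:E)%E.
  by rewrite integral_indic// setIT; have := aboveE M2eta atoms c.
rewrite -!ind; apply/andP; split; apply: (le_integral_max_atom (lexx _)) => //;
  try (by move=> z; exact: ramp_ge0); move=> z _; rewrite indicE.
- have [|] := boolP (z \in _); last by rewrite ramp_ge0.
  by move=> /set_mem /=; rewrite in_itv/= andbT => bz; rewrite ramp_right// ltW.
- have [|] := boolP (z \in _); first by rewrite ramp_le1.
  move=> /negP nz; rewrite ramp_left// leNgt; apply/negP => az; apply: nz.
  by apply: mem_set; rewrite /= in_itv/= az.
Qed.

Lemma pairing_ramp a b : a < b ->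
  (above eta b)%:R <= pairing (ramp a b) eta <= (above eta a)%:R.
Proof.
move=> ab; have /andP[r1 r2] := integral_ramp ab.
have rf : (\int[eta]_x (ramp a b x)%:E)%E \is a fin_num.
  rewrite ge0_fin_numE; first exact: le_lt_trans r2 (ltry _).
  by apply: integral_ge0 => z _; rewrite lee_fin ramp_ge0.
by rewrite -!lee_fin /pairing /Rintegral fineK// r1.
Qed.

Lemma sorted_atoms : sums_diracs (sorted_dom eta) (sorted_pos eta) eta.
Proof.
move=> A mA; have [r [[rJ rinj rsurj] ry]] := sorted_bijection M2eta atoms.
rewrite (atoms mA) /dirac_sum (reindex_esum I (sorted_dom eta) r); last by split.
by apply: eq_esum => i Ii; rewrite ry.
Qed.

(** A missing atom contributes 0, as if it sat at -oo; this fits functions that vanish there and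
    keeps the index set fixed when the number of atoms varies. *)
Definition sorted_val (f : R -> R) (j : nat) : R :=
  if `[< sorted_dom eta j >] then f (sorted_pos eta j) else 0.

Lemma integral_sorted (f : R -> R) : measurable_fun setT f -> (forall x, 0 <= f x) ->
  (\int[eta]_x (f x)%:E = \esum_(j in setT) (sorted_val f j)%:E)%E.
Proof.
move=> mf f0.
have e (A : set (measurableTypeR R)) : measurable A -> A `<=` setT ->
    eta A = dirac_sum (sorted_dom eta) (sorted_pos eta) A.
  by move=> mA _; exact: sorted_atoms.
rewrite (eq_measure_integral _ e) ge0_integral_dirac_sum; last first.
- by move=> z; rewrite lee_fin.
- exact/measurable_EFinP.
by apply: eq_esum => j _; rewrite /restrict0 /sorted_val; case: ifP.
Qed.

End ramp.

(** * Consequences of convergence in M_2 for the ordered atoms *)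

Section deterministic_convergence.
Context {R : realType}.
Variables (eta_ : nat -> measure_on_line R) (eta : measure_on_line R).
Variables (I_ : nat -> set nat) (x_ : nat -> nat -> R) (I : set nat) (x : nat -> R).
Hypothesis M2eta_ : forall n, inM2 (eta_ n).
Hypothesis M2eta : inM2 eta.
Hypothesis atoms_ : forall n, sums_diracs (I_ n) (x_ n) (eta_ n).
Hypothesis atoms : sums_diracs I x eta.
Hypothesis eta_vague : vague_cvg eta_ eta.
Hypothesis eta_max : (fun n => max_atom (eta_ n)) @ \oo --> max_atom eta.
Hypothesis eta_alpha : forall k,
  (fun n => pairing (alpha k.+1) (eta_ n)) @ \oo --> pairing (alpha k.+1) eta.

(** Compactly supported tests could miss mass escaping to +oo; convergence of the maxima excludes
    this. Cutting [f] off beyond [M], one above the largest atom of [eta], eventually leaves the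
    integrals unchanged. *)
Lemma half_line_cvg (f : R -> R) (a : R) : continuous f -> (forall x, 0 <= f x) ->
  (forall x, x <= a -> f x = 0) ->
  (fun n => pairing f (eta_ n)) @ \oo --> pairing f eta.
Proof.
move=> cf f0 fa; pose M := max_atom eta + 1.
pose g x := f x * (1 - ramp M (M + 1) x).
have g0 z : 0 <= g z by rewrite mulr_ge0// subr_ge0 ramp_le1.
have cg : continuous g.
  move=> z; apply: cvgM; first exact: cf.
  by apply: cvgB; [exact: cvg_cst|exact: continuous_ramp].
have M1 : M < M + 1 by rewrite ltrDl.
have C0g : C0plus g.
  apply: (@C0plus_itv _ _ a (M + 1)) => // z gz; apply/andP; split.
    by rewrite leNgt; apply: contra gz => /ltW za; rewrite /g fa// mul0r.
  by rewrite leNgt; apply: contra gz => /ltW za; rewrite /g ramp_right// subrr mulr0.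
have fg z : z <= M -> f z = g z by move=> zM; rewrite /g ramp_left// subr0 mulr1.
have mf := continuous_measurable_fun cf; have mg := continuous_measurable_fun cg.
rewrite (eq_pairing_max_atom M2eta atoms (_ : _ <= M) mf mg)//; last by rewrite lerDl.
apply: cvg_trans (eta_vague C0g); apply: near_eq_cvg.
have := eta_max => /cvgrPdist_lt /(_ 1 ltr01); apply: filterS => n.
rewrite ltr_norml => /andP[en _].
by apply/esym/(eq_pairing_max_atom (M2eta_ n) (atoms_ n) (_ : _ <= M) mf mg) => //; rewrite /M; lra.
Qed.

(** Counts are integers, so ramp integrals known up to an error below 1 suffice to compare them. *)
Lemma above_cvg (a b : R) : a < b -> \forall n \near \oo,
  (above (eta_ n) b <= above eta a)%N /\ (above eta b <= above (eta_ n) a)%N.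
Proof.
move=> ab; have := half_line_cvg (@continuous_ramp _ a b) (ramp_ge0 a b) (fun x => ramp_left ab).
move=> /cvgrPdist_lt /(_ 1 ltr01); apply: filterS => n; rewrite ltr_norml => /andP[n1 n2].
have /andP[p1 p2] := pairing_ramp M2eta atoms ab.
have /andP[q1 q2] := pairing_ramp (M2eta_ n) (atoms_ n) ab.
split; rewrite -ltnS -(ltr_nat R) -natr1.
  by apply: le_lt_trans q1 _; apply: lt_le_trans (lerD p2 (lexx _)); rewrite addrC -ltrBlDr -opprB ltrNl.
by apply: le_lt_trans p1 _; apply: lt_le_trans (lerD q2 (lexx _)); rewrite addrC -ltrBlDr.
Qed.

(** More than [j] atoms of [eta] lie beyond y - e/2 and at most [j] beyond y; [above_cvg] transfers
    this to the approximating measures at the levels y - e and y + e. *)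
Lemma sorted_pos_cvg j (e : R) : sorted_dom eta j -> 0 < e -> \forall n \near \oo,
  sorted_dom (eta_ n) j /\ `|sorted_pos eta j - sorted_pos (eta_ n) j| <= e.
Proof.
move=> Jj e0; set y := sorted_pos eta j.
have h1 : y - e / 2 < y by lra.
have h2 : y - e < y - e / 2 by lra.
have h3 : y < y + e by lra.
have j1 : (j < above eta (y - e / 2))%N by rewrite -(lt_sorted_pos M2eta atoms).
have j2 : (above eta y <= j)%N.
  by rewrite leqNgt -(lt_sorted_pos M2eta atoms)// ltxx.
apply: filterS2 (above_cvg h2) (above_cvg h3) => n [_ n2] [n3 _].
have j3 : (j < above (eta_ n) (y - e))%N by exact: leq_trans j1 n2.
have Jn : sorted_dom (eta_ n) j by exists (y - e).
split => //; rewrite ler_norml lerBrDl lerBlDl; apply/andP; split.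
  rewrite addrC leNgt (lt_sorted_pos (M2eta_ n) (atoms_ n))// -leqNgt.
  exact: leq_trans n3 j2.
by rewrite lerBlDr -lerBlDl ltW// (lt_sorted_pos (M2eta_ n) (atoms_ n)).
Qed.

Lemma sorted_val_cvg (f : R -> R) j : continuous f -> (forall x, 0 <= f x) ->
  f x @[x --> -oo] --> 0 ->
  (fun n => sorted_val (eta_ n) f j) @ \oo --> sorted_val eta f j.
Proof.
move=> cf f0 fNy; rewrite {2}/sorted_val; case: asboolP => [Jj|nJj].
  have cv : \forall n \near \oo, sorted_dom (eta_ n) j.
    by apply: filterS (sorted_pos_cvg Jj ltr01) => n [].
  have yc : (fun n => sorted_pos (eta_ n) j) @ \oo --> sorted_pos eta j.
    by apply/cvgrPdist_le => e e0; apply: filterS (sorted_pos_cvg Jj e0) => n [].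
  apply: cvg_trans (cvg_comp _ _ yc (cf _)); apply: near_eq_cvg.
  by apply: filterS cv => n Jn; rewrite /sorted_val asboolT.
(* Here [eta] has at most [j] atoms, so the atom of rank [j] in the approximating measures is
   eventually missing or below any given level, where [f] is small. *)
apply/cvgrPdist_lt => e e0.
have [a [_ fa]] := (cvgrPdist_lt _ _).1 fNy e e0.
have aa : a - 2 < a - 1 by lra.
apply: filterS (above_cvg aa) => n [nj _].
rewrite sub0r normrN /sorted_val; case: asboolP => Jn; last by rewrite normr0.
have := fa (sorted_pos (eta_ n) j); rewrite sub0r normrN; apply.
rewrite ltNge; apply/negP => ya.
have : a - 1 < sorted_pos (eta_ n) j by lra.
rewrite (lt_sorted_pos (M2eta_ n) (atoms_ n))// => jn.
by apply: nJj; exists (a - 2); exact: leq_trans jn nj.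
Qed.

(** The difference of [tail] and [alpha] is continuous, non-negative and zero below -1, hence
    covered by [half_line_cvg]; the metric controls [alpha] itself. *)
Lemma pairing_tail_cvg k :
  (fun n => pairing (tail k.+1%:R) (eta_ n)) @ \oo --> pairing (tail k.+1%:R) eta.
Proof.
pose psi (z : R) : R := tail k.+1%:R z - alpha k.+1 z.
have cpsi : continuous psi.
  by move=> z; apply: cvgB; [exact: continuous_tail|exact: continuous_alpha].
have psi0 z : 0 <= psi z by rewrite subr_ge0; case/andP: (alpha_le_tail k.+1 z).
have psi1 z : z <= -1 -> psi z = 0.
  by move=> z1; rewrite /psi /alpha z1 tail_neg ?subrr// (le_trans z1)// lerN10.
have D (mu : measure_on_line R) : inM2 mu -> pairing (tail k.+1%:R) mu = pairing (alpha k.+1) mu + pairing psi mu.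
  move=> M2mu; have fin_tail := inM2_tail_integrable (k := k.+1%:R) M2mu (ltr0Sn _ _).
  have mpsi := continuous_measurable_fun cpsi.
  have malpha := continuous_measurable_fun (@continuous_alpha R k.+1).
  have split_tail : (\int[mu]_x (tail k.+1%:R x)%:E =
      \int[mu]_x (alpha k.+1 x)%:E + \int[mu]_x (psi x)%:E)%E.
    rewrite -ge0_integralD//.
    - by apply: eq_integral => z _; rewrite -EFinD /psi addrC subrK.
    - by move=> z _; rewrite lee_fin; case/andP: (alpha_le_tail k.+1 z).
    - exact/measurable_EFinP.
    - by move=> z _; rewrite lee_fin.
    - exact/measurable_EFinP.
  have A0 : (0 <= \int[mu]_x (alpha k.+1 x)%:E)%E.
    by apply: integral_ge0 => z _; rewrite lee_fin; case/andP: (alpha_le_tail k.+1 z).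
  have B0 : (0 <= \int[mu]_x (psi x)%:E)%E by apply: integral_ge0 => z _; rewrite lee_fin.
  have Aoo := le_lt_trans (leeDl _ B0) (eq_ind _ (fun v => v < +oo)%E fin_tail _ split_tail).
  have Boo := le_lt_trans (leeDr _ A0) (eq_ind _ (fun v => v < +oo)%E fin_tail _ split_tail).
  by rewrite /pairing /Rintegral split_tail fineD// ge0_fin_numE.
rewrite (D eta)//; under eq_fun do rewrite D//.
by apply: cvgD; [exact: eta_alpha|exact: half_line_cvg psi1].
Qed.

Lemma tail_cvgNy (k : R) : 0 < k -> tail k x @[x --> -oo] --> 0.
Proof.
move=> k0; apply/cvgrPdist_le => e e0; pose M := Num.max 1 (k / e).
have M1 : 1 <= M by rewrite le_max lexx.
exists (- M); split; first exact: num_real.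
move=> z zM; have z0 : z <= 0 by lra.
rewrite sub0r normrN ger0_norm ?tail_ge0// tail_neg// expRN.
rewrite -[leRHS]invrK lef_pV2 ?posrE ?expR_gt0 ?invr_gt0//.
have zk : z ^+ 2 / k <= expR (z ^+ 2 / k).
  by apply: le_trans (expR_ge1Dx _); rewrite lerDr.
apply: le_trans zk; rewrite ler_pdivlMr// mulrC.
apply: (@le_trans _ _ M); first by rewrite le_max lexx orbT.
by rewrite expr2 -mulrNN -[leLHS]mul1r; apply: ler_pM => //; lra.
Qed.

Lemma sorted_tail_cvg k : (fun n => \esum_(j in setT)
    (`|sorted_val (eta_ n) (tail k.+1%:R) j - sorted_val eta (tail k.+1%:R) j|)%:E)%E
  @ \oo --> 0%E.
Proof.
have t0 (z : R) : 0 <= tail k.+1%:R z := tail_ge0 _ _.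
have s0 (mu : measure_on_line R) j : 0 <= sorted_val mu (tail k.+1%:R) j :> R.
  by rewrite /sorted_val; case: ifP.
have fin_tail (mu : measure_on_line R) : inM2 mu -> (\int[mu]_x (tail k.+1%:R x)%:E < +oo)%E.
  by move=> M2mu; exact: inM2_tail_integrable.
have sI (mu : measure_on_line R) I' x' : inM2 mu -> sums_diracs I' x' mu ->
    (\esum_(j in setT) (sorted_val mu (tail k.+1%:R) j)%:E = (pairing (tail k.+1%:R) mu)%:E)%E.
  move=> M2mu amu; rewrite -(integral_sorted M2mu amu (measurable_tail k.+1%:R) t0) fineK//.
  by rewrite ge0_fin_numE ?fin_tail//; apply: integral_ge0 => z _; rewrite lee_fin.
apply: scheffe => //.
- move=> j; apply: sorted_val_cvg => //; first exact: continuous_tail.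
  exact: tail_cvgNy.
- by rewrite (sI _ _ _ M2eta atoms) ltry.
- by move=> n; rewrite (sI _ _ _ (M2eta_ n) (atoms_ n)) ltry.
- rewrite (sI _ _ _ M2eta atoms); under eq_fun do rewrite (sI _ _ _ (M2eta_ _) (atoms_ _)).
  by apply/cvg_EFin; [exact: nearW|exact: pairing_tail_cvg].
Qed.

End deterministic_convergence.

(** * The law of theta *)

Lemma eq_dirac_sum {R : realType} {J : choiceType} (D D' : set J) (y y' : J -> R)
    (A : set (measurableTypeR R)) :
  D = D' -> (forall j, D j -> y j = y' j) -> dirac_sum D y A = dirac_sum D' y' A.
Proof. by move=> <- yy; apply: eq_esum => j Dj; rewrite yy. Qed.

Lemma eq_theta {R : realType} {d} {Omega : measurableType d}
    (tau tau' : nat -> seq bool -> Omega -> R) X X' (I : set nat) (x : nat -> R) t w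
    (A : set (measurableTypeR R)) :
  (forall i, I i -> tau i = tau' i) -> (forall i, I i -> X i = X' i) ->
  theta tau X I x t w A = theta tau' X' I x t w A.
Proof.
move=> tt XX; apply: eq_dirac_sum.
  by apply/seteqP; split => -[i u] /= [Ii]; rewrite ?tt// -?tt.
by move=> [i u] /= [Ii _]; rewrite tt// XX.
Qed.

Section law_of_theta.
Context {R : realType} {d : measure_display} {Omega : measurableType d}.
Variable P : probability Omega R.
Implicit Types (tau : nat -> seq bool -> Omega -> R)
  (X : nat -> seq bool -> R -> Omega -> R) (I : set nat) (x : nat -> R).

(** [theta] as a deterministic functional on [pathspace], so that its law depends on the law of
    [state] only. *)
Definition state_theta I x (t : R) (f : @pathspace R state_index) : measure_on_line R :=
  dirac_sum [set p : nat * seq bool | I p.1 /\ f (p, true) <> 0]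
    (fun p => x p.1 + f (p, false) - Num.sqrt 2 * t).

Lemma theta_state tau X I x t w A :
  theta tau X I x t w A = state_theta I x t (fun k => state tau X t k w) A.
Proof.
apply: eq_dirac_sum.
  apply/seteqP; split => -[i u] /= [Ii]; rewrite /alive; first by move=> ->; split => //; exact/eqP/oner_neq0.
  by case: (_ <= _ < _).
by move=> [i u] /= [_ /andP[bt _]]; rewrite position_clipped.
Qed.

Variables (h : nat -> R -> R) (h_C0 : forall k, C0plus (h k)).
Variables (F : M2 h -> R) (F_continuous : continuous F).

Lemma measurable_state_theta I x t :
  measurable_fun setT ((fun f => extend_M2 F (state_theta I x t f)) : pathspace -> R).
Proof.
have mon (p : nat * seq bool) : measurable
    [set f : @pathspace R state_index | I p.1 /\ f (p, true) <> 0].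
  have [Ip|nIp] := pselect (I p.1); last first.
    by rewrite (_ : mkset _ = set0)//; apply/seteqP; split => f //= [].
  rewrite (_ : mkset _ = (fun f : @pathspace R state_index => f (p, true)) @^-1` (~` [set 0])).
    rewrite -[X in measurable X]setTI.
    have m0 : measurable ([set~ 0] : set R) by apply: measurableC; exact: measurable_set1.
    exact: (measurable_coordinate (p, true)) m0.
  by apply/seteqP; split => f /= => [[]|].
have mz (p : nat * seq bool) : measurable_fun setT
    ((fun f => x p.1 + f (p, false) - Num.sqrt 2 * t) : @pathspace R state_index -> R).
  by apply: measurable_funB => //; apply: measurable_funD => //; exact: measurable_coordinate.
apply: (measurable_extend_M2 F_continuous).
- exact: (measurable_random_inM2 mon mz).
- exact: (measurable_random_max mon mz).
- move=> k; have [ch h0 _] := h_C0 k.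
  exact: (measurable_random_pairing mon mz (continuous_measurable_fun ch) h0).
- move=> k; apply: (measurable_random_pairing mon mz).
    exact: continuous_measurable_fun (@continuous_alpha R k.+1).
  by move=> z; case/andP: (alpha_le_tail k.+1 z).
Qed.

Lemma extend_theta_state tau X I x t w :
  extend_M2 F (theta tau X I x t w) =
  extend_M2 F (state_theta I x t (fun k => state tau X t k w)).
Proof. by apply: (eq_extend_M2 F_continuous) => A _; exact: theta_state. Qed.

Lemma measurable_extend_theta tau X I x t : iid_BBMs P tau X ->
  measurable_fun setT (fun w => extend_M2 F (theta tau X I x t w)).
Proof.
move=> iid; under eq_fun do rewrite extend_theta_state.
apply: (measurableT_comp (measurable_state_theta I x t)).
by apply: (measurable_fun_pathspace (V := state tau X t)) => k; exact: measurable_state iid.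
Qed.

Lemma extend_M2_bounded : (exists C : R, forall eta : M2 h, `|F eta| <= C) ->
  exists2 C : R, 0 <= C & forall eta, `|extend_M2 F eta| <= C.
Proof.
move=> [C FC]; exists `|C| => // eta; rewrite /extend_M2; case: pselect => [M2eta|_].
  by rewrite (le_trans (FC _))// ler_norm.
by rewrite normr0.
Qed.

Hypothesis F_bounded : exists C : R, forall eta : M2 h, `|F eta| <= C.

Lemma expectation_theta_eqlaw tau X tau' X' I x t :
  iid_BBMs P tau X -> iid_BBMs P tau' X' ->
  ('E_P[fun w => extend_M2 F (theta tau X I x t w)] =
   'E_P[fun w => extend_M2 F (theta tau' X' I x t w)])%E.
Proof.
move=> iid iid'; have [C _ FC] := extend_M2_bounded F_bounded.
rewrite unlock.
under eq_integral do rewrite extend_theta_state.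
under [RHS]eq_integral do rewrite extend_theta_state.
apply: (eqlaw_bounded_integral (C := C)
    (g := (fun f => extend_M2 F (state_theta I x t f)))) => //.
- by move=> k; exact: measurable_state iid.
- by move=> k; exact: measurable_state iid'.
- exact: state_eqlaw.
- exact: measurable_state_theta.
Qed.

Lemma iid_BBMs_inj tau X (s : nat -> nat) : injective s -> iid_BBMs P tau X ->
  iid_BBMs P (tau \o s) (X \o s).
Proof.
move=> sI [bbm ind]; split => [i|]; first exact: bbm.
exact: (mutually_independent_inj sI ind).
Qed.

(** A relabelling of the atoms is traded for a relabelling of the BBMs, under which the law is
    invariant. *)
Lemma theta_relabel tau X I J x y (r : nat -> nat) t w A :
  set_bij I J r -> (forall i, I i -> y (r i) = x i) ->
  theta tau X J y t w A = theta (tau \o r) (X \o r) I x t w A.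
Proof.
move=> [rJ rI rs] yx; rewrite /theta/= /dirac_sum.
rewrite (reindex_esum [set p : nat * seq bool | I p.1 /\ alive (tau (r p.1)) t w p.2] _
    (fun p => (r p.1, p.2)))/=.
  by apply: eq_esum => -[i u] /= [Ii _]; rewrite yx.
split.
- by move=> [i u] /= [Ii al]; split => //; exact: rJ.
- move=> [i u] [i' u'] /set_mem /= [Ii _] /set_mem /= [Ii' _] [rr ->].
  by rewrite (rI i i')// mem_set.
- move=> [j u] /= [Jj al]; have [i Ii ij] := rs j Jj.
  by exists (i, u); rewrite /= ij.
Qed.

(* The BBM of the atom of rank j gets number 2 j, so that the relabelling
   extends to an injection of nat, the odd numbers serving outside I. *)
Lemma expectation_theta_sorted tau X I x t (eta : measure_on_line R) :
  iid_BBMs P tau X -> inM2 eta -> sums_diracs I x eta ->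
  ('E_P[fun w => extend_M2 F (theta tau X I x t w)] =
   'E_P[fun w => extend_M2 F (theta (tau \o double) (X \o double)
     (sorted_dom eta) (sorted_pos eta) t w)])%E.
Proof.
move=> iid M2eta atoms; have [r [rbij ry]] := sorted_bijection M2eta atoms.
pose s i := if `[< I i >] then (r i).*2 else (i.*2).+1.
have sI : injective s.
  move=> i j; rewrite /s; case: asboolP => Ii; case: asboolP => Ij.
  - move=> /double_inj rr; case: rbij => _ rI _.
    by apply: rI; rewrite ?mem_set.
  - by move=> e; have := odd_double (r i); rewrite e /= odd_double.
  - by move=> e; have := odd_double (r j); rewrite -e /= odd_double.
  - by move=> [] /double_inj.
rewrite (expectation_theta_eqlaw I x t iid (iid_BBMs_inj sI iid)) unlock.
apply: eq_integral => w _; congr EFin; apply: (eq_extend_M2 F_continuous) => A _.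
rewrite (theta_relabel _ _ _ _ _ rbij ry); apply: eq_theta => i Ii /=.
  by rewrite /s asboolT.
by rewrite /s asboolT.
Qed.

End law_of_theta.

Section dirac_sum_reindex.
Context {R : realType} {T : countType}.

(** Particles are labelled by [nat * seq bool], while the lemmas on atoms take enumerations by
    [nat]. *)
Lemma dirac_sum_pickle (D : set T) (y : T -> R) :
  sums_diracs (choice.pickle @` D) (fun n => oapp y 0 (choice.unpickle n)) (dirac_sum D y).
Proof.
move=> A mA; rewrite /dirac_sum (reindex_esum D (choice.pickle @` D) choice.pickle).
  by apply: eq_esum => j _; rewrite choice.pickleK.
split; first by move=> j Dj; exists j.
- by move=> i j _ _; exact: (pcan_inj choice.pickleK).
- by move=> _ [j Dj <-]; exists j.
Qed.

End dirac_sum_reindex.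

(** With m the maximum of [mu], the ramp from m - e to m - e/2 has integral at least 1 and the ramp
    from m to m + e has integral 0. Once the integrals are within 1 of these values, integrality of
    counts places the maximum of the approximating measure in ]m - e, m + e]. *)
Lemma max_atom_cvg {R : realType} (mu_ : nat -> measure_on_line R) (mu : measure_on_line R)
    (I_ : nat -> set nat) x_ I x :
  (forall n, inM2 (mu_ n)) -> inM2 mu ->
  (forall n, sums_diracs (I_ n) (x_ n) (mu_ n)) -> sums_diracs I x mu ->
  (forall a b, a < b -> (fun n => pairing (ramp a b) (mu_ n)) @ \oo --> pairing (ramp a b) mu) ->
  (fun n => max_atom (mu_ n)) @ \oo --> max_atom mu.
Proof.
move=> M2mu_ M2mu atoms_ atoms cv; apply/cvgrPdist_le => e e0; set m := max_atom mu.
have h1 : m - e < m - e / 2 by lra.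
have h2 : m - e / 2 < m by lra.
have h3 : m < m + e by lra.
have up : (0 < above mu (m - e / 2))%N by rewrite (above_gt0 M2mu atoms).
have down : above mu m = 0%N.
  by apply/eqP; rewrite -leqn0 leqNgt (above_gt0 M2mu atoms) ltxx.
have /andP[r1 _] := pairing_ramp M2mu atoms h1.
have /andP[_ s2] := pairing_ramp M2mu atoms h3.
have := cv _ _ h1 => /cvgrPdist_lt /(_ 1 ltr01).
have := cv _ _ h3 => /cvgrPdist_lt /(_ 1 ltr01).
apply: filterS2 => n; rewrite !ltr_norml => /andP[sn _] /andP[_ rn].
have /andP[_ r2] := pairing_ramp (M2mu_ n) (atoms_ n) h1.
have /andP[s1 _] := pairing_ramp (M2mu_ n) (atoms_ n) h3.
have up1 : 1 <= (above mu (m - e / 2))%:R :> R by rewrite ler1n.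
have down0 : (above mu m)%:R = 0 :> R by rewrite down.
have lo : m - e < max_atom (mu_ n).
  rewrite -(above_gt0 (M2mu_ n) (atoms_ n)) -(ltr_nat R).
  apply: lt_le_trans r2; move: r1 rn up1; move: (pairing _ mu) (pairing _ (mu_ n)) (_%:R) => u v k.
  lra.
have hi : max_atom (mu_ n) <= m + e.
  rewrite leNgt -(above_gt0 (M2mu_ n) (atoms_ n)) -leqNgt -ltnS -(ltr_nat R).
  apply: le_lt_trans s1 _; move: s2 sn down0; move: (pairing _ mu) (pairing _ (mu_ n)) (_%:R) => u v k.
  lra.
by rewrite ler_norml; apply/andP; split; lra.
Qed.

Lemma ramp_le_tail {R : realType} (a b x : R) : a < b ->
  ramp a b x <= (tail 1 a)^-1 * tail 1 x.
Proof.
move=> ab; have [xa|ax] := leP x a.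
  by rewrite ramp_left// mulr_ge0 ?invr_ge0 ?tail_ge0.
have ta : 0 < tail 1 a by exact: expR_gt0.
apply: le_trans (ramp_le1 _ _ _) _; rewrite mulrC ler_pdivlMr// mul1r.
by apply: tail_homo => //; exact: ltW.
Qed.

Lemma C0plus_le_tail {R : realType} (f : R -> R) : C0plus f ->
  exists2 C : R, 0 <= C & forall x, f x <= C * tail 1 x.
Proof.
move=> [cf f0 cS]; have [M [_ SM]] := compact_bounded cS.
pose K : set R := `[- (Num.max M 0 + 1), Num.max M 0 + 1]%classic.
have M1 : M < Num.max M 0 + 1 by rewrite ltr_pwDr// le_max lexx.
have SK x : f x != 0 -> K x.
  move=> fx; have /(SM _ M1) : closure [set x | f x != 0] x by exact: subset_closure.
  by rewrite /K /= in_itv/= ler_norml.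
have cK : {within K, continuous f} by apply: continuous_subspaceT.
have [B BK] : exists B : R, forall x, K x -> f x <= B.
  by have [B [_ BK]] := compact_bounded (continuous_compact cK (@segment_compact R _ _));
    exists (B + 1) => x Kx; apply: le_trans (ler_norm _) _; apply: BK; [rewrite ltrDl|exists x].
have ta : 0 < tail 1 (- (Num.max M 0 + 1)) by exact: expR_gt0.
exists (`|B| / tail 1 (- (Num.max M 0 + 1))); first by rewrite divr_ge0// ltW.
move=> x; have [fx|fx] := eqVneq (f x) 0.
  by rewrite fx mulr_ge0 ?tail_ge0// divr_ge0// ltW.
have Kx := SK x fx; rewrite mulrAC ler_pdivlMr//; apply: ler_pM => //.
- exact: ltW.
- by rewrite (le_trans (BK x Kx))// ler_norm.
- by apply: tail_homo => //; move: Kx; rewrite /K /= in_itv/= => /andP[].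
Qed.

Fixpoint words (n : nat) : seq (seq bool) :=
  if n is m.+1 then [::] :: map (cons false) (words m) ++ map (cons true) (words m)
  else [:: [::]].

Lemma mem_words u n : (size u <= n)%N -> u \in words n.
Proof.
elim: n u => [|n ih] [|b u] //= un.
by rewrite inE/= mem_cat; case: b; rewrite map_f ?orbT// ih.
Qed.

(** The sums satisfy S(n+1) = 1 + S(n)/2, a recursion with fixed point 2. *)
Lemma words_sum {R : realType} n : \sum_(u <- words n) 4 ^- size u <= 2 :> R.
Proof.
elim: n => [|n ih] /=; first by rewrite big_seq1 expr0 invr1 ler1n.
have E (b : bool) : \sum_(u <- map (cons b) (words n)) 4 ^- size u =
    4^-1 * \sum_(u <- words n) 4 ^- size u :> R.
  by rewrite big_map mulr_sumr; apply: eq_bigr => u _; rewrite /= exprS invfM.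
rewrite big_cons big_cat !E /= expr0 invr1; lra.
Qed.

Lemma ler_sum_subset {R : realDomainType} {I : eqType} (f : I -> R) (s l : seq I) :
  (forall i, 0 <= f i) -> uniq s -> {subset s <= l} ->
  \sum_(i <- s) f i <= \sum_(i <- l) f i.
Proof.
move=> f0; elim: s l => [|i s ih] l /=; first by rewrite big_nil sumr_ge0.
move=> /andP[is_ us] sl; have il : i \in l by apply: sl; rewrite mem_head.
rewrite big_cons (big_rem i il)/= lerD2l; apply: ih => // j js.
have : j \in l by apply: sl; rewrite inE js orbT.
rewrite (perm_mem (perm_to_rem il)) inE => /predU1P[ji|//].
by move: is_; rewrite -ji js.
Qed.

Lemma esum_words {R : realType} :
  (\esum_(u in [set: seq bool]) (4 ^- size u : R)%:E <= 2%:E)%E.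
Proof.
apply: ge_ereal_sup => _ [X [finX _] <-].
rewrite fsbig_finite//= sumEFin lee_fin.
apply: le_trans (words_sum (\max_(u <- fset_set X) size u)).
apply: ler_sum_subset => [u||u uX]; first by rewrite invr_ge0 exprn_ge0.
- exact: fset_uniq.
- by apply: mem_words; rewrite (big_rem u uX)/= leq_maxl.
Qed.

(** * Convergence of the coupled processes *)

Lemma esumZ {R : realType} {T : countType} (K : R) (g : T -> R) : 0 <= K ->
  (forall p, 0 <= g p) ->
  (\esum_(p in setT) (K * g p)%:E = K%:E * \esum_(p in setT) (g p)%:E)%E.
Proof.
move=> K0 g0; rewrite !esum_pickle; [|by move=> p; rewrite lee_fin ?mulr_ge0..].
rewrite -nneseriesZl//; last by move=> i _; apply: along_pickle_ge0 => p; rewrite lee_fin.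
apply: eq_eseriesr => i _; rewrite /along_pickle; case: pickle_inv => [p|]/=.
  by rewrite EFinM.
by rewrite mule0.
Qed.

Section fixed_environment.
Context {R : realType} {d : measure_display} {Omega : measurableType d}.
Variables (tau : nat -> seq bool -> Omega -> R) (X : nat -> seq bool -> R -> Omega -> R).
Variables (t : R) (t_ge0 : 0 <= t) (w : Omega).

Definition pair_weight (p : nat * seq bool) : R := weight (tau p.1) (X p.1) t p.2 w.

Definition displacement (p : nat * seq bool) : R :=
  clipped_position (tau p.1) (X p.1) t p.2 w - Num.sqrt 2 * t.

(* The factor 8 (t + 1) makes z^2 / m, where z is the displacement, at most
   the exponent of [weight] up to a constant. *)
Lemma tail_displacement (m x : R) p : 8 * (t + 1) <= m ->
  alive (tau p.1) t w p.2 ->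
  tail m (x + displacement p) <= expR (t ^+ 2) * (tail (2 * m) x * pair_weight p).
Proof.
move=> tm al; have m0 : 0 < m by apply: lt_le_trans tm; rewrite mulr_gt0// ltr_wpDl.
have t0 := t_ge0.
(* [m4] absorbs the drift, 2 (sqrt 2 t)^2 = 4 t^2 <= t^2 m, and [m8] the Brownian part, 2 q^2 / m <=
   q^2 / (4 (t + 1)). *)
have m4 : 4 <= m by lra.
have m8 : 2 * (4 * (t + 1)) <= m by lra.
apply: le_trans (tail_shift _ _ m0) _.
rewrite mulrCA ler_wpM2l ?tail_ge0// /pair_weight /weight indicE mem_set// mul1r -expRD ler_expR.
rewrite /displacement; set q := clipped_position _ _ _ _ _; set r := Num.sqrt 2 * t.
have r2 : r ^+ 2 = 2 * t ^+ 2 by rewrite /r exprMn sqr_sqrtr.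
have qr : (q - r) ^+ 2 <= 2 * q ^+ 2 + 2 * r ^+ 2.
  by rewrite -subr_ge0 (_ : _ - _ = (q + r) ^+ 2) ?sqr_ge0//; ring.
have t1 : 0 < 4 * (t + 1) by rewrite mulr_gt0// ltr_wpDl.
rewrite ler_pdivrMr//; apply: (le_trans qr); rewrite r2 [leRHS]mulrDl addrC.
apply: lerD.
  rewrite (_ : 2 * (2 * t ^+ 2) = t ^+ 2 * 4); last by ring.
  by rewrite ler_wpM2l ?sqr_ge0.
by rewrite mulrAC [leLHS]mulrC [leRHS]mulrC ler_wpM2l ?sqr_ge0// mulrC ler_pdivlMr.
Qed.

Section one_configuration.
Variables (eta : measure_on_line R) (f : R -> R).

Definition theta_term (p : nat * seq bool) : R :=
  \1_[set p | alive (tau p.1) t w p.2] p * sorted_val eta (fun x => f (x + displacement p)) p.1.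

Lemma integral_theta : measurable_fun setT f -> (forall x, 0 <= f x) ->
  (\int[theta tau X (sorted_dom eta) (sorted_pos eta) t w]_x (f x)%:E =
   \esum_(p in setT) (theta_term p)%:E)%E.
Proof.
move=> mf f0; rewrite /theta ge0_integral_dirac_sum; last 2 first.
- exact/measurable_EFinP.
- by move=> z; rewrite lee_fin.
apply: eq_esum => p _; rewrite /restrict0 /theta_term /sorted_val indicE /=.
case: asboolP => [[Jp al]|nJal].
  rewrite asboolT// mem_set// mul1r /displacement position_clipped ?addrA//.
  by case/andP: al.
case: asboolP => Jp; last by rewrite mulr0.
by rewrite memNset ?mul0r// => al; exact: nJal.
Qed.

End one_configuration.

Lemma theta_term_ge0 eta f p : (forall x, 0 <= f x) -> 0 <= theta_term eta f p.
Proof. by move=> f0; rewrite mulr_ge0// /sorted_val; case: ifP. Qed.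

Lemma theta_term_le (f : R -> R) (C : R) (k : nat) : 0 <= C ->
  (forall x, f x <= C * tail k.+1%:R x) ->
  exists l : nat, forall eta p, theta_term eta f p <=
    C * expR (t ^+ 2) * (sorted_val eta (tail l.+1%:R) p.1 * pair_weight p).
Proof.
(* [m] is at least [k.+1], to bound the given tail, and at least 8 (t + 1), as [tail_displacement]
   requires; the predecessor below compensates the successor in the index of the tails. *)
move=> C0 fC; pose m := (k.+1 + (Num.truncn (8 * (t + 1))).+1)%N.
have km : k.+1%:R <= m%:R :> R by rewrite ler_nat leq_addr.
have tm : 8 * (t + 1) <= m%:R.
  by apply: (@le_trans _ _ (Num.truncn (8 * (t + 1))).+1%:R); [exact/ltW/truncnS_gt|rewrite ler_nat leq_addl].
exists (2 * m).-1 => eta p.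
have m2 : ((2 * m).-1.+1)%:R = 2 * m%:R :> R by rewrite prednK ?natrM// muln_gt0.
rewrite /theta_term /sorted_val indicE m2; case: asboolP => Jp; last by rewrite !mulr0 mul0r mulr0.
have [|] := boolP (p \in _); last first.
  by rewrite mul0r !mulr_ge0 ?expR_ge0 ?tail_ge0// /pair_weight weight_ge0.
move=> /set_mem al; rewrite mul1r -mulrA; apply: le_trans (fC _) _; rewrite ler_wpM2l//.
apply: le_trans (tail_displacement _ tm al).
by apply: tail_le => //; rewrite ltr0n.
Qed.

Variables (eta_ : nat -> measure_on_line R) (eta : measure_on_line R).
Variables (I_ : nat -> set nat) (x_ : nat -> nat -> R) (I : set nat) (x : nat -> R).
Hypothesis M2eta_ : forall n, inM2 (eta_ n).
Hypothesis M2eta : inM2 eta.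
Hypothesis atoms_ : forall n, sums_diracs (I_ n) (x_ n) (eta_ n).
Hypothesis atoms : sums_diracs I x eta.
Hypothesis eta_vague : vague_cvg eta_ eta.
Hypothesis eta_max : (fun n => max_atom (eta_ n)) @ \oo --> max_atom eta.

Definition tail_weight (mu : measure_on_line R) (k : nat) (p : nat * seq bool) : R :=
  sorted_val mu (tail k.+1%:R) p.1 * pair_weight p.

Lemma tail_weight_ge0 mu k p : 0 <= tail_weight mu k p.
Proof.
by rewrite mulr_ge0 ?weight_ge0// /sorted_val; case: ifP => // _; exact: tail_ge0.
Qed.

Hypothesis fin_weight : forall k, (\esum_(p in setT) (tail_weight eta k p)%:E < +oo)%E.
Hypothesis fin_weight_ : forall n k, (\esum_(p in setT) (tail_weight (eta_ n) k p)%:E < +oo)%E.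
Hypothesis cvg_weight : forall k, (fun n => \esum_(p in setT)
  (`|tail_weight (eta_ n) k p - tail_weight eta k p|)%:E)%E @ \oo --> 0%E.
Hypothesis some_alive : exists u, alive (tau 0) t w u.

Let Theta_ n := theta tau X (sorted_dom (eta_ n)) (sorted_pos (eta_ n)) t w.
Let Theta := theta tau X (sorted_dom eta) (sorted_pos eta) t w.

(** Termwise, this is [sorted_val_cvg] for [f] translated by the displacement; the majorants are
    multiples of [tail_weight] and vary with [n]. *)
Lemma integral_theta_cvg (f : R -> R) (C : R) (k : nat) : 0 <= C ->
  continuous f -> (forall x, 0 <= f x) -> (forall x, f x <= C * tail k.+1%:R x) ->
  (fun n => \int[(Theta_ n)]_x (f x)%:E)%E @ \oo --> (\int[(Theta)]_x (f x)%:E)%E.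
Proof.
move=> C0 cf f0 fC; have [l lP] := theta_term_le C0 fC.
have mf := continuous_measurable_fun cf.
rewrite integral_theta//; under eq_fun do rewrite integral_theta//.
pose K := C * expR (t ^+ 2).
have K0 : 0 <= K by rewrite mulr_ge0 ?expR_ge0.
apply: (esum_dominated_cvg_moving (b_ := fun n p => K * tail_weight (eta_ n) l p)
    (b := fun p => K * tail_weight eta l p)).
- by move=> n p; rewrite theta_term_ge0//=; exact: lP.
- move=> p; rewrite /theta_term; apply: cvgM; first exact: cvg_cst.
  apply: (sorted_val_cvg M2eta_ M2eta atoms_ atoms eta_vague eta_max) => //.
    move=> z; apply: (cvg_comp (fun z => z + displacement p) f); last exact: cf.
    by apply: cvgD; [exact: cvg_id|exact: cvg_cst].
  have tc : C * tail k.+1%:R x0 @[x0 --> -oo] --> 0.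
    by rewrite -[X in _ --> X](mulr0 C); apply: cvgM; [exact: cvg_cst|exact: tail_cvgNy].
  have fc : f z @[z --> -oo] --> 0.
    apply: (squeeze_cvgr _ (cvg_cst 0) tc); apply: nearW => z.
    by rewrite f0 fC.
  apply/cvgrPdist_lt => e e0; have [a [ar fa]] := (cvgrPdist_lt _ _).1 fc e e0.
  exists (a - displacement p); split; first exact: num_real.
  by move=> z za; apply: fa; lra.
- rewrite esumZ//; last by move=> p; exact: tail_weight_ge0.
  by rewrite lte_mul_pinfty.
- have -> : (fun n => \esum_(p in setT) (`|K * tail_weight (eta_ n) l p - K * tail_weight eta l p|)%:E)%E =
      (fun n => K%:E * \esum_(p in setT) (`|tail_weight (eta_ n) l p - tail_weight eta l p|)%:E)%E.
    apply/funext => n; rewrite -esumZ//; apply: eq_esum => p _.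
    by rewrite -mulrBr normrM ger0_norm.
  by rewrite -(mule0 K%:E); apply: cvgeZl => //; exact: cvg_weight.
Qed.

(** Every measure in M_2 has an atom of rank 0, which carries the BBM of number 0; survival of that
    single BBM makes the result nonzero. *)
Lemma theta_inM2 mu J y : inM2 mu -> sums_diracs J y mu ->
  (forall k, (\esum_(p in setT) (tail_weight mu k p)%:E < +oo)%E) ->
  inM2 (theta tau X (sorted_dom mu) (sorted_pos mu) t w).
Proof.
move=> M2mu amu fin_mu; apply: tail_integrable_inM2.
- exact: dirac_sum_integer.
- rewrite gt_eqF//; apply/dirac_sum_gt0; have [u au] := some_alive.
  exists (0%N, u) => //; split => //=.
  have [j [a ja]] := inM2_dirac_sum_neq0 (eq_inM2 (sorted_atoms M2mu amu) M2mu).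
  by exists a; exact: leq_ltn_trans ja.
- move=> k; rewrite integral_theta; [|exact: measurable_tail|by move=> z; exact: tail_ge0].
  have [|l lP] := @theta_term_le (tail k.+1%:R) 1 k ler01.
    by move=> z; rewrite mul1r.
  apply: (@le_lt_trans _ _ (\esum_(p in setT) (1 * expR (t ^+ 2) * tail_weight mu l p)%:E)%E).
    by apply: le_esum => p _; rewrite lee_fin; exact: lP.
  rewrite esumZ; last 2 first.
  - by rewrite mul1r expR_ge0.
  - by move=> p; exact: tail_weight_ge0.
  by rewrite lte_mul_pinfty// lee_fin mul1r expR_ge0.
Qed.

(** The test functions of both kinds, and the ramps that control the maximum, are all bounded by
    multiples of a tail. *)
Lemma dist2_theta_cvg h : (forall k, C0plus (h k)) ->
  (fun n => dist2 h Theta (Theta_ n)) @ \oo --> 0.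
Proof.
move=> hC0; have M2T := theta_inM2 M2eta atoms fin_weight.
have M2T_ n := theta_inM2 (M2eta_ n) (atoms_ n) (fin_weight_ n).
have pcv (f : R -> R) (C : R) (k : nat) : 0 <= C -> continuous f -> (forall x, 0 <= f x) ->
    (forall x, f x <= C * tail k.+1%:R x) ->
    (fun n => pairing f (Theta_ n)) @ \oo --> pairing f Theta.
  move=> C0 cf f0 fC; have cv := integral_theta_cvg C0 cf f0 fC.
  apply: fine_cvg; rewrite fineK//.
  rewrite ge0_fin_numE; last by apply: integral_ge0 => z _; rewrite lee_fin.
  apply: (@le_lt_trans _ _ (\int[(Theta)]_x (C * tail k.+1%:R x)%:E)%E).
    apply: ge0_le_integral => //.
    - by move=> z _; rewrite lee_fin.
    - by apply/measurable_EFinP; exact: continuous_measurable_fun cf.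
    - by apply/measurable_EFinP; apply: measurable_funM => //; exact: measurable_tail.
    - by move=> z _; rewrite lee_fin.
  under eq_integral do rewrite EFinM.
  rewrite ge0_integralZl//.
  - by rewrite lte_mul_pinfty// inM2_tail_integrable.
  - by apply/measurable_EFinP; exact: measurable_tail.
  - by move=> z _; rewrite lee_fin tail_ge0.
apply: dist2_cvg0.
- move=> k; have [C C0 hC] := C0plus_le_tail (hC0 k).
  by case: (hC0 k) => ch h0 _; exact: (pcv _ C 0%N).
- apply: (max_atom_cvg M2T_ M2T (fun n => dirac_sum_pickle _ _) (dirac_sum_pickle _ _)).
  move=> a b ab; apply: (pcv _ (tail 1 a)^-1 0%N).
  + by rewrite invr_ge0 tail_ge0.
  + exact: continuous_ramp.
  + exact: ramp_ge0.
  + by move=> z; exact: ramp_le_tail.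
- move=> k; apply: (pcv _ 1 k) => //; first exact: continuous_alpha.
  + by move=> z; case/andP: (alpha_le_tail k.+1 z).
  + by move=> z; rewrite mul1r; case/andP: (alpha_le_tail k.+1 z).
Qed.

End fixed_environment.

Section survival.
Context {R : realType} {d : measure_display} {Omega : measurableType d}.
Variable P : probability Omega R.

Lemma birth_nseqS (tau : seq bool -> Omega -> R) n w :
  birth tau (nseq n.+1 false) w = birth tau (nseq n false) w + tau (nseq n false) w.
Proof.
have take_nseq (k m : nat) : (k <= m)%N -> take k (nseq m false) = nseq k false.
  by elim: k m => [|k ih] [|m] //= km; rewrite ih.
rewrite /birth !size_nseq big_ord_recr/= -[false :: nseq n false]/(nseq n.+1 false) take_nseq//.
congr (_ + _); apply: eq_bigr => j _.
by rewrite (take_nseq _ n.+1 (ltnW (leqW (ltn_ord j)))) (take_nseq _ n (ltnW (ltn_ord j))).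
Qed.

(** If nobody is alive at time [t], all particles on the line [nseq n false] are born by time [t],
    which has probability at most exp(3t) 4^-n for every n. *)
Lemma ae_some_alive (tau : seq bool -> Omega -> R) X (t : R) : is_BBM P tau X -> 0 <= t ->
  {ae P, forall w, exists u, alive tau t w u}.
Proof.
move=> bbm t0; pose N := \bigcap_n [set w | birth tau (nseq n false) w <= t].
have mb n := measurable_birth_le (BBM_lifetime_measurable bbm) t (nseq n false).
have mN : measurable N by exact: bigcapT_measurable.
exists N; split => //.
  apply/eqP; rewrite eq_le measure_ge0 andbT; apply/lee_addgt0Pr => e e0; rewrite add0e.
  have [n ne] := exp2V_small (divr_gt0 e0 (expR_gt0 (3 * t))).
  have le_b : (P N <= P [set w | birth tau (nseq n false) w <= t]%R)%E.
    by apply: le_measure; [exact: (mem_set mN)|exact: (mem_set (mb n))|move=> w; exact].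
  apply: le_trans le_b _; apply: le_trans (birth_probability_le bbm t _) _.
  rewrite lee_fin size_nseq mulrC -ler_pdivlMr ?expR_gt0//; apply: le_trans ne.
  rewrite lef_pV2 ?posrE ?exprn_gt0//; apply: lerXn2r => //; rewrite ?nnegrE//.
  by rewrite ler_nat.
move=> w dead n _ /=; elim: n => [|n ih]; first by rewrite /birth big_ord0.
rewrite birth_nseqS leNgt; apply/negP => tb; apply: dead.
by exists (nseq n false); rewrite /alive ih tb.
Qed.

Lemma ae_lt_pinfty (f : Omega -> \bar R) : measurable_fun setT f ->
  (forall w, 0 <= f w)%E -> (\int[P]_w f w < +oo)%E -> {ae P, forall w, f w < +oo}%E.
Proof.
move=> mf f0 fin_f.
have fi : P.-integrable setT f.
  by apply/integrableP; split => //; under eq_integral do rewrite gee0_abs//.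
move: (integrable_ae measurableT fi); apply: filterS => w /(_ I).
by rewrite ge0_fin_numE.
Qed.

End survival.

Lemma nneseries_cvg0 {R : realType} (a : nat -> \bar R) : (forall n, 0 <= a n)%E ->
  (\sum_(n <oo) a n < +oo)%E -> a @ \oo --> 0%E.
Proof.
move=> a0 fin_a.
have := nneseries_tail_cvg fin_a (fun n _ => a0 n).
move=> tl; apply: (squeeze_cvge _ (cvg_cst 0%E) tl); apply: nearW => n.
rewrite a0/=; apply: le_trans (nneseries_lim_ge n.+1 _) => //.
by rewrite big_nat1.
Qed.

Section weighted_sums.
Context {R : realType} {d : measure_display} {Omega : measurableType d}.
Variable P : probability Omega R.
Variables (tau : nat -> seq bool -> Omega -> R) (X : nat -> seq bool -> R -> Omega -> R).
Variables (t : R) (t_ge0 : 0 <= t).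
Hypothesis iid : iid_BBMs P tau X.

Definition weighted_sum (a : nat -> R) (w : Omega) : \bar R :=
  (\esum_(p in setT) (a p.1 * pair_weight tau X t w p)%:E)%E.

Variable a : nat -> R.
Hypothesis a_ge0 : forall j, 0 <= a j.

Let term_ge0 w p : (0 <= (a p.1 * pair_weight tau X t w p)%:E)%E.
Proof. by rewrite lee_fin mulr_ge0// weight_ge0. Qed.

Lemma weighted_sum_ge0 w : (0 <= weighted_sum a w)%E.
Proof. by apply: esum_ge0. Qed.

Let mterm k : measurable_fun setT (fun w =>
  along_pickle (fun p => (a p.1 * pair_weight tau X t w p)%:E) k).
Proof.
rewrite /along_pickle; case: pickle_inv => [p|]/=; last exact: measurable_cst.
apply/measurable_EFinP; apply: measurable_funM => //.
by apply: (measurable_weight (P := P)); case: iid.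
Qed.

Lemma measurable_weighted_sum : measurable_fun setT (weighted_sum a).
Proof.
rewrite /weighted_sum; under eq_fun do rewrite esum_pickle//.
by apply: measurable_nneseries => // k w; exact: along_pickle_ge0.
Qed.

(** Each label contributes a multiple of 4^-|u|; the factor 2 is the bound on the sum of these over
    all words. *)
Lemma expectation_weighted_sum :
  (\int[P]_w weighted_sum a w <=
   (2 * weight_const t)%:E * \esum_(j in setT) (a j)%:E)%E.
Proof.
rewrite /weighted_sum; under eq_integral do rewrite esum_pickle//.
rewrite integral_nneseries//; last by move=> k w _; exact: along_pickle_ge0.
pose b (p : nat * seq bool) := a p.1 * (weight_const t * 4 ^- size p.2).
have b0 p : 0 <= b p.
  by rewrite !mulr_ge0 ?weight_const_ge0 ?invr_ge0 ?exprn_ge0.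
apply: (@le_trans _ _ (\sum_(k <oo) along_pickle (EFin \o b) k)%E).
  apply: lee_nneseries => [k _|k _].
    by move=> _; apply: integral_ge0 => w _; exact: along_pickle_ge0.
  rewrite /along_pickle; case: pickle_inv => [p|]/=; last by rewrite integral0.
  under eq_integral do rewrite EFinM.
  have [bbm _] := iid.
  rewrite ge0_integralZl//.
  - by rewrite /b EFinM lee_wpmul2l ?lee_fin//; exact: expectation_weight_le.
  - by apply/measurable_EFinP; exact: (measurable_weight (P := P)).
  - by move=> w _; rewrite lee_fin weight_ge0.
  - by rewrite lee_fin.
rewrite -esum_pickle; last by move=> p; rewrite lee_fin.
have -> : (\esum_(p in setT) (EFin \o b) p =
    \esum_(j in setT) \esum_(u in setT) (b (j, u))%:E)%E.
  rewrite (esum_esum (J := fun=> setT) (a := fun j u => (b (j, u))%:E)); last by move=> *; rewrite lee_fin.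
  rewrite (_ : _ `*`` _ = setT); last by apply/seteqP; split.
  by apply: eq_esum => -[].
apply: (@le_trans _ _ (\esum_(j in setT) (2 * weight_const t * a j)%:E)%E); last first.
  by rewrite esumZ// mulr_ge0// weight_const_ge0.
apply: le_esum => j _; rewrite /b/=.
under eq_esum do rewrite mulrA.
rewrite esumZ; last 2 first.
- by rewrite mulr_ge0// weight_const_ge0.
- by move=> u; rewrite invr_ge0 exprn_ge0.
rewrite (_ : 2 * weight_const t * a j = a j * weight_const t * 2); last by ring.
rewrite [leRHS]EFinM; apply: lee_wpmul2l; last exact: esum_words.
by rewrite lee_fin mulr_ge0// weight_const_ge0.
Qed.

End weighted_sums.

Section fast_convergence.
Context {R : realType} {d : measure_display} {Omega : measurableType d}.
Variable P : probability Omega R.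
Variables (h : nat -> R -> R) (h_C0 : forall k, C0plus (h k)).
Variables (F : M2 h -> R) (F_continuous : continuous F).
Hypothesis F_bounded : exists C : R, forall eta : M2 h, `|F eta| <= C.
Variables (tau : nat -> seq bool -> Omega -> R) (X : nat -> seq bool -> R -> Omega -> R).
Variables (t : R) (t_ge0 : 0 <= t).
Hypothesis iid : iid_BBMs P tau X.
Variables (eta_ : nat -> measure_on_line R) (eta : measure_on_line R).
Variables (I_ : nat -> set nat) (x_ : nat -> nat -> R) (I : set nat) (x : nat -> R).
Hypothesis M2eta_ : forall n, inM2 (eta_ n).
Hypothesis M2eta : inM2 eta.
Hypothesis atoms_ : forall n, sums_diracs (I_ n) (x_ n) (eta_ n).
Hypothesis atoms : sums_diracs I x eta.
Hypothesis eta_vague : vague_cvg eta_ eta.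
Hypothesis eta_max : (fun n => max_atom (eta_ n)) @ \oo --> max_atom eta.

Let c (mu : measure_on_line R) (k j : nat) : R := sorted_val mu (tail k.+1%:R) j.

Hypothesis summable_distance : forall k,
  (\sum_(n <oo) \esum_(j in setT) (`|c (eta_ n) k j - c eta k j|)%:E < +oo)%E.

Let c_ge0 mu k j : 0 <= c mu k j.
Proof. by rewrite /c /sorted_val; case: ifP => // _; exact: tail_ge0. Qed.

Let ae_weight_fin mu J y k : inM2 mu -> sums_diracs J y mu ->
  {ae P, forall w, \esum_(p in setT) (tail_weight tau X t w mu k p)%:E < +oo}%E.
Proof.
move=> M2mu amu.
have cfin : (\esum_(j in setT) (c mu k j)%:E < +oo)%E.
  rewrite -(integral_sorted M2mu amu (measurable_tail k.+1%:R) (fun z => tail_ge0 _ z)).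
  exact: inM2_tail_integrable.
apply: (ae_lt_pinfty (measurable_weighted_sum t iid (c_ge0 mu k))).
  by move=> w; exact: weighted_sum_ge0.
apply: le_lt_trans (expectation_weighted_sum t_ge0 iid (c_ge0 mu k)) _.
by rewrite lte_mul_pinfty// lee_fin mulr_ge0// weight_const_ge0.
Qed.

(** The expected weighted distances are summable in [n], so their series is almost surely finite and
    its terms tend to 0. *)
Let ae_weight_cvg k : {ae P, forall w, (fun n => \esum_(p in setT)
  (`|tail_weight tau X t w (eta_ n) k p - tail_weight tau X t w eta k p|)%:E) @ \oo --> 0}%E.
Proof.
pose a (n j : nat) : R := `|c (eta_ n) k j - c eta k j|.
have a0 n j : 0 <= a n j by exact: normr_ge0.
have mw n := measurable_weighted_sum t iid (a0 n).
have w0 n w : (0 <= weighted_sum tau X t (a n) w)%E by exact: weighted_sum_ge0.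
have : (\int[P]_w \sum_(n <oo) weighted_sum tau X t (a n) w < +oo)%E.
  rewrite integral_nneseries//.
  apply: (@le_lt_trans _ _ (\sum_(n <oo) (2 * weight_const t)%:E * \esum_(j in setT) (a n j)%:E)%E).
    apply: lee_nneseries => [n _|n _].
      by move=> _; apply: integral_ge0 => w _; exact: w0.
    exact: expectation_weighted_sum.
  rewrite nneseriesZl//; last by move=> n _; apply: esum_ge0 => j _; rewrite lee_fin.
  apply: lte_mul_pinfty => //; last exact: summable_distance.
  by rewrite lee_fin mulr_ge0// weight_const_ge0.
move=> /(ae_lt_pinfty _ _) ae_fin.
have {ae_fin} : {ae P, forall w, \sum_(n <oo) weighted_sum tau X t (a n) w < +oo}%E.
  apply: ae_fin; last by move=> w; apply: nneseries_ge0 => n _ _; exact: w0.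
  exact: measurable_nneseries.
apply: filterS => w /(nneseries_cvg0 (fun n => w0 n w)) cv.
rewrite [X in X @ _ --> _](_ : _ = fun n => weighted_sum tau X t (a n) w)//.
apply/funext => n; apply: eq_esum => p _.
by rewrite /tail_weight -mulrBl normrM (@ger0_norm _ (pair_weight _ _ _ _ _))// weight_ge0.
Qed.

Lemma expectation_sorted_theta_cvg :
  (fun n => 'E_P[fun w => extend_M2 F
     (theta tau X (sorted_dom (eta_ n)) (sorted_pos (eta_ n)) t w)])%E @ \oo -->
  'E_P[fun w => extend_M2 F (theta tau X (sorted_dom eta) (sorted_pos eta) t w)]%E.
Proof.
have [C _ FC] := extend_M2_bounded F_bounded; rewrite unlock.
apply: (cvg_bounded_integral (C := C)) => //.
- by move=> n; exact: (measurable_extend_theta h_C0 F_continuous _ _ _ iid).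
- exact: (measurable_extend_theta h_C0 F_continuous _ _ _ iid).
have ae_alive := ae_some_alive (iid.1 0%N) t_ge0.
have ae_fin := ae_foralln (fun k => ae_weight_fin k M2eta atoms).
have ae_fin_ := ae_foralln (fun n => ae_foralln (fun k => ae_weight_fin k (M2eta_ n) (atoms_ n))).
have ae_cvg := ae_foralln ae_weight_cvg.
move: ae_cvg; apply: filter_app; move: ae_fin_; apply: filter_app.
move: ae_fin; apply: filter_app; move: ae_alive; apply: filterS => w al fin fin_ cv.
apply: (extend_M2_cvg F_continuous).
- exact: (theta_inM2 t_ge0 al M2eta atoms).
- by move=> n; exact: (theta_inM2 t_ge0 al (M2eta_ n) (atoms_ n)).
- exact: (dist2_theta_cvg t_ge0 M2eta_ M2eta atoms_ atoms eta_vague eta_max).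
Qed.

End fast_convergence.

(** * Passage to a fast subsequence and conclusion *)

Lemma sorted_tail_dist_lty {R : realType} (k : nat) (mu mu' : measure_on_line R)
    (I I' : set nat) (x x' : nat -> R) :
  inM2 mu -> inM2 mu' -> sums_diracs I x mu -> sums_diracs I' x' mu' ->
  (\esum_(j in setT) (`|sorted_val mu (tail k.+1%:R) j -
    sorted_val mu' (tail k.+1%:R) j|)%:E < +oo)%E.
Proof.
move=> M2mu M2mu' amu amu'; have t0 (z : R) : 0 <= tail k.+1%:R z := tail_ge0 _ _.
have s0 (nu : measure_on_line R) j : 0 <= sorted_val nu (tail k.+1%:R) j.
  by rewrite /sorted_val; case: ifP.
apply: (@le_lt_trans _ _ (\esum_(j in setT) ((sorted_val mu (tail k.+1%:R) j)%:E +
    (sorted_val mu' (tail k.+1%:R) j)%:E))%E).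
  apply: le_esum => j _; rewrite -EFinD lee_fin; apply: le_trans (ler_normB _ _) _.
  by rewrite !ger0_norm.
rewrite esumD; [|by move=> j _; rewrite lee_fin..].
apply: lte_add_pinfty.
  by rewrite -(integral_sorted M2mu amu (measurable_tail k.+1%:R) t0) inM2_tail_integrable.
by rewrite -(integral_sorted M2mu' amu' (measurable_tail k.+1%:R) t0) inM2_tail_integrable.
Qed.

(** One subsequence serves all [k]: its term of index [i] controls every [k <= i], so each fixed [k]
    is controlled from index [k] on. *)
Lemma fast_subsequence {R : realType} (D : nat -> nat -> \bar R) :
  (forall k, D ^~ k @ \oo --> 0%E) ->
  exists s : nat -> nat, (forall i, (i <= s i)%N) /\
    forall i k, (k <= i)%N -> (D (s i) k <= (2^-1 ^+ i)%:E)%E.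
Proof.
move=> D0.
have /choice[s sP] : forall i, exists n, (i <= n)%N /\
    forall k, (k <= i)%N -> (D n k <= (2^-1 ^+ i)%:E)%E.
  move=> i; have q0 : (0 : R) < 2^-1 ^+ i by rewrite exprn_gt0.
  have : \forall n \near \oo, (i <= n)%N /\ forall k, (k < i.+1)%N -> (D n k <= (2^-1 ^+ i)%:E)%E.
    elim: i.+1 => [|m ih].
      by exists i => // n /= ni; split.
    have Dm : \forall n \near \oo, (D n m < (2^-1 ^+ i)%:E)%E.
      have V : nbhs (0%E : \bar R) [set y : \bar R | (y < (2^-1 ^+ i)%:E)%E].
        apply: open_nbhs_nbhs; split; last by rewrite /= lte_fin.
        exact: open_ereal_lt_ereal.
      exact: (D0 m _ V).
    apply: filterS2 ih Dm => n [ni ih] Dm; split => // k.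
    by rewrite ltnS leq_eqVlt => /predU1P[->|/ih//]; exact: ltW.
  by case=> N _ /(_ N (leqnn _)) [iN DN]; exists N; split => // k ki; apply: DN.
by exists s; split => [i|i k ki]; [case: (sP i)|case: (sP i) => _; exact].
Qed.

Theorem theorem1p1 (R : realType)
    (h : nat -> R -> R) (h_test : vague_test_sequence h)
    (d : measure_display) (Omega : measurableType d) (P : probability Omega R)
    (tau : nat -> seq bool -> Omega -> R)
    (X : nat -> seq bool -> R -> Omega -> R) (bbm : iid_BBMs P tau X)
    (I : M2 h -> set nat) (x : M2 h -> nat -> R)
    (enum_atoms : forall eta : M2 h, sums_diracs (I eta) (x eta) eta)
    (t : R) (t_ge0 : 0 <= t) (F : M2 h -> R)
    (F_bounded : exists C : R, forall eta : M2 h, `|F eta| <= C)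
    (F_continuous : continuous F) :
  (exists C : R, forall eta : M2 h, `|semigroup P tau X I x t F eta| <= C) /\
  continuous (semigroup P tau X I x t F).
Proof.
have [h_C0 h_cvg] := h_test.
have [C C0 FC] := extend_M2_bounded F_bounded.
have mtheta eta := measurable_extend_theta h_C0 F_continuous (I eta) (x eta) t bbm.
have bound eta : (`|'E_P[fun w => extend_M2 F (theta tau X (I eta) (x eta) t w)]| <= C%:E)%E.
  rewrite unlock; apply: le_trans (le_abse_integral _ measurableT _) _.
    exact/measurable_EFinP.
  apply: (@le_trans _ _ (\int[P]_w C%:E)%E).
    apply: ge0_le_integral => //.
    - by apply: measurableT_comp => //; exact/measurable_EFinP.
    - by move=> w _; rewrite /= lee_fin.
  by rewrite integral_cst//= probability_setT mule1.
have fin_E eta : 'E_P[fun w => extend_M2 F (theta tau X (I eta) (x eta) t w)]%E \is a fin_num.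
  by rewrite fin_num_abs; exact: le_lt_trans (bound eta) (ltry _).
split.
  by exists C => eta; move: (bound eta); rewrite -(fineK (fin_E eta)) /= lee_fin.
move=> eta V /nbhs_ballP[e e0 eV].
suff [n nP] : exists n : nat, forall eta' : M2 h, dist2 h eta eta' < n.+1%:R^-1 ->
    `|semigroup P tau X I x t F eta - semigroup P tau X I x t F eta'| < e.
  apply/nbhs_ballP; exists n.+1%:R^-1; first by rewrite /= invr_gt0.
  by move=> eta' /nP d_eta'; apply: eV; rewrite -ball_normE.
(* If every radius 1/(n+1) fails, a sequence [zeta] converges to [eta] while the values of the
   semigroup stay at distance at least [e]. *)
apply: contrapT => no_n.
have /choice[zeta zetaP] : forall n : nat, exists eta' : M2 h, dist2 h eta eta' < n.+1%:R^-1 /\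
    e <= `|semigroup P tau X I x t F eta - semigroup P tau X I x t F eta'|.
  move=> n; apply: contrapT => no_eta; apply: no_n; exists n => eta' d_eta'.
  by rewrite ltNge; apply/negP => e_eta'; apply: no_eta; exists eta'.
have cvg_dist0 (u : nat -> M2 h) : (forall n, dist2 h eta (u n) < n.+1%:R^-1) ->
    (fun n => dist2 h eta (u n)) @ \oo --> 0.
  move=> un; apply: (squeeze_cvgr _ (cvg_cst 0) (@cvg_harmonic R)).
  by apply: nearW => n; rewrite dist2_ge0 ltW.
have cvgs (u : nat -> M2 h) : (forall n, dist2 h eta (u n) < n.+1%:R^-1) ->
    [/\ vague_cvg (fun n => u n) eta, (fun n => max_atom (u n)) @ \oo --> max_atom eta &
      forall k, (fun n => pairing (alpha k.+1) (u n)) @ \oo --> pairing (alpha k.+1) eta].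
  move=> /cvg_dist0 /cvg_dist2[uh um ua]; split => //.
  by apply: h_cvg => // [n|]; [case: (M2P (u n))|case: (M2P eta)].
pose D n k := (\esum_(j in setT) (`|sorted_val (zeta n) (tail k.+1%:R) j -
  sorted_val eta (tail k.+1%:R) j|)%:E)%E.
have [zv zm za] := cvgs zeta (fun n => (zetaP n).1).
have D0 k : D ^~ k @ \oo --> 0%E.
  exact: (sorted_tail_cvg (fun n => M2P (zeta n)) (M2P eta) (fun n => enum_atoms (zeta n))
    (enum_atoms eta) zv zm za).
have [s [si sD]] := fast_subsequence D0.
(* [n <= s n] preserves the rate 1/(n+1), hence the convergence along [zeta \o s]. *)
have sdist n : dist2 h eta (zeta (s n)) < n.+1%:R^-1.
  apply: lt_le_trans (zetaP (s n)).1 _.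
  by rewrite lef_pV2 ?posrE// ler_nat ltnS.
have [sv sm _] := cvgs (zeta \o s) sdist.
have summable k : (\sum_(n <oo) D (s n) k < +oo)%E.
  apply: (geometric_nneseries_lty (q := 2^-1)).
  - by rewrite invr_gt0 ltr0n invf_lt1 ?ltr1n.
  - move=> n; rewrite (sorted_tail_dist_lty _ (M2P (zeta (s n))) (M2P eta)
      (enum_atoms (zeta (s n))) (enum_atoms eta)) andbT.
    by apply: esum_ge0 => j _; rewrite lee_fin.
  - by exists k => // n /= kn; exact: sD.
(* The coupling: the even-numbered BBMs drive all the sorted initial conditions, in agreement with
   [expectation_theta_sorted]. *)
have cv := expectation_sorted_theta_cvg h_C0 F_continuous F_bounded t_ge0
  (iid_BBMs_inj double_inj bbm)
  (fun n => M2P (zeta (s n))) (M2P eta) (fun n => enum_atoms (zeta (s n))) (enum_atoms eta)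
  sv sm summable.
have semigroup_cvg : (fun n => semigroup P tau X I x t F (zeta (s n))) @ \oo -->
    semigroup P tau X I x t F eta.
  rewrite /semigroup; apply: fine_cvg; rewrite fineK//.
  rewrite (expectation_theta_sorted h_C0 F_continuous F_bounded t bbm (M2P eta) (enum_atoms eta)).
  rewrite [X in X @ _ --> _](_ : _ = fun n => 'E_P[fun w => extend_M2 F
    (theta (tau \o double) (X \o double) (sorted_dom (zeta (s n)))
      (sorted_pos (zeta (s n))) t w)])%E//.
  apply/funext => n.
  exact: (expectation_theta_sorted h_C0 F_continuous F_bounded t bbm (M2P _) (enum_atoms _)).
have /cvgrPdist_lt /(_ e e0) [N _ /(_ N (leqnn _))] := semigroup_cvg.
by rewrite ltNge (zetaP (s N)).2.
Qed.
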